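(* Let $\Gamma$ be a Coxeter diagram with associated Coxeter group $W_\Gamma$ and, for each $k\ge 1$, let $\Gamma^k$ be its $k$-odd graph. The connected components of $\Gamma^k$ are in natural bijection with the conjugacy classes of involutions of rank $k$ in $W_\Gamma$. A representative of the conjugacy class corresponding to a given connected component of $\Gamma^k$ is obtained by choosing any vertex $W_J$ in that component and taking the longest element of the parabolic subgroup $W_J$.
   Context: A Coxeter system $(W,S)$ of finite rank has $S=\{s_i\mid i\in I\}$, $I$ finite, and $W=\langle S\mid (s_is_j)^{m_{i,j}}\ (i,j\in I,\ m_{i,j}<\infty)\rangle$, with $m_{i,i}=1$ and $m_{i,j}=m_{j,i}\in\{2,3,\dots\}\cup\{\infty\}$ for $i\neq j$. Its Coxeter diagram $\Gamma$ has vertex set $V(\Gamma)=S$ and an edge $\{s_i,s_j\}$ iff $m_{i,j}\ge 3$, labeled by $m_{i,j}$ when $m_{i,j}\geq 4$ and unlabeled when $m_{i,j}=3$; one writes $W=W_\Gamma$. An edge is odd if $m_{i,j}$ is finite and odd (this includes unlabeled edges). For $J\subseteq I$, $S_J=\{s_j\mid j\in J\}$, $W_J=\langle S_J\rangle$ is a standard parabolic subgroup of rank $|J|$, and $\Gamma_J$ is the full subgraph of $\Gamma$ on $S_J$. A parabolic subgroup is a conjugate of a standard parabolic subgroup, with the same rank. The longest element of a finite standard parabolic subgroup $W_J$ is its element of maximal word length with respect to $S_J$. An involution is an element of order exactly $2$. The parabolic closure of an element is the smallest parabolic subgroup containing it; the rank of an involution is the rank of its parabolic closure. Odd-adjacency: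 $W_J$ and $W_K$ are odd-adjacent if there exist $\ell\ge1$ and $L,M,X\subseteq I$ such that (1) $W_J=W_L\times W_X$ with $J=L\sqcup X$ and $W_K=W_M\times W_X$ with $K=M\sqcup X$ (internal direct products); (2) $W_L\cong W_M\cong(\mathbb Z/2\mathbb Z)^\ell$; (3) $S_L$ and $S_M$ differ by exactly one generator, i.e. $S_L\setminus S_M=\{s_l\}$ and $S_M\setminus S_L=\{s_m\}$; (4) $\{s_l,s_m\}$ is an odd edge of $\Gamma$. The $k$-odd graph $\Gamma^k$ ($k\ge1$): its vertices are the rank-$k$ standard parabolic subgroups $W_J$ such that every connected component of $\Gamma_J$ is a Coxeter diagram of one of the types $\mathtt A_1$, $\mathtt B_n$ ($n\ge2$), $\mathtt D_{2n}$ ($n\ge2$), $\mathtt E_7$, $\mathtt E_8$, $\mathtt F_4$, $\mathtt G_2$, $\mathtt H_3$, $\mathtt H_4$, $\mathtt I_2(2m)$ ($m\ge2$); two vertices span an edge iff they are odd-adjacent. (All such $W_J$ are finite.) *)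

(* Defs.v *)
From HB Require Import structures.
From mathcomp Require Import all_boot all_order all_fingroup all_algebra.
From mathcomp Require Import boolp classical_sets functions.
Set Implicit Arguments.
Unset Strict Implicit.
Unset Printing Implicit Defensive.

Local Open Scope set_scope.
Local Open Scope classical_set_scope.

(* In a Coxeter matrix, [None] stands for the entry infinity. *)
Definition coxeter_matrix (I : finType) (m : I -> I -> option nat) : Prop :=
  [/\ forall i, m i i = Some 1%N,
      forall i j, m i j = m j i
    & forall i j, i != j -> forall n, m i j = Some n -> (2 <= n)%N].

Definition diagram_edge (I : finType) (m : I -> I -> option nat) : rel I :=
  fun i j => (i != j) && (if m i j is Some n then (3 <= n)%N else true).

Definition odd_diagram_edge (I : finType) (m : I -> I -> option nat) : rel I :=
  fun i j => diagram_edge m i j && (if m i j is Some n then odd n else false).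

(* C is the vertex set of a connected component of the full subgraph on J. *)
Definition diagram_component (I : finType) (m : I -> I -> option nat)
    (J C : {set I}) : Prop :=
  exists2 i, i \in J &
    C = finset (connect
      [rel x y | [&& x \in J, y \in J & diagram_edge m x y]] i).

(* The subscript is the rank, except that [TypeI2 p] has label p. *)
Inductive diagram_type :=
  | TypeA1 | TypeB of nat | TypeD of nat | TypeE7 | TypeE8 | TypeF4 | TypeG2
  | TypeH3 | TypeH4 | TypeI2 of nat.

Definition type_rank (t : diagram_type) : nat :=
  match t with
  | TypeA1 => 1 | TypeB n => n | TypeD n => n | TypeE7 => 7 | TypeE8 => 8
  | TypeF4 => 4 | TypeG2 => 2 | TypeH3 => 3 | TypeH4 => 4 | TypeI2 _ => 2
  end.

(* The labels below are used for 0 <= i < j < rank only. *)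

(* 0 - 1 - 2 - ..., the edge {i, i+1} being labelled c i *)
Definition path_label (c : nat -> nat) (i j : nat) : nat :=
  if j == i.+1 then c i else 2.

(* 0 - 1 - ... - (n-2), with the last vertex n-1 attached to b *)
Definition tripod_label (n b i j : nat) : nat :=
  if ((j == i.+1) && (j.+1 < n)%N) || ((i == b) && (j.+1 == n)) then 3 else 2.

Definition type_label (t : diagram_type) : nat -> nat -> nat :=
  match t with
  | TypeA1 => fun _ _ => 2
  | TypeB n => path_label (fun i => if i.+2 == n then 4 else 3)
  | TypeD n => tripod_label n (n - 3)
  | TypeE7 => tripod_label 7 2
  | TypeE8 => tripod_label 8 2
  | TypeF4 => path_label (fun i => if i == 1%N then 4 else 3)
  | TypeG2 => path_label (fun _ => 6)
  | TypeH3 | TypeH4 => path_label (fun i => if i == 0%N then 5 else 3)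
  | TypeI2 p => path_label (fun _ => p)
  end.

Definition type_entry (t : diagram_type) (i j : nat) : nat :=
  if i == j then 1%N else type_label t (minn i j) (maxn i j).

Definition has_diagram_type (I : finType) (m : I -> I -> option nat)
    (C : {set I}) (t : diagram_type) : Prop :=
  exists phi : 'I_(type_rank t) -> I,
    [/\ injective phi, C = [set phi a | a : 'I_(type_rank t)]%SET
      & forall a b, m (phi a) (phi b) = Some (type_entry t a b)].

Definition allowed_type (t : diagram_type) : bool :=
  match t with
  | TypeB n => (2 <= n)%N
  | TypeD n => (4 <= n)%N && ~~ odd n
  | TypeI2 p => (4 <= p)%N && ~~ odd p
  | _ => true
  end.

Local Open Scope group_scope.

Definition coxeter_relations (I : finType) (m : I -> I -> option nat)
    (G : groupType) (f : I -> G) : Prop :=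
  forall i j n, m i j = Some n -> (f i * f j) ^+ n = 1.

Definition is_subgroup (W : groupType) (H : set W) : Prop :=
  [/\ H 1, forall x y, H x -> H y -> H (x * y) & forall x, H x -> H x^-1].

Definition generated_by (W : groupType) (A : set W) : set W :=
  [set x | forall H, is_subgroup H -> A `<=` H -> H x].

(* W = < s_i | (s_i s_j)^(m i j) >, through the universal property of the
   presentation. *)
Definition coxeter_system (I : finType) (m : I -> I -> option nat)
    (W : groupType) (s : I -> W) : Prop :=
  [/\ coxeter_relations m s,
      generated_by (range s) = setT
    & forall (G : groupType) (f : I -> G), coxeter_relations m f ->
        exists2 phi : W -> G,
          {morph phi : x y / x * y} & forall i, phi (s i) = f i].

Definition std_parabolic (I : finType) (W : groupType) (s : I -> W)
    (J : {set I}) : set W :=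
  generated_by [set s j | j in [set` J]].

Definition conj_set (W : groupType) (A : set W) (g : W) : set W :=
  [set x ^ g | x in A].

Definition parabolic (I : finType) (W : groupType) (s : I -> W)
    (P : set W) : Prop :=
  exists J g, P = conj_set (std_parabolic s J) g.

Definition parabolic_rank (I : finType) (W : groupType) (s : I -> W)
    (P : set W) (r : nat) : Prop :=
  exists J g, P = conj_set (std_parabolic s J) g /\ #|J| = r.

Definition parabolic_closure (I : finType) (W : groupType) (s : I -> W)
    (w : W) (P : set W) : Prop :=
  [/\ parabolic s P, P w & forall Q, parabolic s Q -> Q w -> P `<=` Q].

Definition involution (W : groupType) (w : W) : Prop := w <> 1 /\ w * w = 1.

Definition involution_rank (I : finType) (W : groupType) (s : I -> W)
    (w : W) (r : nat) : Prop :=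
  involution w /\
  exists2 P, parabolic_closure s w P & parabolic_rank s P r.

Definition conj_class (W : groupType) (w : W) : set W := range (conjg w).

Definition involution_classes (I : finType) (W : groupType) (s : I -> W)
    (k : nat) : set (set W) :=
  [set conj_class w | w in [set w | involution_rank s w k]].

(* Words in S_J without inverses suffice, as the generators are involutions. *)
Definition is_word (I : finType) (W : groupType) (s : I -> W) (J : {set I})
    (w : W) (u : seq I) : Prop :=
  {subset u <= J} /\ w = \prod_(i <- u) s i.

Definition word_length (I : finType) (W : groupType) (s : I -> W)
    (J : {set I}) (w : W) (n : nat) : Prop :=
  (exists2 u, is_word s J w u & size u = n) /\
  (forall u, is_word s J w u -> (n <= size u)%N).

Definition longest (I : finType) (W : groupType) (s : I -> W) (J : {set I})
    (w : W) : Prop :=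
  exists2 n, word_length s J w n
    & forall v p, word_length s J v p -> (p <= n)%N.

Definition internal_direct_product (W : groupType) (A B C : set W) : Prop :=
  [/\ forall a b, A a -> B b -> a * b = b * a,
      A `&` B = [set 1]
    & C = [set a * b | a in A & b in B]].

Definition elementary_2group (W : groupType) (A : set W) (l : nat) : Prop :=
  exists phi : 'rV['Z_2]_l -> W,
    [/\ forall u v, phi (u + v)%R = phi u * phi v, injective phi
      & range phi = A].

(* The subgroups W_J and W_K are given by their index sets J and K. *)
Definition odd_adjacent (I : finType) (m : I -> I -> option nat)
    (W : groupType) (s : I -> W) (J K : {set I}) : Prop :=
  exists (l : nat) (L M X : {set I}),
    (1 <= l)%N /\
    [/\ [/\ J = L :|: X, L :&: X = finset.set0 & internal_direct_product
              (std_parabolic s L) (std_parabolic s X) (std_parabolic s J)],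
        [/\ K = M :|: X, M :&: X = finset.set0 & internal_direct_product
              (std_parabolic s M) (std_parabolic s X) (std_parabolic s K)],
        elementary_2group (std_parabolic s L) l,
        elementary_2group (std_parabolic s M) l
      & exists a b, [/\ L :\: M = [set a]%SET, M :\: L = [set b]%SET
                      & odd_diagram_edge m a b]].

(* As J |-> W_J is injective, the vertices of the k-odd graph are encoded as
   subsets J of the index set. *)
Definition odd_graph_vertex (I : finType) (m : I -> I -> option nat)
    (k : nat) (J : {set I}) : Prop :=
  #|J| = k /\
  forall C, diagram_component m J C ->
    exists2 t, allowed_type t & has_diagram_type m C t.

Definition odd_graph_edge (I : finType) (m : I -> I -> option nat)
    (W : groupType) (s : I -> W) (k : nat) : rel {set I} :=
  fun J K => `[< [/\ odd_graph_vertex m k J, odd_graph_vertex m k K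
                   & odd_adjacent m s J K] >].

Definition odd_graph_components (I : finType) (m : I -> I -> option nat)
    (W : groupType) (s : I -> W) (k : nat) : set {set {set I}} :=
  [set finset (connect (odd_graph_edge m s k) J)
     | J in [set J | odd_graph_vertex m k J]].

(* Main.v *)
From HB Require Import structures.
Require Import Defs.
From mathcomp Require Import all_boot all_order all_fingroup all_algebra.
From mathcomp Require Import boolp classical_sets functions.
From mathcomp Require Import zify ring lra.
From mathcomp Require Import reals trigo.
From mathcomp Require Rstruct.
Import fintype boot.finset.
Set Implicit Arguments.
Unset Strict Implicit.
Unset Printing Implicit Defensive.
Import Order.TTheory GRing.Theory Num.Theory.
Local Open Scope ring_scope.

(* W acts faithfully on its geometric representation V, sending each root to a
   positive or a negative vector. By Richardson's argument (descent on the
   length) every involution is conjugate to an element w_J of some W_J acting as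
   -1 on V_J; such a w_J is the longest element of W_J, and W_J is its parabolic
   closure. If w_J and w_K are conjugate, the conjugating element maps V_J to V_K
   and, up to W_K, maps the simple roots of J onto those of K. Such an element is
   a product of elementary steps J -> J' inside J + i, each of which is given by
   the longest elements of W_J and of the finite group W_(J+i). As -1 is realized
   on J, a step changes J only when the component of i in J + i is of a type for
   which -1 is not realized, and two different vertices of it have complements
   on which -1 is realized: this forces a single odd edge isolated from the rest
   of J, which is odd-adjacency.

   The subsets J on which -1 is realized are those with allowed components.
   Weighting the branches of a diagram by vectors with h_x <= 0 on the branch
   leaves only the finite types. For the allowed ones -1 is obtained from a root
   orthogonal to a smaller set, or as a power of a Coxeter element. For A_n,
   D_odd and E_6 it is excluded because -1 would force the quotient of the weight
   lattice by the root lattice to have exponent 2. *)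

(** * Chebyshev polynomials and cosines *)

(** The group is given only by the universal property of its presentation, so lengths and subgroups
    become tractable only through the geometric representation. Membership in [W_J] is read off
    supports, since elements of [W_J] change vectors only inside [V_J], and minimality in a coset is
    read off signs of roots. The field enters through a few facts about cosines, collected in a
    record over any ordered field: monotonicity, exact values for small labels, and the Chebyshev
    identities of a half turn. Finiteness of [W_N] is never a statement about cardinals. One element
    making all simple roots of [N] negative yields the inequality [nonaff], and this alone drives
    the classification. A step adds [i] to [J] and drops another vertex, so both vertices have
    complements in [J + i] carrying -1. Among the connected types without -1, E_6 has no such
    vertex, D_odd at most one, and A_n two of them only for n = 2. What remains is A_2 and I_2(odd),
    the odd edges. *)

(* With a shifted index: [cheb x n] is U_(n-1)(x), the Chebyshev polynomial of
   the second kind. *)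
Fixpoint cheb (R : nzRingType) (x : R) (n : nat) : R :=
  match n with
  | 0 => 0
  | 1 => 1
  | (n'.+1 as n1).+1 => 2 * x * cheb x n1 - cheb x n'
  end.

Lemma chebSS (R : nzRingType) (x : R) n :
  cheb x n.+2 = 2 * x * cheb x n.+1 - cheb x n.
Proof. by []. Qed.

Lemma cheb1 (R : numDomainType) n : cheb 1 n = n%:R :> R.
Proof.
suff: cheb 1 n = n%:R :> R /\ cheb 1 n.+1 = n.+1%:R :> R by case.
elim: n => [|n [IH1 IH2]]; split=> //.
rewrite chebSS IH1 IH2 mulr1 -natrM -natrB; last by rewrite mul2n -addnn; lia.
by congr _%:R; lia.
Qed.

(* [c n] stands for cos (pi / n). *)
Record cosine_table (R : realFieldType) := CosineTable {
  ct :> nat -> R;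
  ct_1 : ct 1 = -1;
  ct_2 : ct 2 = 0;
  ct_3 : ct 3 = 1 / 2;
  ct_4 : 2 * ct 4 ^+ 2 = 1;
  ct_5 : 4 * ct 5 ^+ 2 = 2 * ct 5 + 1;
  ct_6 : 4 * ct 6 ^+ 2 = 3;
  ct_homo : forall n k, (0 < k)%N -> (k <= n)%N -> ct k <= ct n;
  ct_lt1 : forall n, (1 < n)%N -> ct n < 1;
  cheb_ct_ge0 : forall n k, (1 < n)%N -> (k <= n)%N -> 0 <= cheb (ct n) k;
  cheb_ct_n : forall n, (1 < n)%N -> cheb (ct n) n = 0;
  cheb_ct_Sn : forall n, (1 < n)%N -> cheb (ct n) n.+1 = -1 }.

Definition cosm (R : realType) (n : nat) : R := cos (pi / n%:R).

(** * Real cosines and their table *)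

Section Trig.
Variable R : realType.
Implicit Types (n k : nat).
Local Notation c := (cosm R).

Lemma sin_cheb (t : R) n : sin t * cheb (cos t) n = sin (n%:R * t).
Proof.
suff: sin t * cheb (cos t) n = sin (n%:R * t) /\
      sin t * cheb (cos t) n.+1 = sin (n.+1%:R * t) by case.
elim: n => [|n [IH1 IH2]]; split => //=.
- by rewrite mulr0 mul0r sin0.
- by rewrite mulr1 mul1r.
rewrite mulrBr mulrCA IH1 -/(cheb _ n.+1) IH2.
have -> : n.+2%:R * t = n.+1%:R * t + t by rewrite -(natr1 n.+1) mulrDl mul1r.
have -> : n%:R * t = n.+1%:R * t - t.
  by rewrite -natr1 mulrDl mul1r addrK.
rewrite sinB sinD; ring.
Qed.

Lemma pin_gt0 n : (1 < n)%N -> 0 < (pi : R) / n%:R < pi.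
Proof.
move=> n1; have p0 := pi_gt0 R.
have n0 : 0 < n%:R :> R by rewrite ltr0n; lia.
rewrite divr_gt0 //= ltr_pdivrMr // ltr_pMr // ltr1n //.
Qed.

Lemma sinpin_gt0 n : (1 < n)%N -> 0 < sin ((pi : R) / n%:R).
Proof. by move=> /pin_gt0; exact: sin_gt0_pi. Qed.

Lemma cheb_cosm n k : (1 < n)%N ->
  cheb (c n) k = sin (k%:R * (pi / n%:R)) / sin (pi / n%:R).
Proof.
move=> n1; rewrite -sin_cheb mulrAC mulfV ?mul1r //.
exact: lt0r_neq0 (sinpin_gt0 n1).
Qed.

Lemma cheb_cosm_ge0 n k : (1 < n)%N -> (k <= n)%N -> 0 <= cheb (c n) k.
Proof.
move=> n1 kn; rewrite cheb_cosm // divr_ge0 //; last exact: ltW (sinpin_gt0 n1).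
apply: sin_ge0_pi; have p0 := pi_gt0 R.
have n0 : 0 < n%:R :> R by rewrite ltr0n; lia.
rewrite mulr_ge0 //=; last by rewrite divr_ge0 // ltW.
rewrite mulrCA ger_pMr // ler_pdivrMr // mul1r ler_nat //.
Qed.

Lemma cheb_cosm_n n : (1 < n)%N -> cheb (c n) n = 0.
Proof.
move=> n1; rewrite cheb_cosm // mulrCA mulfV ?mulr1 ?sinpi ?mul0r //.
by rewrite pnatr_eq0; lia.
Qed.

Lemma cheb_cosm_Sn n : (1 < n)%N -> cheb (c n) n.+1 = -1.
Proof.
move=> n1; rewrite cheb_cosm // -natr1 mulrDl mul1r mulrCA mulfV ?mulr1; last first.
  by rewrite pnatr_eq0; lia.
rewrite addrC sinDpi mulNr mulfV //; exact: lt0r_neq0 (sinpin_gt0 n1).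
Qed.

Lemma cosm_homo n k : (0 < k)%N -> (k <= n)%N -> c k <= c n.
Proof.
move=> k0 kn; have p0 := pi_gt0 R.
have k0' : 0 < k%:R :> R by rewrite ltr0n.
have n0' : 0 < n%:R :> R by rewrite ltr0n; lia.
have H j : (0 < j)%N -> (pi : R) / j%:R \in `[0, pi].
  move=> j0; rewrite in_itv /=; apply/andP; split; first exact/divr_ge0/ler0n/ltW.
  by rewrite ler_pdivrMr ?ltr0n // ler_pMr // ler1n.
rewrite /cosm leNgt ltr_cos ?H //; last by lia.
rewrite -leNgt ler_pM2l // lef_pV2 ?posrE // ler_nat //.
Qed.

Lemma cosm1 : c 1 = -1.
Proof. by rewrite /cosm divr1 cospi. Qed.

Lemma cosm2 : c 2 = 0.
Proof. exact: cos_pihalf. Qed.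

Lemma cosm_ge0 n : (1 < n)%N -> 0 <= c n.
Proof. by move=> n1; rewrite -cosm2 cosm_homo. Qed.

Lemma cosm_lt1 n : (1 < n)%N -> c n < 1.
Proof.
move=> n1; have := sinpin_gt0 n1; have := cos2Dsin2 ((pi : R) / n%:R).
have := cos_le1 ((pi : R) / n%:R); rewrite -/(c n); nra.
Qed.

Lemma cosm3 : c 3 = 1 / 2.
Proof.
have := @cheb_cosm_n 3 isT; have := @cosm_ge0 3 isT => /=.
nra.
Qed.

(** The values for 4, 5 and 6 are roots of [cheb x n]; monotonicity against a smaller label singles
    out the right factor. *)
Lemma cosm4 : 2 * c 4 ^+ 2 = 1.
Proof.
have := @cheb_cosm_n 4 isT; have := @cosm_ge0 4 isT => /=.
have : c 3 <= c 4 by exact: cosm_homo.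
rewrite cosm3; nra.
Qed.

Lemma cosm5 : 4 * c 5 ^+ 2 = 2 * c 5 + 1.
Proof.
have := @cheb_cosm_n 5 isT; have := @cosm_ge0 5 isT => /=.
have : c 3 <= c 5 by exact: cosm_homo.
rewrite cosm3 => h1 h2 h3.
have : (4 * c 5 ^+ 2 - 2 * c 5 - 1) * (4 * c 5 ^+ 2 + 2 * c 5 - 1) = 0.
  rewrite -[RHS]h3; ring.
move/eqP; rewrite mulf_eq0 => /orP[/eqP|/eqP]; nra.
Qed.

Lemma cosm6 : 4 * c 6 ^+ 2 = 3.
Proof.
have := @cheb_cosm_n 6 isT; have := @cosm_ge0 6 isT => /=.
have : c 4 <= c 6 by exact: cosm_homo.
have := cosm4; have : c 3 <= c 4 by exact: cosm_homo.
rewrite cosm3 => h0 h00 h1 h2 h3.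
have : c 6 * (4 * c 6 ^+ 2 - 1) * (4 * c 6 ^+ 2 - 3) = 0.
  by rewrite -[RHS](mulr0 2^-1) -h3; field.
move/eqP; rewrite !mulf_eq0 => /orP[/orP[/eqP|/eqP]|/eqP]; nra.
Qed.

Definition cosm_table : cosine_table R :=
  @CosineTable R (cosm R) cosm1 cosm2 cosm3 cosm4 cosm5 cosm6
    cosm_homo cosm_lt1 cheb_cosm_ge0 cheb_cosm_n cheb_cosm_Sn.

End Trig.

(** * The geometric representation *)

Section ChebLemmas.
Variables (R : realFieldType) (x : R) (n : nat).
Hypotheses (Un : cheb x n = 0) (USn : cheb x n.+1 = -1).

(** A half turn changes the sign: both sides satisfy the same recurrence of order two and agree for
    [k = 0] and [k = 1]. *)
Lemma cheb_shift k : cheb x (n + k) = - cheb x k.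
Proof.
suff: cheb x (n + k) = - cheb x k /\ cheb x (n + k).+1 = - cheb x k.+1 by case.
elim: k => [|k [IH1 IH2]]; first by rewrite addn0 Un USn /= oppr0.
rewrite addnS; split=> //; rewrite chebSS IH1 IH2 chebSS; ring.
Qed.

Lemma cheb_double : cheb x n.*2 = 0.
Proof. by rewrite -addnn cheb_shift Un oppr0. Qed.

Lemma cheb_doubleS : cheb x n.*2.+1 = 1.
Proof. by rewrite -addnn -addnS cheb_shift USn opprK. Qed.

Lemma cheb_doubleP : (0 < n)%N -> cheb x n.*2.-1 = -1.
Proof.
move: cheb_double cheb_doubleS; case: n => // k.
rewrite doubleS (chebSS x k.*2.+1) => -> h _; rewrite -pred_Sn.
by move: h; rewrite mulr0 sub0r => <-; rewrite opprK.
Qed.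

End ChebLemmas.

Section GeometricRepresentation.
Variables (I : finType) (m : I -> I -> option nat).
Hypothesis m_cox : coxeter_matrix m.
Variables (R : realFieldType) (c : cosine_table R).
Implicit Types (i j l : I) (k n : nat) (J K : {set I}).

Lemma ct_ge0 n : (1 < n)%N -> 0 <= c n.
Proof. by move=> n1; rewrite -(ct_2 c) ct_homo. Qed.

Notation V := {ffun I -> R^o}.
Implicit Types (u v w : V).

(** The Tits form on simple roots. The diagonal label 1 gives 1 since [c 1 = -1]; an infinite label
    gets the limit value -1. *)
Definition bform i j : R := if m i j is Some n then - c n else -1.

Definition delta i : V := [ffun j => (j == i)%:R : R^o].

(* The linear form B(alpha_i, -). *)
Definition hform i v : R := \sum_j bform i j * v j.

Definition refl i v : V := v - (2 * hform i v) *: delta i.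

Definition actw (s : seq I) v : V := foldr refl v s.

Lemma mii i : m i i = Some 1%N. Proof. by case: m_cox. Qed.
Lemma m_sym i j : m i j = m j i. Proof. by case: m_cox. Qed.
Lemma m_ge2 i j n : i != j -> m i j = Some n -> (1 < n)%N.
Proof. by move=> ij; case: m_cox => _ _ /(_ _ _ ij n). Qed.

Lemma b_ii i : bform i i = 1.
Proof. by rewrite /bform mii ct_1 opprK. Qed.
Lemma b_sym i j : bform i j = bform j i.
Proof. by rewrite /bform m_sym. Qed.
Lemma b_le0 i j : i != j -> bform i j <= 0.
Proof.
move=> ij; rewrite /bform; case E: (m i j) => [n|]; last by lra.
by rewrite oppr_le0 ct_ge0 // (m_ge2 ij).
Qed.

Lemma h_linear i : linear_for *%R (hform i).
Proof.
move=> a u v; rewrite /hform mulr_sumr -big_split /=; apply: eq_bigr => j _.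
by rewrite !ffunE /= mulrDr; congr (_ + _); rewrite mulrCA.
Qed.
HB.instance Definition _ i :=
  GRing.isLinear.Build R V R *%R (hform i) (@h_linear i).

Lemma h_delta i j : hform i (delta j) = bform i j.
Proof.
rewrite /hform (bigD1 j) //= ffunE eqxx mulr1 big1 ?addr0 // => k kj.
by rewrite ffunE (negPf kj) mulr0.
Qed.

Lemma refl_linear i : linear (refl i).
Proof.
move=> a u v; rewrite /refl linearP /= mulrDr scalerDl scalerBr scalerA.
rewrite opprD addrACA; do 4 f_equal; ring.
Qed.
HB.instance Definition _ i :=
  GRing.isLinear.Build R V V *:%R (refl i) (@refl_linear i).

Lemma actw_linear s : linear (actw s).
Proof. by elim: s => // i s IH a u v; rewrite /= IH linearP. Qed.
HB.instance Definition _ s :=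
  GRing.isLinear.Build R V V *:%R (actw s) (@actw_linear s).

Lemma actw_cat s t v : actw (s ++ t) v = actw s (actw t v).
Proof. by rewrite /actw foldr_cat. Qed.

Lemma actw_rcons s i v : actw (rcons s i) v = actw s (refl i v).
Proof. by rewrite -cats1 actw_cat. Qed.

Lemma reflE i v j : refl i v j = v j - 2 * hform i v * (j == i)%:R.
Proof. by rewrite !ffunE. Qed.

Lemma reflEne i v j : j != i -> refl i v j = v j.
Proof. by move=> /negPf ji; rewrite reflE ji mulr0 subr0. Qed.

Lemma deltaE i j : delta i j = (j == i)%:R. Proof. by rewrite ffunE. Qed.

Lemma deltaii i : delta i i = 1. Proof. by rewrite deltaE eqxx. Qed.

Lemma delta_neq0 i : delta i != 0.
Proof. by apply/eqP => /ffunP/(_ i)/eqP; rewrite !ffunE eqxx oner_eq0. Qed.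

Lemma h_refl i v : hform i (refl i v) = - hform i v.
Proof. rewrite /refl linearB linearZ /= h_delta b_ii; ring. Qed.

Lemma reflK i : involutive (refl i).
Proof.
move=> v; rewrite {1}/refl h_refl /refl -addrA -opprD -scalerDl.
have -> : 2 * hform i v + 2 * - hform i v = 0 by ring.
by rewrite scale0r subr0.
Qed.

Lemma refl_delta i : refl i (delta i) = - delta i.
Proof.
rewrite /refl h_delta b_ii mulr1 -[X in X - _]scale1r -scalerBl -[RHS]scaleN1r.
by congr (_ *: _); ring.
Qed.

Lemma refl_fix i v : hform i v = 0 -> refl i v = v.
Proof. by move=> h0; rewrite /refl h0 mulr0 scale0r subr0. Qed.

Lemma actw_rev s v : actw (rev s) (actw s v) = v.
Proof.
by elim: s v => // i s IH v; rewrite rev_cons actw_rcons /= reflK IH.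
Qed.

Lemma actw_revK s v : actw s (actw (rev s) v) = v.
Proof. by rewrite -{1}(revK s) actw_rev. Qed.

Lemma decomp v : v = \sum_i (v i : R) *: delta i.
Proof.
apply/ffunP=> j; rewrite sum_ffunE (bigD1 j) //= big1 ?addr0.
  by rewrite !ffunE eqxx; rewrite /GRing.scale /= mulr1.
by move=> k kj; rewrite !ffunE eq_sym (negPf kj) /GRing.scale /= mulr0.
Qed.

Definition form u v : R := \sum_i u i * hform i v.

Lemma form_sym u v : form u v = form v u.
Proof.
rewrite /form; under eq_bigr do rewrite mulr_sumr.
rewrite exchange_big /=; apply: eq_bigr => i _; rewrite mulr_sumr.
apply: eq_bigr => j _; rewrite b_sym; ring.
Qed.

Lemma form_linear u : linear_for *%R (form u).
Proof.
move=> a v w; rewrite /form mulr_sumr -big_split /=; apply: eq_bigr => j _.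
by rewrite linearP /=; ring.
Qed.
HB.instance Definition _ u :=
  GRing.isLinear.Build R V R *%R (form u) (@form_linear u).

Lemma form_delta i v : form (delta i) v = hform i v.
Proof.
rewrite /form (bigD1 i) //= deltaii mul1r big1 ?addr0 // => k ki.
by rewrite deltaE (negPf ki) mul0r.
Qed.

Lemma form_refl i u v : form (refl i u) (refl i v) = form u v.
Proof.
rewrite {2}/refl linearB linearZ /= form_sym (form_sym _ (delta i)) form_delta.
by rewrite h_refl /refl linearB linearZ /= !(form_sym v) form_delta; ring.
Qed.

Lemma form_actw s u v : form (actw s u) (actw s v) = form u v.
Proof. by elim: s => // i s IH; rewrite /= form_refl. Qed.

Lemma form_root s i : form (actw s (delta i)) (actw s (delta i)) = 1.
Proof. by rewrite form_actw form_delta h_delta b_ii. Qed.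

(* Length [k], last letter [j], so that [j] acts first. *)
Fixpoint alt i j (k : nat) : seq I :=
  if k is k'.+1 then rcons (alt j i k') j else [::].

Lemma size_alt i j k : size (alt i j k) = k.
Proof. by elim: k i j => //= k IH i j; rewrite size_rcons IH. Qed.

Lemma mem_alt i j k l : l \in alt i j k -> l = i \/ l = j.
Proof.
elim: k i j => //= k IH i j; rewrite mem_rcons inE => /orP[/eqP->|]; first by right.
by case/IH; auto.
Qed.

Lemma refl_pair i j (p q : R) :
  refl j (p *: delta i + q *: delta j) =
  p *: delta i + (- 2 * bform i j * p - q) *: delta j.
Proof.
rewrite /refl linearD !linearZ /= !h_delta b_ii -addrA scalerN -scaleNr -scalerDl b_sym.
by do 2 f_equal; ring.
Qed.

(** On the plane of two simple roots each reflection replaces one coordinate according to the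
    Chebyshev recurrence, so an orbit runs through consecutive values of [U]. The induction needs an
    arbitrary starting index [n]. *)
Lemma alt_act k n i j (U := cheb (- bform i j)) :
  actw (alt i j k) (U n.+1 *: delta i + U n *: delta j) =
  if odd k then U (n + k)%N *: delta i + U (n + k).+1 *: delta j
  else U (n + k).+1 *: delta i + U (n + k)%N *: delta j.
Proof.
elim: k n i j @U => [|k IH] n i j U /=; first by rewrite addn0.
rewrite actw_rcons refl_pair addrC.
have -> : - 2 * bform i j * U n.+1 - U n = U n.+2 by rewrite /U chebSS; ring.
rewrite {1 2}/U b_sym IH addSnnS.
by case: (odd k); rewrite addrC b_sym.
Qed.

Lemma alt_act0 k i j (U := cheb (- bform i j)) :
  actw (alt i j k) (delta i) =
  if odd k then U k *: delta i + U k.+1 *: delta j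
  else U k.+1 *: delta i + U k *: delta j.
Proof.
rewrite -(alt_act k 0 i j); congr (actw _ _).
by rewrite (_ : cheb _ 1 = 1) // (_ : cheb _ 0 = 0) // scale1r scale0r addr0.
Qed.

Lemma alt_doubleS i j k : alt i j k.+1.*2 = rcons (rcons (alt i j k.*2) i) j.
Proof. by []. Qed.

Lemma actw_alt_iter i j k v :
  actw (alt i j k.*2) v = iter k (fun v => refl i (refl j v)) v.
Proof.
elim: k v => // k IH v.
by rewrite alt_doubleS !actw_rcons IH -iterSr.
Qed.

Lemma alt_relation i j n v : m i j = Some n -> actw (alt i j n.*2) v = v.
Proof.
have [<-|ij] := eqVneq i j.
  rewrite mii => -[<-]; by rewrite actw_alt_iter /= reflK.
move=> mij; have n1 := m_ge2 ij mij; have n0 : (0 < n)%N by lia.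
pose x : R := - bform i j.
have xc : x = c n by rewrite /x /bform mij opprK.
have U0 : cheb x n = 0 by rewrite xc cheb_ct_n.
have U1 : cheb x n.+1 = -1 by rewrite xc cheb_ct_Sn.
have bx : bform i j = - x by rewrite /x opprK.
have di : actw (alt i j n.*2) (delta i) = delta i.
  rewrite alt_act0 -/x odd_double cheb_double // cheb_doubleS //.
  by rewrite scale1r scale0r addr0.
have dj : actw (alt i j n.*2) (delta j) = delta j.
  have -> : n.*2 = n.*2.-1.+1 by lia.
  rewrite /= actw_rcons refl_delta linearN /=.
  rewrite alt_act0 b_sym -/x.
  have -> : odd n.*2.-1 by have := odd_double n; lia.
  rewrite cheb_doubleP // prednK; last by lia.
  by rewrite cheb_double // scale0r addr0 scaleN1r opprK.
have x0 : 0 <= x by rewrite xc ct_ge0.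
have x1 : x < 1 by rewrite xc ct_lt1.
have D0 : 1 - x ^+ 2 != 0 by apply: lt0r_neq0; nra.
(* [p] and [q] solve the linear system that makes [z] orthogonal to the plane; its Gram determinant
   [1 - x ^+ 2] is nonzero because the label is finite. *)
pose p := (hform i v + x * hform j v) / (1 - x ^+ 2).
pose q := (hform j v + x * hform i v) / (1 - x ^+ 2).
pose z := v - (p *: delta i + q *: delta j).
have hiz : hform i z = 0.
  by rewrite /z linearB linearD !linearZ /= !h_delta b_ii bx /p /q; field.
have hjz : hform j z = 0.
  by rewrite /z linearB linearD !linearZ /= !h_delta b_ii (b_sym j) bx /p /q; field.
have ez : actw (alt i j n.*2) z = z.
  rewrite actw_alt_iter; elim: (n) => //= k ->.
  by rewrite (refl_fix hjz) (refl_fix hiz).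
have -> : v = z + (p *: delta i + q *: delta j) by rewrite subrK.
by rewrite linearD /= ez linearD !linearZ /= di dj.
Qed.

Definition nonneg v := forall i, 0 <= v i.
Definition supp J v := forall i, i \notin J -> v i = 0.

Lemma nonnegD u v : nonneg u -> nonneg v -> nonneg (u + v).
Proof. by move=> hu hv i; rewrite ffunE addr_ge0 ?hu ?hv. Qed.

Lemma nonnegZ (a : R) v : 0 <= a -> nonneg v -> nonneg (a *: v).
Proof. by move=> ha hv i; rewrite ffunE mulr_ge0 ?hv. Qed.

Lemma nonneg0 : nonneg 0.
Proof. by move=> i; rewrite ffunE. Qed.

Lemma nonneg_sum (T : Type) (r : seq T) (P : pred T) (F : T -> V) :
  (forall t, P t -> nonneg (F t)) -> nonneg (\sum_(t <- r | P t) F t).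
Proof.
move=> H; elim/big_ind: _ => //; [exact: nonneg0 | exact: nonnegD].
Qed.

Lemma nonneg_delta i : nonneg (delta i).
Proof. by move=> j; rewrite deltaE ler0n. Qed.

Lemma nonneg_anti v : nonneg v -> nonneg (- v) -> v = 0.
Proof.
move=> h1 h2; apply/ffunP=> i; rewrite ffunE.
by have := h1 i; have := h2 i; rewrite ffunE; lra.
Qed.

Lemma suppD J u v : supp J u -> supp J v -> supp J (u + v).
Proof. by move=> hu hv i iJ; rewrite ffunE hu // hv // addr0. Qed.

Lemma suppZ J (a : R) v : supp J v -> supp J (a *: v).
Proof. by move=> hv i iJ; rewrite ffunE hv // scaler0. Qed.

Lemma suppN J v : supp J v -> supp J (- v).
Proof. by move=> hv i iJ; rewrite ffunE hv // oppr0. Qed.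

Lemma supp_delta J i : i \in J -> supp J (delta i).
Proof. by move=> iJ j jJ; rewrite deltaE; case: eqP jJ => // ->; rewrite iJ. Qed.

Lemma suppS J K v : J \subset K -> supp J v -> supp K v.
Proof. by move=> /subsetP s hv i iK; apply: hv; apply: contra iK; exact: s. Qed.

Lemma supp_refl J i v : i \in J -> supp J v -> supp J (refl i v).
Proof. by move=> iJ hv; apply/suppD/suppN/suppZ/supp_delta. Qed.

Lemma supp_actw J s v : {subset s <= J} -> supp J v -> supp J (actw s v).
Proof.
elim: s => //= i s IH sub hv; apply: supp_refl; first exact/sub/mem_head.
by apply: IH => // j js; apply: sub; rewrite inE js orbT.
Qed.

Lemma actw_sub_supp J s v : {subset s <= J} -> supp J (actw s v - v).
Proof.
elim: s => /= [_|i s IH sub]; first by move=> i _; rewrite subrr ffunE.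
have iJ : i \in J by exact/sub/mem_head.
have : supp J (actw s v - v).
  by apply: IH => // j js; apply: sub; rewrite inE js orbT.
rewrite /refl addrAC => h; apply: suppD => //.
exact/suppN/suppZ/supp_delta.
Qed.

Lemma supp_decomp J v : supp J v -> v = \sum_(i in J) (v i : R) *: delta i.
Proof.
move=> hv; rewrite {1}(decomp v) [LHS](bigID (mem J)) /= [X in _ + X]big1 ?addr0 //.
by move=> i /hv ->; rewrite scale0r.
Qed.

Lemma actw_supp_sum J s v : supp J v ->
  actw s v = \sum_(i in J) (v i : R) *: actw s (delta i).
Proof.
move=> hv; rewrite {1}(supp_decomp hv) linear_sum.
by apply: eq_bigr => i _; rewrite linearZ.
Qed.

End GeometricRepresentation.

(** * Positivity of roots and faithfulness *)

Arguments cheb : simpl never.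

(** Bijections with their inverses form a group that the universal property can map into. *)
Record autob (T : Type) := Autob {
  abf : T -> T; abg : T -> T; abfK : cancel abf abg; abgK : cancel abg abf }.

Lemma autob_eq T (f g : autob T) : abf f =1 abf g -> f = g.
Proof.
case: f g => [f f' fK f'K] [g g' gK g'K] /= /funext fg; subst g.
have e : f' = g' by apply/funext => x; rewrite -[LHS]gK f'K.
by subst g'; congr Autob; exact: Prop_irrelevance.
Qed.

HB.instance Definition _ T := gen_eqMixin (autob T).
HB.instance Definition _ T := gen_choiceMixin (autob T).

Section AutobGroup.
Variable T : Type.
Implicit Types f g h : autob T.
Definition autob_one : autob T := @Autob T id id (fun=> erefl) (fun=> erefl).
Definition autob_inv f := Autob (abgK f) (abfK f).
Definition autob_mul f g :=
  Autob (can_comp (abfK f) (abfK g)) (can_comp (abgK g) (abgK f)).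
Lemma autob_mulA : associative autob_mul.
Proof. by move=> f g h; apply: autob_eq. Qed.
Lemma autob_mul1 : left_id autob_one autob_mul.
Proof. by move=> f; apply: autob_eq. Qed.
Lemma autob_mulr1 : right_id autob_one autob_mul.
Proof. by move=> f; apply: autob_eq. Qed.
Lemma autob_mulV : left_inverse autob_one autob_inv autob_mul.
Proof. by move=> f; apply: autob_eq => x /=; rewrite abfK. Qed.
Lemma autob_mulrV : right_inverse autob_one autob_inv autob_mul.
Proof. by move=> f; apply: autob_eq => x /=; rewrite abgK. Qed.
HB.instance Definition _ := isGroup.Build (autob T)
  autob_mulA autob_mul1 autob_mulr1 autob_mulV autob_mulrV.
End AutobGroup.

Section Alt.
Variable I : finType.
Implicit Types i j l : I.

Lemma alt_cons i j n : alt i j n.+1 = (if odd n then i else j) :: alt i j n.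
Proof.
elim: n i j => // n IH i j; rewrite -[LHS]/(rcons (alt j i n.+1) j) IH.
by rewrite rcons_cons /=; case: (odd n).
Qed.

Lemma alt_suffix i j n k : (k <= n)%N -> exists2 p, size p = (n - k)%N &
  (alt i j n = p ++ alt i j k) /\ forall l, l \in p -> l = i \/ l = j.
Proof.
move=> kn; rewrite -{2}(subnK kn); elim: (n - k)%N => [|d [p sp [e mp]]].
  by exists [::].
exists ((if odd (d + k) then i else j) :: p); rewrite /= ?sp //; split.
  by rewrite -[LHS]/(alt i j (d + k).+1) alt_cons e.
move=> l; rewrite inE => /orP[/eqP->|/mp//]; case: odd; by [left|right].
Qed.

Lemma alt_double i j n : alt i j (n + n) = rev (alt j i n) ++ alt i j n.
Proof.
elim: n => // n IH; rewrite addSn addnS [LHS]alt_cons (alt_cons i j (n + n)) IH.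
have -> : odd (n + n) = false by rewrite oddD addbb.
have -> : odd (n + n).+1 = true by rewrite /= oddD addbb.
rewrite -[alt j i n.+1]/(rcons (alt i j n) i) rev_rcons cat_cons; congr (_ :: _).
rewrite [in RHS]alt_cons -cat_rcons -rev_cons -alt_cons.
by rewrite -[alt i j n.+1]/(rcons (alt j i n) j) rev_rcons.
Qed.
End Alt.

Section CoxeterGroup.
Variables (I : finType) (m : I -> I -> option nat).
Hypothesis m_cox : coxeter_matrix m.
Variables (R : realFieldType) (c : cosine_table R).
Variables (W : groupType) (s : I -> W).
Hypothesis W_cox : coxeter_system m s.
Implicit Types (i j l : I) (k n : nat) (J K : {set I}) (w x y : W).
Local Notation V := {ffun I -> R^o}.
Implicit Types (v : V) (t u : seq I).
Local Notation refl := (refl m c).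
Local Notation actw := (actw m c).
Local Notation delta := (@delta I R).

Definition reflg i : autob V := Autob (reflK m_cox c i) (reflK m_cox c i).

Lemma abf_expg (f : autob V) n v : abf (f ^+ n)%g v = iter n (abf f) v.
Proof. by elim: n v => // n IH v; rewrite expgS /= IH. Qed.

Lemma reflg_rel : coxeter_relations m reflg.
Proof.
move=> i j n mij; apply: autob_eq => v.
rewrite abf_expg -[RHS](alt_relation m_cox c v mij) actw_alt_iter //.
Qed.

Definition rho : W -> autob V :=
  let: And3 _ _ U := W_cox in s2val (cid2 (U _ _ reflg_rel)).

Lemma rhoM : {morph rho : x y / (x * y)%g}.
Proof. by rewrite /rho; case: W_cox => ? ? U; case: cid2. Qed.

Lemma rho_s i : rho (s i) = reflg i.
Proof. by rewrite /rho; case: W_cox => ? ? U; case: cid2. Qed.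

Definition act w v : V := abf (rho w) v.

Lemma actM x y v : act (x * y)%g v = act x (act y v).
Proof. by rewrite /act rhoM. Qed.

Lemma act_s i v : act (s i) v = refl i v.
Proof. by rewrite /act rho_s. Qed.

Lemma ss i : (s i * s i = 1)%g.
Proof. by case: W_cox => /(_ i i 1%N (mii m_cox i)). Qed.

Lemma sV i : ((s i)^-1 = s i)%g.
Proof. by apply: mulg1_eq; exact: ss. Qed.

Lemma act1 v : act 1%g v = v.
Proof.
by apply: (can_inj (abfK (rho 1%g))); rewrite -/(act _ _) -/(act _ _) -actM mulg1.
Qed.

Lemma actVK w : cancel (act w) (act w^-1).
Proof. by move=> v; rewrite -actM mulVg act1. Qed.

Lemma actKV w : cancel (act w^-1) (act w).
Proof. by move=> v; rewrite -actM mulgV act1. Qed.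

Definition word (u : seq I) : W := (\prod_(i <- u) s i)%g.

Lemma word_cons i u : word (i :: u) = (s i * word u)%g.
Proof. by rewrite /word big_cons. Qed.
Lemma word_nil : word [::] = 1%g.
Proof. by rewrite /word big_nil. Qed.
Lemma word_cat t u : word (t ++ u) = (word t * word u)%g.
Proof. by rewrite /word big_cat. Qed.
Lemma word1 i : word [:: i] = s i.
Proof. by rewrite word_cons word_nil mulg1. Qed.
Lemma word_rcons u i : word (rcons u i) = (word u * s i)%g.
Proof. by rewrite -cats1 word_cat word1. Qed.

Lemma word_rev u : word (rev u) = ((word u)^-1)%g.
Proof.
elim: u => [|i u IH]; first by rewrite word_nil invg1.
by rewrite rev_cons word_rcons IH word_cons invgM sV.
Qed.

Lemma act_word u v : act (word u) v = actw u v.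
Proof.
elim: u v => [|i u IH] v; first by rewrite word_nil act1.
by rewrite word_cons actM IH act_s.
Qed.

Lemma braid i j n : m i j = Some n -> word (alt i j n) = word (alt j i n).
Proof.
move=> mij.
have e k : word (alt i j k.*2) = ((s i * s j) ^+ k)%g.
  elim: k => [|k IH]; first by rewrite word_nil.
  by rewrite alt_doubleS !word_rcons IH expgSr mulgA.
have : word (alt i j n.*2) = 1%g by rewrite e; case: W_cox => + _ _; exact.
rewrite -addnn alt_double word_cat word_rev => /(congr1 (mulg (word (alt j i n)))).
by rewrite mulVKg mulg1.
Qed.

Local Notation inW := (std_parabolic s).

Lemma inWP J w : inW J w <-> exists2 u, {subset u <= J} & w = word u.
Proof.
split=> [h|[u uJ ->]].
  suff : [set y | exists2 u, {subset u <= J} & y = word u]%classic w by [].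
  apply: h; first split.
  - by exists [::] => //; rewrite word_nil.
  - move=> x y [t tJ ->] [u uJ ->]; exists (t ++ u); last by rewrite word_cat.
    by move=> i; rewrite mem_cat => /orP[/tJ|/uJ].
  - move=> x [t tJ ->]; exists (rev t); last by rewrite word_rev.
    by move=> i; rewrite mem_rev => /tJ.
  move=> _ [j jJ <-]; exists [:: j]; last by rewrite word1.
  by move=> i; rewrite inE => /eqP->.
move=> H [H1 HM HV] sH; elim: u uJ => [|i u IH] uJ; first by rewrite word_nil.
rewrite word_cons; apply: HM.
  by apply: sH; exists i => //; apply: uJ; exact: mem_head.
by apply: IH => j ju; apply: uJ; rewrite inE ju orbT.
Qed.

Lemma inW1 J : inW J 1%g.
Proof. by move=> H []. Qed.
Lemma inWM J x y : inW J x -> inW J y -> inW J (x * y)%g.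
Proof. by move=> hx hy H sH sub; case: (sH) => _ HM _; apply: HM; [exact: hx|exact: hy]. Qed.
Lemma inWV J x : inW J x -> inW J (x^-1)%g.
Proof. by move=> hx H sH sub; case: (sH) => _ _ HV; apply: HV; exact: hx. Qed.
Lemma inWs J i : i \in J -> inW J (s i).
Proof. by move=> iJ H sH sub; apply: sub; exists i. Qed.
Lemma inWT w : inW [set: I]%SET w.
Proof.
case: W_cox => _ /(congr1 (fun A : set W => A w)) e _.
have : generated_by (range s) w by rewrite e.
move=> h H sH sub; apply: h => // _ [i _ <-]; apply: sub; exists i => //; exact: in_setT.
Qed.
Lemma inWS J K w : J \subset K -> inW J w -> inW K w.
Proof.
move=> /subsetP sJK /inWP[u uJ ->]; apply/inWP; exists u => // i /uJ; exact: sJK.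
Qed.
Lemma act_wordP w : exists u, forall v, act w v = actw u v.
Proof.
by have /inWP[u _ ->] := inWT w; exists u => v; rewrite act_word.
Qed.

Lemma act_linear w : linear (act w).
Proof. by have [u e] := act_wordP w; move=> a x y; rewrite !e linearP. Qed.
HB.instance Definition _ w :=
  GRing.isLinear.Build R V V *:%R (act w) (@act_linear w).

Definition lenP J w n : bool :=
  `[< exists u, [/\ {subset u <= J}, w = word u & size u = n] >].

(* 0 outside [W_J]. *)
Definition len J w : nat :=
  if pselect (exists n, lenP J w n) is left h then ex_minn h else 0.

Lemma len_min J w u : {subset u <= J} -> w = word u -> (len J w <= size u)%N.
Proof.
move=> uJ wu; have P : lenP J w (size u) by apply/asboolP; exists u.
rewrite /len; case: pselect => [h|//]; case: ex_minnP => n _; exact.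
Qed.

Lemma len_word J w : inW J w ->
  exists u, [/\ {subset u <= J}, w = word u & size u = len J w].
Proof.
move=> /inWP[u uJ wu]; rewrite /len; case: pselect => [h|[]].
  by case: ex_minnP => n /asboolP.
by exists (size u); apply/asboolP; exists u.
Qed.

Lemma lenM_word J w u : inW J w -> {subset u <= J} ->
  (len J (w * word u)%g <= len J w + size u)%N.
Proof.
move=> /len_word[t [tJ -> <-]] uJ; rewrite -size_cat; apply: len_min.
  by move=> i; rewrite mem_cat => /orP[/tJ|/uJ].
by rewrite word_cat.
Qed.

Lemma lenMs J w i : inW J w -> i \in J ->
  (len J (w * s i)%g <= (len J w).+1)%N.
Proof.
move=> hw iJ; rewrite -word1 -addn1; apply: (@lenM_word J w [:: i]) => //.
by move=> j; rewrite inE => /eqP->.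
Qed.

Lemma msK w i : ((w * s i) * s i = w)%g.
Proof. by rewrite -mulgA ss mulg1. Qed.

Lemma len_gt0_last J w : inW J w -> (0 < len J w)%N ->
  exists i, i \in J /\ (len J (w * s i)%g < len J w)%N.
Proof.
move=> /len_word[u [uJ wu <-]]; case/lastP: u uJ wu => [//|u i] uJ wu _.
have iJ : i \in J by apply: uJ; rewrite mem_rcons mem_head.
exists i; split=> //; rewrite size_rcons ltnS; apply: len_min.
  by move=> j ju; apply: uJ; rewrite mem_rcons inE ju orbT.
by rewrite wu word_rcons msK.
Qed.

Lemma len_eq0 J w : inW J w -> len J w = 0 -> w = 1%g.
Proof.
by move=> /len_word[u [_ -> <-]] /size0nil ->; rewrite word_nil.
Qed.

(** Letters [j], [i], [j], ... are peeled off the right end of [w] as long as the length drops; this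
    isolates the part of [w] in the dihedral subgroup of [i] and [j]. *)
Lemma strip J w i j : inW J w -> i \in J -> j \in J ->
  exists k x, [/\ inW J x, w = (x * word (alt i j k))%g,
    len J w = (len J x + k)%N
    & (len J x <= len J (x * s (if odd k then i else j)))%N].
Proof.
have [n] := ubnP (len J w); elim: n w i j => // n IH w i j; rewrite ltnS => wn wJ iJ jJ.
case: (leqP (len J w) (len J (w * s j)%g)) => h.
  by exists 0, w; rewrite word_nil mulg1 addn0.
have wsJ : inW J (w * s j)%g by apply: inWM => //; exact: inWs.
have [|k [x [xJ e lx lt]]] := IH (w * s j)%g j i _ wsJ jJ iJ; first lia.
exists k.+1, x; split=> //.
- by rewrite -(msK w j) e /= word_rcons mulgA.
- have := lenMs wsJ jJ; rewrite msK; lia.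
- by move: lt => /=; case: (odd k).
Qed.

(* Relative to the length function of [W_J]: this avoids comparing the latter
   with the length in [W]. *)
Theorem root_pos J w i : inW J w -> i \in J ->
  (len J w <= len J (w * s i)%g)%N -> nonneg (act w (delta i)).
Proof.
have [n] := ubnP (len J w); elim: n w i => // n IH w i; rewrite ltnS => wn wJ iJ wi.
case: (posnP (len J w)) => [/(len_eq0 wJ)->|w0].
  by rewrite act1; exact: nonneg_delta.
have [j [jJ wj]] := len_gt0_last wJ w0.
have ij : i != j by apply: contraTneq wj => <-; rewrite -leqNgt.
have [k [x [xJ e lx lt]]] := strip wJ iJ jJ.
have altJ l p q r : p \in J -> q \in J -> l \in alt p q r -> l \in J.
  by move=> pJ qJ /mem_alt[]->.
case: k e lx lt => [|k] e lx lt.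
  by move: wj lt; rewrite e word_nil mulg1 /=; lia.
(* One letter does not shorten [x] because the stripping stopped there. The other is the first
   letter of the alternating word, and if it shortened [x] then [w] would have too short a word. *)
have xi : (len J x <= len J (x * s i))%N /\ (len J x <= len J (x * s j))%N.
  set y := if odd k.+1 then j else i.
  have yJ : y \in J by rewrite /y; case: ifP.
  have : (len J x <= len J (x * s y))%N.
    have xyJ : inW J (x * s y)%g by apply: inWM => //; exact: inWs.
    have := @lenM_word J (x * s y)%g (alt i j k) xyJ (fun l => @altJ l i j k iJ jJ).
    rewrite -mulgA -word_cons size_alt.
    have -> : y :: alt i j k = alt i j k.+1.
      by rewrite alt_cons /y /=; case: (odd k).
    by rewrite -e; lia.
  by move: lt; rewrite /y /=; case: (odd k).
have xn : (len J x < n)%N by lia.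
have pi : nonneg (act x (delta i)) by apply: IH => //; case: xi.
have pj : nonneg (act x (delta j)) by apply: IH => //; case: xi.
(* A longer alternating suffix could be rewritten by the braid relation to end in [i], and [w * s i]
   would be shorter than [w]. *)
have short M : m i j = Some M -> (k.+1 < M)%N.
  move=> mij; rewrite ltnNge; apply/negP => Mk.
  have M1 := m_ge2 m_cox ij mij.
  have [p sp [ep mp]] := alt_suffix i j Mk.
  have : (len J (w * s i)%g <= len J x + size (p ++ alt i j M.-1))%N.
    have -> : (w * s i = x * word (p ++ alt i j M.-1))%g.
      rewrite e ep !word_cat (braid mij) -{1}(prednK (ltnW M1)) /= word_rcons.
      by rewrite -!mulgA ss mulg1.
    apply: lenM_word => // l; rewrite mem_cat => /orP[/mp[]->//|]; exact: altJ.
  by rewrite size_cat sp size_alt; lia.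
rewrite e actM act_word (alt_act0 m_cox).
(* Up to a half turn the Chebyshev values are nonnegative; for an infinite label they are the
   natural numbers. *)
have cge r : (r <= k.+2)%N -> 0 <= cheb (- bform m c i j) r.
  move=> rk; rewrite /bform; case E: (m i j) => [M|]; last first.
    by rewrite opprK cheb1 ler0n.
  by rewrite opprK cheb_ct_ge0 ?(m_ge2 m_cox ij E) //; have := short _ E; lia.
by case: ifP => _; rewrite linearD !linearZ /=; apply: nonnegD; apply: nonnegZ => //; apply: cge.
Qed.

Lemma root_neg J w i : inW J w -> i \in J ->
  (len J (w * s i)%g < len J w)%N -> nonneg (- act w (delta i)).
Proof.
move=> wJ iJ wi.
have : nonneg (act (w * s i)%g (delta i)).
  apply: (@root_pos J) => //; first by apply: inWM => //; exact: inWs.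
  by rewrite msK ltnW.
by rewrite actM act_s (refl_delta m_cox) linearN.
Qed.

Lemma act_neq0 w v : v != 0 -> act w v != 0.
Proof. by apply: contra_neq => h; rewrite -(actVK w v) h linear0. Qed.

Lemma len_lt_root J w i : inW J w -> i \in J ->
  nonneg (- act w (delta i)) -> (len J (w * s i)%g < len J w)%N.
Proof.
move=> wJ iJ h; rewrite ltnNge; apply/negP => /(root_pos wJ iJ) h'.
have := act_neq0 w (delta_neq0 R i).
by rewrite (nonneg_anti h' h) eqxx.
Qed.

Lemma root_sign w i : nonneg (act w (delta i)) \/ nonneg (- act w (delta i)).
Proof.
have wT := inWT w; have iT := in_setT i.
case: (leqP (len [set: I]%SET w) (len [set: I]%SET (w * s i)%g)) => h.
  by left; exact: (root_pos wT iT).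
by right; exact: (root_neg wT iT).
Qed.

Lemma faithful w : (forall i, act w (delta i) = delta i) -> w = 1%g.
Proof.
move=> h; have wT := inWT w; case: (posnP (len [set: I]%SET w)) => [/(len_eq0 wT)//|w0].
have [j [jT /(root_neg wT jT)]] := len_gt0_last wT w0; rewrite h => /nonneg_anti.
by rewrite opprK => /(_ (@nonneg_delta I R j))/eqP; rewrite oppr_eq0 (negPf (delta_neq0 R j)).
Qed.

Lemma faithful2 x y : (forall i, act x (delta i) = act y (delta i)) -> x = y.
Proof.
move=> h; have : (y^-1 * x)%g = 1%g.
  by apply: faithful => i; rewrite actM h actVK.
by move=> /(congr1 (mulg y)); rewrite mulVKg mulg1.
Qed.

End CoxeterGroup.

(** * Involutions and the subsets on which -1 is realized *)

Section Involutions.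
Variables (I : finType) (m : I -> I -> option nat).
Hypothesis m_cox : coxeter_matrix m.
Variables (R : realFieldType) (c : cosine_table R).
Variables (W : groupType) (s : I -> W).
Hypothesis W_cox : coxeter_system m s.
Implicit Types (i j l : I) (k n : nat) (J K N : {set I}) (w x y z g : W).
Local Notation V := {ffun I -> R^o}.
Implicit Types (v : V) (t u : seq I).
Local Notation refl := (refl m c).
Local Notation actw := (actw m c).
Local Notation hform := (hform m c).
Local Notation form := (form m c).
Local Notation delta := (@delta I R).
Local Notation act := (act m_cox c W_cox).
Local Notation inW := (std_parabolic s).
Local Notation word := (word s).
Local Notation len := (len s).
Local Notation ell := (len [set: I]%SET).
Local Notation inWT := (inWT W_cox).
Local Notation inWP := (inWP m_cox W_cox).

Lemma form_act x v v' : form (act x v) (act x v') = form v v'.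
Proof. by have [u e] := act_wordP m_cox c W_cox x; rewrite !e form_actw. Qed.

Lemma form_root_act x i : form (act x (delta i)) (act x (delta i)) = 1.
Proof. by rewrite form_act form_delta h_delta b_ii. Qed.

Lemma supp_act J x v : inW J x -> supp J v -> supp J (act x v).
Proof. by move=> /inWP[u uJ ->] hv; rewrite act_word; apply: supp_actw. Qed.

Lemma act_sub_supp J x v : inW J x -> supp J (act x v - v).
Proof. by move=> /inWP[u uJ ->]; rewrite act_word; apply: actw_sub_supp. Qed.

Lemma act_supp_sum J x v : supp J v ->
  act x v = \sum_(i in J) (v i : R) *: act x (delta i).
Proof.
move=> hv; rewrite {1}(supp_decomp hv) linear_sum.
by apply: eq_bigr => i _; rewrite linearZ.
Qed.

Lemma act_cone J x v : nonneg v -> supp J v ->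
  (forall j, j \in J -> nonneg (act x (delta j))) -> nonneg (act x v).
Proof.
move=> hv sv h; rewrite (act_supp_sum x sv).
by apply: nonneg_sum => j jJ; apply: nonnegZ => //; exact: h.
Qed.

Lemma delta_not_neg i : ~ nonneg (- delta i).
Proof.
move=> h; have := nonneg_anti (@nonneg_delta I R i) h.
by move/eqP; rewrite (negPf (delta_neq0 R i)).
Qed.

Lemma delta_inj : injective delta.
Proof.
move=> i j /ffunP/(_ i); rewrite !deltaE eqxx.
by case: eqP => // _ /eqP; rewrite oner_eq0.
Qed.

Lemma act_inj x : injective (act x).
Proof. exact: can_inj (actVK _ _ _ x). Qed.

(** Multiplying by generators of [J] whose roots are negative leads to the minimal representative of
    the coset [x W_J]. The strict inequality is what lets [maps_chain] recurse. *)
Lemma coset_min x J : exists y, [/\ inW J y,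
  forall j, j \in J -> nonneg (act (x * y)%g (delta j)),
  (ell (x * y)%g <= ell x)%N
  & ~ (forall j, j \in J -> nonneg (act x (delta j))) -> (ell (x * y)%g < ell x)%N].
Proof.
have [n] := ubnP (ell x); elim: n x => // n IH x; rewrite ltnS => xn.
case: (pselect (forall j, j \in J -> nonneg (act x (delta j)))) => [h|].
  by exists 1%g; rewrite mulg1; split=> //; exact: inW1.
move=> /existsNP[j /not_implyP[jJ jn]].
have jneg : nonneg (- act x (delta j)).
  by case: (root_sign m_cox c W_cox x j).
have lt := len_lt_root (inWT x) (in_setT j) jneg.
have [|y [yJ hy ly _]] := IH (x * s j)%g; first exact: leq_trans lt xn.
have ly' := leq_ltn_trans ly lt.
exists (s j * y)%g; rewrite mulgA; split=> //; last exact: ltnW.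
by apply: inWM => //; exact: inWs.
Qed.

(** Roots have norm 1, so the only positive root on the ray of [delta i] is [delta i] itself. *)
Lemma collinear_root x j i : nonneg (act x (delta j)) ->
  (forall l, l != i -> act x (delta j) l = 0) -> act x (delta j) = delta i.
Proof.
move=> pos h; set b := act x (delta j) in pos h *.
have e : b = (b i : R) *: delta i.
  apply/ffunP => l; rewrite [RHS]ffunE deltaE; case: (eqVneq l i) => [->|li].
    by rewrite /GRing.scale /= mulr1.
  by rewrite h // scaler0.
have : form b b = 1 by exact: form_root_act.
have := pos i; move: (b i : R) e => a -> a0.
rewrite linearZ /= (form_sym m_cox) linearZ /= form_delta h_delta (b_ii m_cox) mulr1 => q.
have -> : a = 1 by nra.
by rewrite scale1r.
Qed.

(** A simple root spans an extremal ray of the positive cone: every term of a nonnegative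
    combination of positive roots equal to it is a multiple of it. *)
Lemma simple_image J x v i : nonneg v -> supp J v ->
  (forall j, j \in J -> nonneg (act x (delta j))) ->
  act x v = delta i -> exists2 j, j \in J & v = delta j.
Proof.
move=> pos sv h e.
have v0 : v != 0.
  apply: contra_eq_neq e => ->; rewrite linear0 eq_sym; exact: delta_neq0.
have [j vj] : exists j, v j != 0.
  apply/existsP; apply: contraNT v0 => /existsPn vz.
  by apply/eqP/ffunP => j; have := vz j; rewrite negbK ffunE => /eqP.
have jJ : j \in J by apply: contraNT vj => /sv ->.
exists j => //; apply: (@act_inj x); rewrite e.
apply/esym/collinear_root; first exact: h.
move=> l li; have := congr1 (fun f : V => f l) e.
rewrite deltaE (negPf li) (act_supp_sum x sv) sum_ffunE => /psumr_eq0P.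
move=> /(_ _ j jJ) H; have : v j * act x (delta j) l = 0.
  rewrite -[RHS]H ?ffunE // => k kJ; rewrite ffunE; apply: mulr_ge0 => //; exact: h.
by move/eqP; rewrite mulf_eq0 (negPf vj) => /eqP.
Qed.

Lemma root_refl_neg x j i : nonneg (act x (delta j)) ->
  nonneg (- refl i (act x (delta j))) -> act x (delta j) = delta i.
Proof.
move=> pos neg; apply: collinear_root => // l li.
by have := pos l; have := neg l; rewrite ffunE reflEne // => a b; lra.
Qed.

Lemma conj_refl x i v (b := act x (delta i)) :
  act (x * s i * x^-1)%g v = v - (2 * form b v) *: b.
Proof.
rewrite !actM act_s /refl linearB linearZ /= actKV; congr (_ - (2 * _) *: _).
by rewrite -form_delta -(form_act x) actKV.
Qed.

Lemma conj_s x i j : act x (delta i) = delta j -> (x * s i * x^-1 = s j)%g.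
Proof.
move=> e; apply: (@faithful2 _ _ m_cox R c _ _ W_cox) => l.
by rewrite conj_refl e act_s /refl form_delta.
Qed.

Lemma conj_sN x i j : act x (delta i) = - delta j -> (x * s i * x^-1 = s j)%g.
Proof.
move=> e; apply: (@faithful2 _ _ m_cox R c _ _ W_cox) => l.
rewrite conj_refl e act_s /refl; have -> : form (- delta j) (delta l) = - hform j (delta l).
  by rewrite (form_sym m_cox) linearN /= (form_sym m_cox) form_delta.
by rewrite mulrN scalerN scaleNr opprK.
Qed.

Definition negw J w := inW J w /\ forall j, j \in J -> act w (delta j) = - delta j.

(* Stated with words, so that it makes sense without [W]. *)
Definition negt J := exists u, {subset u <= J} /\
  forall j, j \in J -> actw u (delta j) = - delta j.

Lemma negtP J : negt J <-> exists w, negw J w.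
Proof.
split=> [[u [uJ h]]|[w [/inWP[u uJ ->] h]]].
  exists (word u); split; first by apply/inWP; exists u.
  by move=> j jJ; rewrite act_word h.
by exists u; split => // j jJ; rewrite -(act_word m_cox c W_cox) h.
Qed.

Lemma negw_supp J w v : negw J w -> supp J v -> act w v = - v.
Proof.
move=> [_ h] sv; rewrite (act_supp_sum w sv) {2}(supp_decomp sv) -sumrN.
by apply: eq_bigr => j jJ; rewrite h // scalerN.
Qed.

(** Any vector is changed by [w] by an element of [V_J], which the second application negates. *)
Lemma negwK J w : negw J w -> (w * w = 1)%g.
Proof.
move=> hw; apply: (@faithful _ _ m_cox R c _ _ W_cox) => i.
have sv := act_sub_supp (delta i) hw.1; set v := _ - _ in sv.
have e : act w (delta i) = delta i + v by rewrite /v addrC subrK.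
by rewrite actM e linearD /= e (negw_supp hw sv) addrK.
Qed.

Lemma negw_central J w x : negw J w -> inW J x -> (w * x = x * w)%g.
Proof.
move=> hw /inWP[u]; elim: u x => [|j u IH] x uJ ->.
  by rewrite word_nil mulg1 mul1g.
have jJ : j \in J by apply: uJ; exact: mem_head.
rewrite word_cons mulgA; have := conj_sN (hw.2 j jJ) => /(canRL (mulgVK _)) ->.
rewrite -!mulgA; congr (_ * _)%g; apply: IH => // l lu.
by apply: uJ; rewrite inE lu orbT.
Qed.

Lemma len_inv J x : inW J x -> len J (x^-1)%g = len J x.
Proof.
have H y : inW J y -> (len J (y^-1)%g <= len J y)%N.
  move=> /(len_word m_cox W_cox)[u [uJ -> <-]].
  rewrite -(word_rev m_cox W_cox) -(size_rev u); apply: len_min => //.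
  by move=> j; rewrite mem_rev => /uJ.
move=> xJ; apply/eqP; rewrite eqn_leq H //=; have := H _ (inWV xJ).
by rewrite invgK.
Qed.

Lemma pos_eq1 J x : inW J x ->
  (forall j, j \in J -> nonneg (act x (delta j))) -> x = 1%g.
Proof.
move=> xJ h; case: (posnP (len J x)) => [/(len_eq0 m_cox W_cox xJ)//|x0].
have [j [jJ lt]] := len_gt0_last m_cox W_cox xJ x0.
have := root_neg m_cox c W_cox xJ jJ lt => /(nonneg_anti (h _ jJ))/eqP.
by rewrite (negPf (act_neq0 _ _ _ _ (delta_neq0 R j))).
Qed.

Lemma neg_unique N x y : inW N x -> inW N y ->
  (forall j, j \in N -> nonneg (- act x (delta j))) ->
  (forall j, j \in N -> nonneg (- act y (delta j))) -> x = y.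
Proof.
move=> xN yN hx hy.
have hc z v : (forall j, j \in N -> nonneg (- act z (delta j))) ->
    nonneg v -> supp N v -> nonneg (- act z v).
  move=> hz pv sv; rewrite (act_supp_sum z sv) -sumrN.
  by apply: nonneg_sum => j jN; rewrite -scalerN; apply: nonnegZ => //; exact: hz.
suff : (x * y^-1)%g = 1%g by move=> /(canRL (mulgVK _)); rewrite mul1g.
have yVN := inWV yN.
apply: (@pos_eq1 N); first exact: inWM.
move=> j jN; rewrite actM.
have sj : supp N (act y^-1 (delta j)) by apply: supp_act => //; exact: supp_delta.
case: (root_sign m_cox c W_cox (y^-1)%g j) => h.
  by have := hc y _ hy h sj; rewrite actKV => /delta_not_neg.
have := hc x _ hx h; rewrite linearN opprK; apply; exact: suppN.
Qed.

Lemma negw_unique J x y : negw J x -> negw J y -> x = y.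
Proof.
move=> [xJ hx] [yJ hy]; apply: (@neg_unique J) => // j jJ.
  by rewrite hx // opprK; exact: nonneg_delta.
by rewrite hy // opprK; exact: nonneg_delta.
Qed.

(** Write [y = s j * x] with [x] shorter. Since [w] negates [V_J], a letter that lengthens [x^-1]
    shortens [w * x^-1]. *)
Lemma negw_len J w y : negw J w -> inW J y ->
  len J w = (len J (w * y^-1)%g + len J y)%N.
Proof.
move=> hw; have [n] := ubnP (len J y); elim: n y => // n IH y; rewrite ltnS => yn yJ.
case: (posnP (len J y)) => [y0|y0].
  by rewrite y0 (len_eq0 m_cox W_cox yJ y0) invg1 mulg1 addn0.
have yVJ := inWV yJ.
have [|j [jJ]] := len_gt0_last m_cox W_cox yVJ; first by rewrite len_inv.
set x := (s j * y)%g; have xV : (x^-1 = y^-1 * s j)%g.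
  by rewrite /x invgM (sV m_cox W_cox).
have xJ : inW J x by apply: inWM => //; exact: inWs.
rewrite -xV !len_inv // => lxy.
have yx : (len J y <= (len J x).+1)%N.
  have := lenMs m_cox W_cox (inWV xJ) jJ.
  by rewrite len_inv // xV (msK m_cox W_cox) len_inv.
rewrite (IH x) //; last by lia.
have wxJ : inW J (w * x^-1)%g by apply: inWM; [case: hw|exact: inWV].
have : (len J (w * x^-1 * s j) < len J (w * x^-1))%N.
  apply: (@len_lt_root _ _ m_cox R c _ _ W_cox) => //.
  have sx : supp J (act x^-1 (delta j)).
    by apply: supp_act; [exact: inWV|exact: supp_delta].
  rewrite actM (negw_supp hw sx) opprK.
  apply: (@root_pos _ _ m_cox R c _ _ W_cox J) => //; first exact: inWV.
  by rewrite len_inv // xV (msK m_cox W_cox) len_inv // ltnW.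
have := lenMs m_cox W_cox wxJ jJ.
have := lenMs m_cox W_cox (inWM wxJ (inWs jJ)) jJ; rewrite (msK m_cox W_cox).
have -> : (w * x^-1 * s j = w * y^-1)%g by rewrite xV mulgA (msK m_cox W_cox).
lia.
Qed.

Lemma word_lengthP J w n : word_length s J w n <-> inW J w /\ n = len J w.
Proof.
split=> [[[u [uJ wu] <-] mn]|[wJ ->]].
  have wJ : inW J w by apply/inWP; exists u.
  split=> //; apply/eqP; rewrite eqn_leq (len_min uJ wu) andbT.
  by have [t [tJ wt <-]] := len_word m_cox W_cox wJ; apply: mn.
split; last by move=> u [uJ wu]; exact: len_min.
by have [u [uJ wu su]] := len_word m_cox W_cox wJ; exists u.
Qed.

Lemma negw_longest J w : negw J w -> unique (longest s J) w.
Proof.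
move=> hw; split.
  exists (len J w); first by apply/word_lengthP; split=> //; case: hw.
  move=> v p /word_lengthP[vJ ->]; rewrite (negw_len hw vJ); lia.
move=> y [n /word_lengthP[yJ ->] mx].
have wy : (len J w <= len J y)%N by apply: (mx w); apply/word_lengthP; split=> //; case: hw.
have e := negw_len hw yJ.
have : (w * y^-1)%g = 1%g.
  apply: (len_eq0 m_cox W_cox (J := J)); last by lia.
  by apply: inWM; [case: hw|exact: inWV].
by move=> /(canRL (mulgVK _)); rewrite mul1g.
Qed.

(** Correcting [g] by an element of [W_K] turns the root into a simple root of [K], so its
    reflection is conjugate in [W_K] to a generator. *)
Lemma root_in_parabolic K g j : supp K (act g (delta j)) ->
  inW K (g * s j * g^-1)%g.
Proof.
move=> sb; have [y [yK hy _ _]] := coset_min (g^-1)%g K.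
set z := (g^-1 * y)%g in hy; have zV : (z^-1 = y^-1 * g)%g by rewrite invgM invgK.
have sb' : supp K (act z^-1 (delta j)).
  by rewrite zV actM; apply: supp_act => //; exact: inWV.
case: (root_sign m_cox c W_cox (z^-1)%g j) => h.
  have [k kK e] := simple_image h sb' hy (actKV _ _ _ z (delta j)).
  have := conj_s e; rewrite zV invgM invgK => e'.
  have -> : (g * s j * g^-1 = y * s k * y^-1)%g.
    by rewrite -e' -!mulgA mulVKg mulgV mulg1.
  by apply: inWM; [apply: inWM => //; exact: inWs|exact: inWV].
have := act_cone h (suppN sb') hy.
by rewrite linearN /= actKV => /delta_not_neg.
Qed.

(** The images under [g] of the simple roots of [J] are negated by an element of [W_K]; it moves
    vectors only along [V_K], so these images lie in [V_K]. *)
Lemma negw_in_parabolic J w K g : negw J w -> conj_set (inW K) g w ->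
  (inW J `<=` conj_set (inW K) g)%classic.
Proof.
move=> hw [x xK xw] y /inWP[u uJ ->].
have P1 : conj_set (inW K) g 1%g by exists 1%g; [exact: inW1|rewrite conj1g].
elim: u uJ => [|j u IH] uJ; first by rewrite word_nil.
rewrite word_cons; have [|y' y'K <-] := IH; first by move=> l lu; apply: uJ; rewrite inE lu orbT.
have jJ : j \in J by apply: uJ; exact: mem_head.
suff sj : inW K (g * s j * g^-1)%g.
  exists (g * s j * g^-1 * y')%g; first exact: inWM.
  by rewrite conjMg; congr (_ * _)%g; rewrite conjgE -!mulgA mulVg mulg1 mulKg.
apply: root_in_parabolic; set b := act g (delta j).
have : act x b = - b.
  have -> : x = (g * w * g^-1)%g by rewrite -xw conjgE !mulgA mulgV mul1g mulgK.
  by rewrite !actM /b actVK hw.2 // linearN.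
have := act_sub_supp b xK => sb e l lK; have := sb l lK.
by rewrite e !ffunE => /eqP; rewrite -mulr2n mulrn_eq0 /= => /eqP; lra.
Qed.

Lemma negw_closure J w : negw J w -> parabolic_closure s w (inW J).
Proof.
move=> hw; split; [|by case: hw|].
  exists J, 1%g; rewrite classical_sets.eqEsubset; split=> x.
    by move=> xJ; exists x => //; rewrite conjg1.
  by move=> [y yJ <-]; rewrite conjg1.
move=> Q [K [g ->]] Qw; exact: negw_in_parabolic Qw.
Qed.

Lemma involution_conj_neg w : (w * w = 1)%g -> exists J x, negw J (w ^ x)%g.
Proof.
have [n] := ubnP (ell w); elim: n w => // n IH w; rewrite ltnS => wn ww.
(* The set of right descents of [w]. *)
pose J := finset (fun i => `[< nonneg (- act w (delta i)) >]).
have JP i : reflect (nonneg (- act w (delta i))) (i \in J).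
  by rewrite inE; exact: asboolP.
case: (pselect (forall i, i \in J -> act w (delta i) = - delta i)) => [h|].
  exists J, 1%g; rewrite conjg1; split=> //.
  have [y [yJ hy _ _]] := coset_min w J; set z := (w * y)%g in hy.
  have wsupp v : supp J v -> supp J (act w v).
    move=> sv; rewrite (act_supp_sum w sv) => l lJ; rewrite sum_ffunE big1 //.
    by move=> i iJ; rewrite h // ffunE (suppN (supp_delta _ iJ)) // scaler0.
  (* To see that [w] lies in [W_J], its [W_J] part is divided out; no descent is left. *)
  suff z1 : z = 1%g.
    have -> : w = (y^-1)%g by rewrite -[RHS]mul1g -z1 /z mulgK.
    exact: inWV.
  apply: (@pos_eq1 [set: I]%SET) => [|i _]; first exact: inWT.
  case: (boolP (i \in J)) => [/hy//|iJ].
  have pw : nonneg (act w (delta i)).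
    by case: (root_sign m_cox c W_cox w i) => // /JP; rewrite (negPf iJ).
  case: (root_sign m_cox c W_cox z i) => // zneg; exfalso.
  have sv := act_sub_supp (delta i) yJ.
  set v := _ - _ in sv; have ev : act y (delta i) = delta i + v by rewrite addrC subrK.
  (* The involution [w] preserves [V_J], so it cannot bring a simple root outside [J] into it. *)
  have ns : ~ supp J (act w (delta i)).
    move=> /wsupp; rewrite -actM ww act1 => /(_ i iJ).
    by rewrite deltaii => /eqP; rewrite oner_eq0.
  apply: ns => l lJ; have := zneg l; have := pw l.
  rewrite ffunE /z actM ev linearD /= ffunE (wsupp _ sv l lJ) addr0; lra.
move=> /existsNP[i /not_implyP[/JP iJ ni]].
have lt := len_lt_root (inWT w) (in_setT i) iJ.
have lt2 : (ell (s i * w)%g < ell w)%N.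
  rewrite -len_inv; last exact: inWT.
  by rewrite invgM (sV m_cox W_cox) (mulg1_eq ww).
have lt3 : (ell (s i * w * s i)%g < ell (s i * w)%g)%N.
  (* The reflection [s i] makes the negative root [w (alpha_i)] positive only if this root is
     [- alpha_i], which [ni] excludes. So conjugation by [s i] shortens [w]. *)
  apply: (@len_lt_root _ _ m_cox R c _ _ W_cox); [exact: inWT|exact: in_setT|].
  rewrite actM act_s.
  have ew : act (w * s i)%g (delta i) = - act w (delta i).
    by rewrite actM act_s refl_delta // linearN.
  have := root_sign m_cox c W_cox (s i * w)%g i; rewrite actM act_s => -[h|//].
  have := @root_refl_neg (w * s i)%g i i; rewrite ew.
  by rewrite linearN /= opprK => /(_ iJ h) e; case: ni; rewrite -[LHS]opprK e.
have ec : (s i * w * s i = w ^ s i)%g by rewrite conjgE (sV m_cox W_cox) mulgA.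
rewrite ec in lt3; have [||J' [x hx]] := IH (w ^ s i)%g.
- by have := ltn_trans lt3 lt2; move=> h; exact: leq_trans h wn.
- by rewrite -conjMg ww conj1g.
by exists J', (s i * x)%g; rewrite conjgM.
Qed.

(** * Elements carrying simple roots to simple roots *)

Definition maps z J K := exists2 f : I -> I,
  (forall j, j \in J -> act z (delta j) = delta (f j)) & [set f j | j in J]%SET = K.

Lemma maps_card z J K : maps z J K -> #|J| = #|K|.
Proof.
move=> [f hf <-]; rewrite card_in_imset // => i j iJ jJ fij.
by apply/delta_inj/(@act_inj z); rewrite !hf // fij.
Qed.

(** If [g] carries [V_J] onto [V_K], its minimal representative modulo [W_J] and the inverse of that
    both preserve positivity, and extremality of simple roots does the rest. *)
Lemma supp_maps J K g :
  (forall j, j \in J -> supp K (act g (delta j))) ->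
  (forall k : I, k \in K -> supp J (act g^-1 (delta k))) ->
  exists2 x, inW J x & maps (g * x)%g J K.
Proof.
move=> sJ sK; have [x [xJ hx _ _]] := coset_min g J; exists x => //.
set z := (g * x)%g in hx *.
have sv v : supp J v -> supp K (act g v).
  move=> hv; rewrite (act_supp_sum g hv) => l lK; rewrite sum_ffunE big1 //.
  by move=> i iJ; rewrite ffunE sJ // scaler0.
have zs j : j \in J -> supp K (act z (delta j)).
  by move=> jJ; rewrite actM; apply/sv/supp_act => //; exact: supp_delta.
have zVs j : j \in K -> supp J (act z^-1 (delta j)).
  move=> jK; rewrite /z invgM actM; apply: supp_act; first exact: inWV.
  exact: sK.
have zVp j : j \in K -> nonneg (act z^-1 (delta j)).
  move=> jK; case: (root_sign m_cox c W_cox (z^-1)%g j) => // h.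
  have := act_cone h (suppN (zVs _ jK)) hx.
  by rewrite linearN /= actKV => /delta_not_neg.
have ex j : exists k : I, j \in J -> k \in K /\ act z (delta j) = delta k.
  case: (boolP (j \in J)) => [jJ|_]; last by exists j.
  have [k kK e] := simple_image (hx _ jJ) (zs _ jJ) zVp (actVK _ _ _ z (delta j)).
  by exists k.
have [f hf] := choice ex; exists f => [j /hf[]//|].
apply/setP => k; apply/imsetP/idP => [[j /hf[kK _] ->]//|kK].
have [j jJ e] := simple_image (zVp _ kK) (zVs _ kK) hx (actKV _ _ _ z (delta k)).
exists j => //; apply: delta_inj; rewrite -(hf j jJ).2 -e actKV //.
Qed.

Lemma maps_conj (u : W) J K w : maps u J K -> negw J w -> negw K (u * w * u^-1)%g.
Proof.
move=> [f hf fK] [/inWP[t tJ wt] hw]; split.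
  apply/inWP; exists (map f t) => [k /mapP[j jt ->]|]; first by rewrite -fK imset_f // tJ.
  rewrite wt => {wt}; elim: t tJ => [|j t IH] tJ /=.
    by rewrite word_nil mulg1 mulgV.
  rewrite !word_cons -(conj_s (hf j _)); last by apply: tJ; exact: mem_head.
  rewrite -IH; last by move=> l lt; apply: tJ; rewrite inE lt orbT.
  by rewrite -!mulgA mulKg.
move=> k; rewrite -fK => /imsetP[j jJ ->].
by rewrite !actM -(hf j jJ) actVK hw // linearN.
Qed.

Lemma maps_neg (u : W) J K : maps u J K -> negt J -> negt K.
Proof.
by move=> h /negtP[w hw]; apply/negtP; exists (u * w * u^-1)%g; exact: maps_conj hw.
Qed.

(** [w'] negates the images under [g] of the simple roots of [J], which puts them in [V_K]; the
    other inclusion follows by exchanging the roles. *)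
Lemma conj_negw J K w w' g : negw J w -> negw K w' -> (w' = g * w * g^-1)%g ->
  exists z, maps z J K.
Proof.
move=> hw hw' e.
have main A B x y h : negw A x -> negw B y -> (y = h * x * h^-1)%g ->
    forall j, j \in A -> supp B (act h (delta j)).
  move=> hx hy eq j jA l lB.
  have := act_sub_supp (act h (delta j)) hy.1 lB.
  rewrite eq !actM actVK hx.2 // linearN !ffunE => /eqP.
  by rewrite -mulr2n mulrn_eq0 /= => /eqP; lra.
have e' : (w = g^-1 * w' * g^-1^-1)%g.
  by rewrite e invgK -!mulgA mulVg mulg1 mulKg.
have [x _ mx] := supp_maps (main _ _ _ _ _ hw hw' e) (main _ _ _ _ _ hw' hw e').
by exists (g * x)%g.
Qed.

(** This makes the rank well defined. A conjugated generator negates its root, which therefore lies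
    in the space of the other parabolic subgroup. *)
Lemma parabolic_card J K g h : conj_set (inW J) g = conj_set (inW K) h -> #|J| = #|K|.
Proof.
have main A B g1 h1 : conj_set (inW A) g1 = conj_set (inW B) h1 ->
    forall j, j \in A -> supp B (act (h1 * g1^-1)%g (delta j)).
  move=> e j jA; have : conj_set (inW B) h1 (s j ^ g1)%g.
    by rewrite -e; exists (s j) => //; exact: inWs.
  move=> [y yB yj]; have ey : (y = (h1 * g1^-1) * s j * (h1 * g1^-1)^-1)%g.
    rewrite -[y](conjgK h1) yj !conjgE !invgM !invgK -!mulgA; done.
  move=> l lB; have := act_sub_supp (act (h1 * g1^-1)%g (delta j)) yB lB.
  rewrite ey !(actM, actVK) -!actM (actM _ _ _ _ (s j)) act_s refl_delta // linearN !ffunE.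
  by move/eqP; rewrite -mulr2n mulrn_eq0 /= => /eqP; lra.
move=> e; have h2 : forall j, j \in K -> supp J (act (h * g^-1)^-1 (delta j)).
  by rewrite invgM invgK; exact: main (esym e).
by have [x _ /maps_card] := supp_maps (main _ _ _ _ e) h2.
Qed.

(* If [negt J], then [u] is [w_N w_J] with [N = i |: J] and [w_N], [w_J] the
   longest elements; in particular [W_N] is finite. *)
Definition step J J' := exists i (u : W), [/\ i \notin J, inW (i |: J) u,
  maps u J J', J' \subset i |: J & nonneg (- act u (delta i))].

(** Induction on the length of [z]. A simple root [i] that [z] makes negative is not in [J], and
    splitting off the [W_(J+i)] part of [z] gives one step and a shorter element. [E] stands for any
    preorder containing the steps, such as connectivity in the odd graph. *)
Lemma maps_chain (E : {set I} -> {set I} -> Prop) z J K :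
  (forall A, E A A) -> (forall B A C, E A B -> E B C -> E A C) ->
  (forall A B, negt A -> negt B -> step A B -> E A B) ->
  negt J -> maps z J K -> E J K.
Proof.
move=> Er Et Es; have [n] := ubnP (ell z).
elim: n z J => // n IH z J; rewrite ltnS => zn nJ [f hf fK].
case: (pselect (forall i, nonneg (act z (delta i)))) => [h|/existsNP[i ni]].
  have z1 : z = 1%g by apply: (@pos_eq1 [set: I]%SET) => //; exact: inWT.
  suff -> : K = J by exact: Er.
  rewrite -fK -[RHS]imset_id; apply: eq_in_imset => j jJ.
  by apply: delta_inj; rewrite -hf // z1 act1.
have ineg : nonneg (- act z (delta i)) by case: (root_sign m_cox c W_cox z i).
have iJ : i \notin J.
  by apply: contraPN ineg => iJ; rewrite hf //; exact: delta_not_neg.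
have [y [yN hy _ lt]] := coset_min z (i |: J).
set z' := (z * y)%g in hy lt; pose u := (y^-1)%g.
have uN : inW (i |: J) u by exact: inWV.
have zu : z = (z' * u)%g by rewrite /u mulgK.
have ex j : exists l, j \in J ->
    [/\ l \in i |: J, act u (delta j) = delta l & act z' (delta l) = delta (f j)].
  case: (boolP (j \in J)) => [jJ|_]; last by exists j.
  have e : act z' (act u (delta j)) = delta (f j) by rewrite -actM -zu hf.
  have su : supp (i |: J) (act u (delta j)).
    by apply: supp_act => //; apply: supp_delta; rewrite !inE jJ orbT.
  have pu : nonneg (act u (delta j)).
    case: (root_sign m_cox c W_cox u j) => // h.
    by have := act_cone h (suppN su) hy; rewrite linearN /= e => /delta_not_neg.
  have [l lN el] := simple_image pu su hy e.
  by exists l => _; split=> //; rewrite -el.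
have [f' hf'] := choice ex.
pose J' := [set f' j | j in J]%SET.
have mu : maps u J J' by exists f' => // j /hf'[].
have nJ' := maps_neg mu nJ.
have st : step J J'.
  exists i, u; split=> //.
    by apply/subsetP => _ /imsetP[j /hf'[lN _ _] ->].
  case: (root_sign m_cox c W_cox u i) => // h; exfalso.
  have su : supp (i |: J) (act u (delta i)).
    by apply: supp_act => //; apply: supp_delta; rewrite !inE eqxx.
  have := act_cone h su hy; rewrite -actM -zu => /nonneg_anti/(_ ineg)/eqP.
  by rewrite (negPf (act_neq0 _ _ _ _ (delta_neq0 R i))).
apply: (Et J'); first exact: Es.
have mz : maps z' J' K.
  (* The search succeeds for every [l] in [J']; the default value only makes the function total. *)
  exists (fun l => odflt l [pick l' | act z' (delta l) == delta l']).
    move=> _ /imsetP[j jJ ->]; have [_ _ ->] := hf' j jJ.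
    case: pickP => [l' /eqP/delta_inj->//|/(_ (f j))]; by rewrite eqxx.
  rewrite -fK /J' -imset_comp; apply: eq_in_imset => j jJ /=.
  have [_ _ ->] := hf' j jJ.
  by case: pickP => [l' /eqP/delta_inj->//|/(_ (f j))]; rewrite eqxx.
apply: (IH z') => //; apply: leq_trans (lt _) zn.
by move=> /(_ i); rewrite !inE eqxx => /(_ isT).
Qed.

End Involutions.

(** * Weights of branches *)

Section Decorations.
Variables (I : finType) (m : I -> I -> option nat).
Hypothesis m_cox : coxeter_matrix m.
Variables (R : realFieldType) (c : cosine_table R).
Implicit Types (i j x y z b : I) (k n : nat) (D N S T : {set I}).
Local Notation V := {ffun I -> R^o}.
Implicit Types (v d : V) (p q : seq I).
Local Notation hform := (hform m c).
Local Notation bform := (bform m c).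
Local Notation delta := (@delta I R).
Local Notation e := (diagram_edge m).

Lemma edge_sym x y : e x y = e y x.
Proof. by rewrite /diagram_edge eq_sym (m_sym m_cox). Qed.

Lemma edge_irr x : e x x = false.
Proof. by rewrite /diagram_edge eqxx. Qed.

Lemma edge_neq x y : e x y -> x != y.
Proof. by case/andP. Qed.

Lemma nonedgeP x y : x != y -> (~~ e x y) = (m x y == Some 2).
Proof.
move=> xy; rewrite /diagram_edge xy /=; case E: (m x y) => [n|] //.
have := m_ge2 m_cox xy E => n2.
by rewrite -leqNgt; apply/idP/eqP => [h|[->]//]; congr Some; lia.
Qed.

Lemma b_nonedge x y : x != y -> ~~ e x y -> bform x y = 0.
Proof. by move=> xy; rewrite nonedgeP // /bform => /eqP ->; rewrite ct_2 oppr0. Qed.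

Definition label_ge n x y := if m x y is Some k then (n <= k)%N else true.

Lemma b_label n x y : (1 < n)%N -> x != y -> label_ge n x y -> bform x y <= - c n.
Proof.
move=> n1 xy; rewrite /label_ge /bform; case E: (m x y) => [k|] h.
  by rewrite lerN2 ct_homo // ltnW.
by have := ct_lt1 c n1; lra.
Qed.

Lemma b_edge x y : e x y -> bform x y <= - (1 / 2).
Proof.
by case/andP => xy h; rewrite -(ct_3 c); apply: b_label.
Qed.

(* Holds when the form is positive definite on [V_N]; it is all that the
   classification of finite types uses. *)
Definition nonaff N := forall v, nonneg v -> supp N v ->
  (forall i, v i != 0 -> hform i v <= 0) -> v = 0.

Lemma nonaffS N S : S \subset N -> nonaff N -> nonaff S.
Proof. by move=> sub h v pv sv; apply: h => //; exact: suppS sv. Qed.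

Lemma h_off d x : nonneg d -> d x = 0 -> hform x d <= 0.
Proof.
move=> pd dx; rewrite /hform; apply: sumr_le0 => j _.
have [->|jx] := eqVneq j x; first by rewrite dx mulr0.
by apply: mulr_le0_ge0 => //; apply: b_le0 => //; rewrite eq_sym.
Qed.

(* A certificate, supported on [T], that the branch [T] at [b] contributes at
   least [k] against the diagonal entry 1 of [b]: once disjoint branches reach
   a total of 1, the form is not positive definite. *)
Definition deco b T (k : R) := [/\ b \notin T & exists d,
  [/\ nonneg d, supp T d, (forall x, x != b -> hform x (delta b + d) <= 0)
    & hform b d <= - k]].

Lemma deco_lt1 N b T (k : R) : nonaff N -> b \in N -> T \subset N ->
  deco b T k -> k < 1.
Proof.
move=> aff bN TN [bT [d [pd sd hx hb]]]; rewrite ltNge; apply/negP => k1.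
have : delta b + d = 0.
  apply: aff.
  - exact/nonnegD/pd/nonneg_delta.
  - by apply: suppD; [exact: supp_delta|exact: suppS sd].
  move=> i _; have [->|ib] := eqVneq i b; last exact: hx.
  rewrite linearD /= h_delta b_ii //; lra.
move/ffunP/(_ b); rewrite !ffunE eqxx sd // addr0 => /eqP.
by rewrite oner_eq0.
Qed.

Lemma decoW b T T' (k k' : R) : T \subset T' -> b \notin T' -> k' <= k ->
  deco b T k -> deco b T' k'.
Proof.
move=> sT bT' kk [bT [d [pd sd hx hb]]]; split=> //; exists d; split=> //.
  exact: suppS sd.
lra.
Qed.

Lemma deco0 b : deco b set0 0.
Proof.
split; first by rewrite inE.
exists 0; split; [exact: nonneg0|by move=> i _; rewrite ffunE| |].
  move=> x xb; rewrite addr0 h_delta; exact: b_le0.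
by rewrite linear0 oppr0.
Qed.

(** A nonnegative vector contributes at most 0 off its support, so certificates on disjoint branches
    add up. *)
Lemma decoU b T1 T2 (k1 k2 : R) : [disjoint T1 & T2] ->
  deco b T1 k1 -> deco b T2 k2 -> deco b (T1 :|: T2) (k1 + k2).
Proof.
move=> dj [b1 [d1 [p1 s1 x1 h1]]] [b2 [d2 [p2 s2 x2 h2]]].
split; first by rewrite inE negb_or b1.
exists (d1 + d2); split; first exact: nonnegD.
- by apply: suppD; [apply: suppS s1; exact: subsetUl|apply: suppS s2; exact: subsetUr].
- move=> x xb; case: (boolP (x \in T1)) => xT.
    have := x1 x xb; rewrite !linearD /=.
    have xT2 : x \notin T2 by rewrite (disjointFr dj xT).
    have := h_off p2 (s2 x xT2); lra.
  have := x2 x xb; rewrite !linearD /=.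
  have := h_off p1 (s1 x xT); lra.
- rewrite linearD /=; lra.
Qed.

(** Eliminating [y] turns a branch of weight [k] at [y] into one of weight [q / (1 - k)] at [x]: one
    step of a continued fraction. *)
Lemma deco_step N x y T (q k k' : R) : nonaff N -> y \in N -> T \subset N ->
  x \notin y |: T -> 0 <= q -> q <= bform x y ^+ 2 -> k' * (1 - k) <= q ->
  deco y T k -> deco x (y |: T) k'.
Proof.
move=> aff yN TN xT q0 qb hk dy; have k1 := deco_lt1 aff yN TN dy.
have xy : x != y by apply: contraNneq xT => ->; rewrite !inE eqxx.
have bx := b_le0 m_cox c xy.
case: dy => yT [d [pd sd hx hb]]; split=> //.
(* The multiple of [delta y + d] that balances [delta x] at [y]: the upper bound for [hform y]
   becomes 0. *)
pose t : R := - bform x y / (1 - k).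
have k1' : 0 < 1 - k by lra.
have t0 : 0 <= t by apply: divr_ge0; lra.
exists (t *: (delta y + d)); split.
- exact/nonnegZ/nonnegD/pd/nonneg_delta.
- apply/suppZ/suppD; first by apply: supp_delta; rewrite !inE eqxx.
  by apply: suppS sd; exact: subsetUr.
- move=> z zx; rewrite linearD linearZ /= h_delta.
  have [->|zy] := eqVneq z y.
    rewrite linearD /= h_delta b_ii // (b_sym m_cox c).
    have : t * (1 - k) = - bform x y by rewrite /t; field; lra.
    have : t * (1 + hform y d) <= t * (1 - k) by apply: ler_wpM2l => //; lra.
    lra.
  have := hx z zy; have := b_le0 m_cox c zx; nra.
- have dx : d x = 0 by apply: sd; apply: contra xT => h; rewrite !inE h orbT.
  have h1 := h_off pd dx; rewrite linearZ /= linearD /= h_delta.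
  have h2 : t * (1 - k) = - bform x y by rewrite /t; field; lra.
  have h3 : k' <= t * - bform x y.
    have : k' * (1 - k) <= (t * - bform x y) * (1 - k).
      by rewrite mulrAC h2; apply: le_trans hk _; apply: le_trans qb _; rewrite expr2; lra.
    by rewrite ler_pM2r.
  nra.
Qed.

Lemma sqr_label n (q : R) x y : (1 < n)%N -> x != y -> label_ge n x y ->
  0 <= q -> q <= c n ^+ 2 -> q <= bform x y ^+ 2.
Proof.
move=> n1 xy h q0 qc; have := b_label n1 xy h; have := ct_ge0 c n1; nra.
Qed.

Lemma sqr_edge x y : e x y -> 1 / 4 <= bform x y ^+ 2.
Proof. by move=> h; have := b_edge h; nra. Qed.

Lemma sqr_label4 x y : x != y -> label_ge 4 x y -> 1 / 2 <= bform x y ^+ 2.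
Proof. move=> xy h; apply: (@sqr_label 4) => //; [lra|]; have := ct_4 c; lra. Qed.

(** cos^2 (pi / 5) is about 0.6545. The classification needs a rational bound above [1 - kap 3],
    which is 5/8. *)
Lemma sqr_label5 x y : x != y -> label_ge 5 x y -> 13 / 20 <= bform x y ^+ 2.
Proof.
move=> xy h; apply: (@sqr_label 5) => //; first lra.
have := ct_5 c; have : c 3 <= c 5 by exact: ct_homo.
rewrite ct_3; nra.
Qed.

Lemma sqr_label6 x y : x != y -> label_ge 6 x y -> 3 / 4 <= bform x y ^+ 2.
Proof. move=> xy h; apply: (@sqr_label 6) => //; [lra|]; have := ct_6 c; lra. Qed.

Lemma sqr_inf x y : m x y = None -> 1 <= bform x y ^+ 2.
Proof. by rewrite /bform => ->; rewrite sqrrN expr1n. Qed.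

Definition seqset p : {set I} := [set x in p].

Lemma seqset_cons x p : seqset (x :: p) = x |: seqset p.
Proof. by apply/setP => y; rewrite !inE. Qed.

(* The weight of an arm of [k] vertices with simple edges. *)
Definition kap k : R := k%:R / (2 * k.+1%:R).

(** The recursion of [deco_step] for a simple edge, where [bform] squares to 1/4. *)
Lemma kapS k : kap k.+1 * (1 - kap k) = 1 / 4.
Proof.
rewrite /kap; have : 0 <= k%:R :> R by exact: ler0n.
rewrite -(natr1 k.+1) -(natr1 k) => h; field; lra.
Qed.

Lemma arm_deco N b p : nonaff N -> b \in N -> {subset p <= N} -> uniq (b :: p) ->
  path e b p -> deco b (seqset p) (kap (size p)).
Proof.
move=> aff; elim: p b => [|y p IH] b bN pN /=.
  move=> _ _; rewrite (_ : seqset [::] = set0); last by apply/setP => x; rewrite !inE.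
  rewrite /kap mul0r; exact: deco0.
case/andP => bp up /andP[by_ pp].
have yN : y \in N by apply: pN; exact: mem_head.
have pN' : {subset p <= N} by move=> z zp; apply: pN; rewrite inE zp orbT.
rewrite seqset_cons; apply: (@deco_step N _ _ _ (1 / 4) (kap (size p))) => //.
- by apply/subsetP => z; rewrite inE => /pN'.
- by rewrite !inE in bp *.
- lra.
- exact: sqr_edge.
- by rewrite kapS.
- exact: IH.
Qed.

(* A branch of weight 1/2 at the far end of a path keeps its weight along the
   path; this covers the diagrams of affine types B, C and D at once. *)
Lemma half_deco N b p T : nonaff N -> b \in N -> {subset p <= N} -> T \subset N ->
  uniq (b :: p) -> (forall x, x \in b :: p -> x \notin T) -> path e b p ->
  deco (last b p) T (1 / 2) -> deco b (seqset p :|: T) (1 / 2).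
Proof.
move=> aff; elim: p b => [|y p IH] b bN pN TN /=.
  move=> _ _ _ dl; rewrite (_ : seqset [::] = set0) ?set0U //.
case/andP => bp up dT /andP[by_ pp] dl.
have yN : y \in N by apply: pN; exact: mem_head.
have pN' : {subset p <= N} by move=> z zp; apply: pN; rewrite inE zp orbT.
rewrite seqset_cons -setUA; apply: (@deco_step N _ _ _ (1 / 4) (1 / 2)) => //.
- by rewrite subUset TN andbT; apply/subsetP => z; rewrite inE => /pN'.
- have := dT b (mem_head _ _); move: bp; rewrite !inE !negb_or.
  by case/andP=> -> -> ->.
- lra.
- exact: sqr_edge.
- lra.
- apply: IH => // x xp; apply: dT; by rewrite inE xp orbT.
Qed.

(** * Counting edges: the diagrams are forests *)

Definition deg D x := #|[set y in D | e x y]|.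

Definition ecount D := (\sum_(x in D) deg D x)%N.

Lemma deg_setU1 D x y : x \notin D -> deg (x |: D) y = (e y x + deg D y)%N.
Proof.
move=> xD; rewrite /deg; case: (boolP (e y x)) => h /=.
  rewrite (_ : [set z in x |: D | e y z] = x |: [set z in D | e y z]).
    by rewrite cardsU1 inE (negPf xD).
  by apply/setP => z; rewrite !inE; case: eqP => //= ->; rewrite h.
rewrite add0n; congr #|pred_of_set _|; apply/setP => z; rewrite !inE.
by case: eqP => //= ->; rewrite (negPf h) andbF.
Qed.

Lemma ecount_setU1 D x : x \notin D -> ecount (x |: D) = (ecount D + 2 * deg D x)%N.
Proof.
move=> xD; rewrite /ecount big_setU1 //= deg_setU1 // edge_irr add0n.
rewrite (eq_bigr (fun y => e y x + deg D y)%N); last by move=> y _; rewrite deg_setU1.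
rewrite big_split /= addnA addnC mul2n -addnn; congr (_ + (_ + _))%N.
rewrite /deg -sum1_card big_mkcond [RHS]big_mkcond /=.
rewrite [LHS]big_mkcond [RHS]big_mkcond /=.
by apply: eq_bigr => y _; rewrite !inE edge_sym; case: (y \in D) => //=; case: (e x y).
Qed.

(** If all degrees in [D] were at least 2, the sum of its simple roots would contradict [nonaff];
    for a cycle this is affine type A. *)
Lemma mindeg N D : nonaff N -> D \subset N -> D != set0 ->
  exists2 x, x \in D & (deg D x <= 1)%N.
Proof.
move=> aff DN D0; have [/existsP[x /andP[]]|] := boolP [exists x in D, deg D x <= 1]%N.
  by exists x.
rewrite negb_exists => /forallP H.
have {}H x : x \in D -> (1 < deg D x)%N.
  by move=> xD; have := H x; rewrite xD /= -ltnNge.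
pose v : V := \sum_(x in D) delta x.
have vE i : v i = (i \in D)%:R.
  rewrite /v sum_ffunE; case: (boolP (i \in D)) => iD.
    rewrite (bigD1 i) //= deltaE eqxx big1 ?addr0 // => j /andP[_ ji].
    by rewrite deltaE eq_sym (negPf ji).
  by rewrite big1 // => j jD; rewrite deltaE; case: eqP jD iD => // -> ->.
have : v = 0.
  apply: aff.
  - by move=> i; rewrite vE ler0n.
  - by move=> i iN; rewrite vE; case: (boolP (i \in D)) iN => // /(subsetP DN) ->.
  move=> i; rewrite vE; case: (boolP (i \in D)) => [iD _|]; last by rewrite eqxx.
  have := H i iD => Hi.
  rewrite /v linear_sum (bigD1 i) //= h_delta b_ii //.
  have : \sum_(j in D | j != i) hform i (delta j) <=
         \sum_(j in [set y in D | e i y]) - (1 / 2 : R).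
    rewrite (bigID (e i)) /= -[leRHS]addr0; apply: lerD; last first.
      apply: sumr_le0 => j /andP[/andP[_ ji] _]; rewrite h_delta; apply: b_le0 => //.
      by rewrite eq_sym.
    rewrite (eq_bigl [in [set y in D | e i y]]).
      by apply: ler_sum => j; rewrite !inE h_delta => /andP[_ /b_edge].
    move=> j; rewrite !inE; case: (j \in D) => //=; case: (boolP (e i j)) => [|_].
      by move=> /edge_neq; rewrite eq_sym => ->.
    by rewrite andbF.
  rewrite sumr_const -/(deg D i) => h.
  have : (2%:R : R) <= (deg D i)%:R by rewrite ler_nat.
  by move: h; rewrite -mulr_natl; lra.
have /set0Pn[x xD] := D0.
by move/ffunP/(_ x); rewrite vE xD ffunE => /eqP; rewrite oner_eq0.
Qed.

Lemma ecount_le N D : nonaff N -> D \subset N -> D != set0 ->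
  (ecount D + 2 <= 2 * #|D|)%N.
Proof.
move=> aff; have [n] := ubnP #|D|; elim: n D => // n IH D; rewrite ltnS => Dn DN D0.
have [x xD dx] := mindeg aff DN D0.
have eD : D = x |: (D :\ x) by rewrite setD1K.
have xn : x \notin D :\ x by rewrite !inE eqxx.
have dx' : (deg (D :\ x) x <= 1)%N by move: dx; rewrite eD deg_setU1 // edge_irr -eD.
have cD : #|D| = (#|D :\ x|).+1 by rewrite {1}eD cardsU1 xn.
rewrite eD ecount_setU1 // -eD cD.
have [D'0|D'0] := eqVneq (D :\ x) set0.
  by rewrite D'0 /ecount /deg big_set0 cards0 (_ : [set y in set0 | _] = set0) ?cards0 //;
    apply/setP => y; rewrite !inE.
have := IH (D :\ x); rewrite D'0 => H.
have : (ecount (D :\ x) + 2 <= 2 * #|D :\ x|)%N.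
  apply: H => //; first by rewrite -cD.
  by apply: subset_trans DN; exact: subD1set.
lia.
Qed.

(** The inequality on [ecount], which counts each edge twice, says that [D] has the number of edges
    of a tree. A second edge from [x] would exceed the bound for forests. *)
Lemma unique_attach N D x y : nonaff N -> x |: D \subset N -> x \notin D ->
  (2 * #|D| <= ecount D + 2)%N -> y \in D -> e x y ->
  (forall z, z \in D -> e x z -> z = y) /\
  (2 * #|x |: D| <= ecount (x |: D) + 2)%N.
Proof.
move=> aff DN xD tree yD exy.
have D0 : x |: D != set0 by apply/set0Pn; exists x; rewrite !inE eqxx.
have := ecount_le aff DN D0; rewrite ecount_setU1 // cardsU1 xD => h.
have y1 : y \in [set z in D | e x z] by rewrite inE yD.
have : deg D x = 1.
  by have : (0 < deg D x)%N; [rewrite card_gt0; apply/set0Pn; exists y|lia].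
move=> d1; split; last by lia.
move=> z zD exz; have /eqP/cards1P[a ea] := d1.
have : z \in [set z in D | e x z] by rewrite inE zD.
by move: y1; rewrite ea !inE => /eqP -> /eqP.
Qed.

End Decorations.

(** * Shapes of diagrams of finite type *)

Section Shapes.
Variables (I : finType) (m : I -> I -> option nat).
Hypothesis m_cox : coxeter_matrix m.
Variables (R : realFieldType) (c : cosine_table R).
Implicit Types (x y z b u v : I) (k n : nat) (C D N S T : {set I}).
Implicit Types (p q r : seq I).
Local Notation e := (diagram_edge m).
Local Notation nonaff := (nonaff m c).
Local Notation deco := (deco m c).
Local Notation kap := (kap R).

(** Induced paths: no chords are allowed. *)
Fixpoint ipath x p :=
  if p is y :: p' then [&& e x y, all (fun z => ~~ e x z) p' & ipath y p'] else true.

Definition cross p q := all (fun x => all (fun y => ~~ e x y) q) p.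

Definition light x y := m x y == Some 3.

Lemma crossP p q : reflect (forall x y, x \in p -> y \in q -> ~~ e x y) (cross p q).
Proof.
apply: (iffP allP) => [h x y /h /allP|h x xp]; first exact.
by apply/allP => y; exact: h.
Qed.

Lemma cross_sym p q : cross p q -> cross q p.
Proof. by move/crossP => h; apply/crossP => x y xq yp; rewrite edge_sym // h. Qed.

Lemma ipath_path x p : ipath x p -> path e x p.
Proof. by elim: p x => //= y p IH x /and3P[-> _ /IH]. Qed.

Lemma ipath_rcons x p y : ipath x p -> e (last x p) y ->
  (forall z, z \in belast x p -> ~~ e z y) -> ipath x (rcons p y).
Proof.
elim: p x => [|a p IH] x /=; first by move=> _ ->.
case/and3P => xa xp ap lst h; rewrite xa all_rcons xp (h x (mem_head _ _)) /=.
by apply: IH => // z zp; apply: h; rewrite inE zp orbT.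
Qed.

Lemma ipath_split b p1 y p2 : ipath b (p1 ++ y :: p2) ->
  [/\ ipath y p2, ipath y (rev (b :: p1)) & cross (b :: p1) p2].
Proof.
elim: p1 b => [|a p1 IH] b /=.
  by case/and3P => by_ bp yp; rewrite /= edge_sym // by_ yp bp.
case/and3P => ba bp /IH[yp2 yr cr]; move: bp; rewrite all_cat /= => /and3P[bp1 nby bp2].
split=> //; last by rewrite /= bp2; exact: cr.
rewrite rev_cons; apply: ipath_rcons => //.
  by rewrite rev_cons last_rcons edge_sym.
move=> z; rewrite rev_cons belast_rcons inE mem_rev edge_sym // => /orP[/eqP->//|zp].
exact: (allP bp1).
Qed.

(* Three arms, possibly empty, attached to [b]. *)
Definition star b p q r := [/\ uniq (b :: p ++ q ++ r),
  [/\ ipath b p, ipath b q & ipath b r]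
  & [/\ cross p q, cross p r & cross q r]].

Definition starset b p q r : {set I} := [set x in b :: p ++ q ++ r].

Lemma star_sw12 b p q r : star b p q r -> star b q p r.
Proof.
move=> [u [ip iq ir] [pq pr qr]]; split=> //; last by split=> //; exact: cross_sym.
by rewrite (perm_uniq (s2 := b :: p ++ q ++ r)) // perm_cons perm_catCA.
Qed.

Lemma starset_sw12 b p q r : starset b p q r = starset b q p r.
Proof. by apply/setP => x; rewrite !(inE, mem_cat); congr (_ || _); rewrite orbCA. Qed.

Lemma star_sw23 b p q r : star b p q r -> star b p r q.
Proof.
move=> [u [ip iq ir] [pq pr qr]]; split=> //; last by split=> //; exact: cross_sym.
by rewrite (perm_uniq (s2 := b :: p ++ q ++ r)) // perm_cons perm_cat2l perm_catC.
Qed.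

Lemma starset_sw23 b p q r : starset b p q r = starset b p r q.
Proof. by apply/setP => x; rewrite !(inE, mem_cat); congr (_ || (_ || _)); rewrite orbC. Qed.

Lemma star_uniq b p q r : star b p q r ->
  [/\ uniq (b :: p), uniq (b :: q), uniq (b :: r) &
   [/\ [disjoint seqset p & seqset q], [disjoint seqset p & seqset r]
     & [disjoint seqset q & seqset r]]].
Proof.
have dj s t : ~~ has (mem s) t -> [disjoint seqset s & seqset t].
  move=> h; apply/pred0P => x; rewrite /= !inE; apply/negbTE; apply: contra h.
  by case/andP => xs xt; apply/hasP; exists x.
move=> [u _ _]; move: u; rewrite /= !(mem_cat, cat_uniq, has_cat, negb_or).
case/andP=> /and3P[-> -> ->] /and3P[-> /andP[h1 h2] /and3P[-> h3 ->]].
by split=> //; split; apply: dj.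
Qed.

Lemma kap_ge k : (0 < k)%N -> 1 / 4 <= kap k.
Proof.
move=> k0; rewrite /kap; have : 1 <= k%:R :> R by rewrite ler1n.
rewrite -(natr1 k) => h; rewrite ler_pdivlMr; lra.
Qed.

Lemma kap_homo k k' : (k <= k')%N -> kap k <= kap k'.
Proof.
move=> kk; rewrite /kap; have : k%:R <= k'%:R :> R by rewrite ler_nat.
have : 0 <= k%:R :> R by exact: ler0n.
rewrite -(natr1 k) -(natr1 k') => h0 h.
rewrite ler_pdivrMr; last lra; rewrite mulrAC ler_pdivlMr; nra.
Qed.

Section InNonaff.
Variable N : {set I}.
Hypothesis aff : nonaff N.

Lemma ipath_deco b p : b \in N -> {subset p <= N} -> uniq (b :: p) ->
  ipath b p -> deco b (seqset p) (kap (size p)).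
Proof. by move=> bN pN up /ipath_path; apply: (arm_deco m_cox aff). Qed.

Lemma star_deco b p q r : starset b p q r \subset N -> star b p q r ->
  [/\ deco b (seqset p) (kap (size p)), deco b (seqset q) (kap (size q))
    & deco b (seqset r) (kap (size r))].
Proof.
move=> /subsetP sN st; have [up uq ur _] := star_uniq st.
have [_ [ip iq ir] _] := st.
have bN : b \in N by apply: sN; rewrite !inE eqxx.
split; apply: ipath_deco => // x xp; apply: sN; rewrite !(inE, mem_cat) xp ?orbT //.
Qed.

Lemma seqset_sub p : {subset p <= N} -> seqset p \subset N.
Proof. by move=> h; apply/subsetP => x; rewrite inE => /h. Qed.

Lemma deco2_absurd b S T (k1 k2 : R) : b \in N -> S \subset N -> T \subset N ->
  [disjoint S & T] -> deco b S k1 -> deco b T k2 -> 1 <= k1 + k2 -> False.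
Proof.
move=> bN SN TN ST dS dT; rewrite leNgt => /negP; apply.
apply: (deco_lt1 m_cox aff bN _ (decoU m_cox ST dS dT)).
by rewrite subUset SN.
Qed.

Lemma deco_edge b x (k : R) : b \in N -> x \in N -> b != x -> 0 <= k ->
  k <= (bform m c b x) ^+ 2 -> deco b [set x] k.
Proof.
move=> bN xN bx k0 h; rewrite -[[set x]]setU0.
apply: (deco_step m_cox aff _ _ _ k0 h) (deco0 m_cox c x) => //.
- exact: sub0set.
- by rewrite !inE orbF.
- by rewrite subr0 mulr1.
Qed.

(** As [kap k] is [(1 - 1 / (k + 1)) / 2], this is the classical condition that the reciprocals of
    the arm lengths plus one have a sum greater than 1. *)
Lemma star_sum b p q r : starset b p q r \subset N -> star b p q r ->
  kap (size p) + kap (size q) + kap (size r) < 1.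
Proof.
move=> sN st; have [dp dq dr] := star_deco sN st.
have [_ _ _ [pq pr qr]] := star_uniq st.
have sN' := subsetP sN.
have bN : b \in N by apply: sN'; rewrite !inE eqxx.
apply: (deco_lt1 m_cox aff bN _ (decoU m_cox _ (decoU m_cox pq dp dq) dr)).
  apply/subsetP => x; rewrite !inE => h; apply: sN'.
  by rewrite !(inE, mem_cat); move: h => /orP[/orP[]|] ->; rewrite ?orbT.
apply/pred0P => x /=; rewrite !inE; apply/negbTE/negP => /andP[/orP[]h1 h2].
  by have := disjointFr pr (x := x); rewrite !inE h1 h2 => /(_ isT).
by have := disjointFr qr (x := x); rewrite !inE h1 h2 => /(_ isT).
Qed.

Lemma star_disj b p q r x : star b p q r -> x \in p -> x \notin q /\ x \notin r.
Proof.
move=> /star_uniq[_ _ _ [pq pr _]] xp.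
have := disjointFr pq (x := x); have := disjointFr pr (x := x).
by rewrite !inE xp => /(_ isT) -> /(_ isT) ->.
Qed.

Lemma ngh_nil p : p != [::] -> (0 < size p)%N.
Proof. by case: p. Qed.

(** An edge with label at least 4 weighs 1/2 or more, and 1/2 is the fixed point of the recursion
    along simple edges: [1 / 2 * (1 - 1 / 2) = 1 / 4]. *)
Lemma heavy_arm b p : b \in N -> {subset p <= N} -> uniq (b :: p) ->
  ipath b p -> ~~ path light b p -> deco b (seqset p) (1 / 2).
Proof.
move=> bN pN up /ipath_path ip; move: up pN ip.
elim: p b bN => // v p IH b bN /andP[bp up] pN /= /andP[bv vp].
have vN : v \in N by apply: pN; exact: mem_head.
have pN' : {subset p <= N} by move=> z zp; apply: pN; rewrite inE zp orbT.
rewrite negb_and => /orP[nl|nl].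
  apply: (@decoW _ _ _ _ _ [set v] _ (1 / 2)) => //.
  - by apply/subsetP => z; rewrite !inE => /eqP ->; rewrite eqxx.
  - by rewrite inE.
  have bv' := edge_neq bv.
  apply: deco_edge => //; first lra.
  apply: (sqr_label4 c) => //; move: bv nl; rewrite /diagram_edge bv' /light /label_ge /=.
  by case: (m b v) => // n n3 h; rewrite ltn_neqAle n3 andbT; apply: contra h => /eqP <-.
rewrite seqset_cons; apply: (@deco_step _ _ m_cox _ _ N _ _ _ (1 / 4) (1 / 2)) => //.
- exact: seqset_sub.
- by move: bp; rewrite !inE.
- lra.
- exact: (sqr_edge c).
- lra.
- exact: IH.
Qed.

(** A heavy arm would weigh 1/2 and the two other arms at least 1/4 each, as in affine type B. *)
Lemma star3_light b p q r : starset b p q r \subset N -> star b p q r ->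
  q != [::] -> r != [::] -> path light b p.
Proof.
move=> sN st q0 r0; apply: contraT => nl; exfalso.
have [_ dq dr] := star_deco sN st; have [up _ _ [pq pr qr]] := star_uniq st.
have sN' := subsetP sN; have bN : b \in N by apply: sN'; rewrite !inE eqxx.
have [_ [ip _ _] _] := st.
have pN : {subset p <= N} by move=> x xp; apply: sN'; rewrite !(inE, mem_cat) xp orbT.
have qN : {subset q <= N} by move=> x xp; apply: sN'; rewrite !(inE, mem_cat) xp !orbT.
have rN : {subset r <= N} by move=> x xp; apply: sN'; rewrite !(inE, mem_cat) xp !orbT.
apply: (deco2_absurd bN _ _ _ (heavy_arm bN pN up ip nl) (decoU m_cox qr dq dr)).
- exact: seqset_sub.
- by rewrite subUset !seqset_sub.
- apply/pred0P => x /=; rewrite !inE; apply/negbTE/negP => /andP[xp].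
  by have [/negPf -> /negPf ->] := star_disj st xp.
have := kap_ge (ngh_nil q0); have := kap_ge (ngh_nil r0); lra.
Qed.

Definition shape D := exists b p q r, [/\ star b p q r, D = starset b p q r
  & (q = [::] /\ r = [::]) \/ [&& p != [::], q != [::] & r != [::]]].

Lemma grow_end b p q r x y : star b p q r -> x \notin starset b p q r ->
  e x y -> (forall z, z \in starset b p q r -> e x z -> z = y) ->
  last b p = y -> (p != [::]) || (q == [::]) && (r == [::]) ->
  star b (rcons p x) q r.
Proof.
move=> st xn exy un ly ne; have [u [ip iq ir] [pq pr qr]] := st.
have yD : y \in b :: p by rewrite -ly mem_last.
have nz z : z \in q ++ r -> ~~ e x z.
  move=> zqr; apply/negP => exz; have zy : z = y.
    by apply: un => //; rewrite inE -cat_cons mem_cat zqr orbT.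
  move: u; rewrite -cat_cons cat_uniq => /and3P[_ /negP + _]; apply.
  by apply/hasP; exists z => //=; rewrite zy.
have nq : cross [:: x] q.
  by rewrite /cross /= andbT; apply/allP => z zq; apply: nz; rewrite mem_cat zq.
have nr : cross [:: x] r.
  by rewrite /cross /= andbT; apply/allP => z zq; apply: nz; rewrite mem_cat zq orbT.
split.
- rewrite (perm_uniq (s2 := x :: b :: p ++ q ++ r)).
    by rewrite cons_uniq u andbT; move: xn; rewrite inE.
  by rewrite -cats1 -catA; exact: (permEl (perm_catCA (b :: p) [:: x] (q ++ r))).
- split=> //; apply: ipath_rcons => //; first by rewrite ly edge_sym.
  move=> z zb; rewrite edge_sym //; apply/negP => exz.
  have zb' : z \in b :: p by rewrite lastI mem_rcons inE zb orbT.
  have zy : z = y by apply: un => //; rewrite inE -cat_cons mem_cat zb'.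
  move: u; rewrite -cat_cons cat_uniq lastI rcons_uniq => /and3P[/andP[/negP + _] _ _].
  by apply; rewrite ly -zy.
- by split=> //; rewrite /cross all_rcons -/(cross p _); apply/andP; split=> //;
    move: nq nr; rewrite /cross /= !andbT.
Qed.

Lemma starset_rcons b p q r x : starset b (rcons p x) q r = x |: starset b p q r.
Proof.
apply/setP => z; rewrite !(inE, mem_cat, mem_rcons).
by case: (z == b); case: (z == x); rewrite //= ?orbT.
Qed.

(** At the end of the arm [x] prolongs it. At an inner vertex [y] there would be a second fork: the
    side of [b] weighs 1/2, and [x] and the rest of the arm at least 1/4 each, as in affine type
    D. *)
Lemma grow_arm b p q r x y : star b p q r -> [&& p != [::], q != [::] & r != [::]] ->
  x \notin starset b p q r -> x |: starset b p q r \subset N ->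
  e x y -> (forall z, z \in starset b p q r -> e x z -> z = y) -> y \in p ->
  shape (x |: starset b p q r).
Proof.
move=> st /and3P[p0 q0 r0] xn sN exy un yp.
have [p1 [p2 ep]] : exists p1 p2, p = p1 ++ y :: p2.
  by case/splitPr: yp => p1 p2; exists p1, p2.
have [p20|p20] := eqVneq p2 [::].
  exists b, (rcons p x), q, r; rewrite starset_rcons; split=> //; last first.
    by right; rewrite q0 r0; case: (p).
  apply: grow_end exy un _ _ => //; last by rewrite p0.
  by rewrite ep p20 last_cat.
exfalso.
have sN' : starset b p q r \subset N by apply: subset_trans sN; exact: subsetUr.
have inN z : z \in b :: p ++ q ++ r -> z \in N by move=> h; apply: (subsetP sN'); rewrite inE.
have xN : x \in N by apply: (subsetP sN); rewrite !inE eqxx.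
have bN : b \in N by apply: inN; exact: mem_head.
have yN : y \in N by apply: inN; rewrite inE mem_cat yp orbT.
have [_ dq dr] := star_deco sN' st; have [up _ _ [pq pr qr]] := star_uniq st.
have [u [ip iq ir] _] := st.
have [iy2 iy1 _] : [/\ ipath y p2, ipath y (rev (b :: p1)) & cross (b :: p1) p2].
  by apply: ipath_split; rewrite -ep.
have dqr := decoU m_cox qr dq dr.
have dqr' : deco b (seqset q :|: seqset r) (1 / 2).
  apply: decoW dqr => //.
    rewrite !inE negb_or; have [bq br] : b \notin q /\ b \notin r; last by rewrite bq br.
    by move: u; rewrite /= !mem_cat !negb_or => /andP[/and3P[]].
  have := kap_ge (ngh_nil q0); have := kap_ge (ngh_nil r0); lra.
have qrN : seqset q :|: seqset r \subset N.
  by apply/subsetP => z; rewrite !inE => h; apply: inN; rewrite inE !mem_cat h !orbT.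
have upr : uniq (y :: rev (b :: p1)) /\ uniq (y :: p2).
  move: up; rewrite ep -cat_cons cat_uniq => /and3P[u1 hn u2]; split=> //.
  rewrite cons_uniq mem_rev rev_uniq u1 andbT; apply: contra hn => h.
  by apply/hasP; exists y => //; exact: mem_head.
have dj z : z \in b :: p -> z \notin seqset q :|: seqset r.
  rewrite !inE negb_or => /orP[/eqP->|zp].
    by move: u; rewrite /= !mem_cat !negb_or => /andP[/and3P[_ -> ->]].
  by have [-> ->] := star_disj st zp.
have memp1 z : z \in rev (b :: p1) -> z \in b :: p.
  by rewrite mem_rev ep !inE mem_cat => /orP[->//|->]; rewrite orbT.
have dl : deco y (seqset (rev (b :: p1)) :|: (seqset q :|: seqset r)) (1 / 2).
  apply: (half_deco m_cox aff yN) => //.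
  - by move=> z /memp1; rewrite inE => /orP[/eqP->//|zp]; apply: inN; rewrite inE mem_cat zp orbT.
  - exact: upr.1.
  - move=> z; rewrite inE => /orP[/eqP->|/memp1 h]; last exact: dj.
    by apply: dj; rewrite inE yp orbT.
  - exact: ipath_path.
  - by rewrite rev_cons last_rcons.
have p2N : {subset p2 <= N}.
  by move=> z zp; apply: inN; rewrite ep !(inE, mem_cat) zp !orbT.
have d2 := ipath_deco yN p2N upr.2 iy2.
have yx := edge_neq exy; rewrite eq_sym in yx.
have dx : deco y [set x] (1 / 4).
  apply: deco_edge => //; [lra|rewrite (b_sym m_cox c); exact: (sqr_edge c)].
have xn' z : z \in b :: p ++ q ++ r -> z != x.
  by move=> h; apply: contraNneq xn => <-; rewrite inE.
have dx2 : [disjoint [set x] & seqset p2].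
  apply/pred0P => z /=; rewrite !inE; apply/negbTE/negP => /andP[/eqP->].
  move=> zp; have := xn' x; rewrite eqxx => h; apply/notF/h.
  by rewrite ep !(inE, mem_cat) zp !orbT.
apply: (deco2_absurd yN _ _ _ (decoU m_cox dx2 dx d2) dl).
- by rewrite subUset sub1set xN seqset_sub.
- rewrite subUset qrN andbT; apply: seqset_sub => z /memp1 h; apply: inN.
  by rewrite -cat_cons mem_cat h.
- apply/pred0P => z /=; rewrite !inE; apply/negbTE/negP => /andP[/orP[/eqP->|zp2]].
    move=> h; have := xn' x; rewrite eqxx => /(_ _)/notF; apply; move: h.
    case/or3P => h; rewrite -cat_cons !mem_cat ?h ?orbT // memp1 //.
  case/or3P => h.
  - move: up; rewrite ep -cat_cons cat_uniq => /and3P[_ /negP + _]; apply.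
    apply/hasP; exists z; first by rewrite inE zp2 orbT.
    by move: h; rewrite mem_rev.
  - have := @dj z; rewrite ep !(inE, mem_cat) zp2 !orbT h => /(_ isT) //.
  - have := @dj z; rewrite ep !(inE, mem_cat) zp2 !orbT h orbT => /(_ isT) //.
have := kap_ge (ngh_nil p20); lra.
Qed.

Lemma shape_grow D x y : shape D -> x \notin D -> x |: D \subset N -> y \in D ->
  e x y -> (forall z, z \in D -> e x z -> z = y) -> shape (x |: D).
Proof.
move=> [b [p [q [r [st ->]]]]] ne xn sN yD exy un.
case: ne => [[q0 r0]|ne]; last first.
  move: yD; rewrite inE !inE !mem_cat => /or4P[/eqP yb|yp|yq|yr].
  (* Four arms of weight at least 1/4 each, as in affine D_4. *)
  - exfalso; have sN' : starset b p q r \subset N.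
      by apply: subset_trans sN; exact: subsetUr.
    have inN z : z \in b :: p ++ q ++ r -> z \in N.
      by move=> h; apply: (subsetP sN'); rewrite inE.
    have xN : x \in N by apply: (subsetP sN); rewrite !inE eqxx.
    have bN : b \in N by apply: inN; exact: mem_head.
    have [dp dq dr] := star_deco sN' st; have [_ _ _ [pq pr qr]] := star_uniq st.
    have [_ [ip iq ir] _] := st.
    have dx : deco b [set x] (1 / 4).
      have yx := edge_neq exy; rewrite eq_sym yb in yx.
      apply: deco_edge => //; [lra|rewrite (b_sym m_cox c); apply: (sqr_edge c)].
      by rewrite -yb.
    have djx s : {subset s <= b :: p ++ q ++ r} -> [disjoint [set x] & seqset s].
      move=> ss; apply/pred0P => z /=; rewrite !inE; apply/negbTE/negP => /andP[/eqP->] /ss h.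
      by move/negP: xn; apply; rewrite inE.
    have djp : [disjoint [set x] & seqset p].
      by apply: djx => z zp; rewrite !(inE, mem_cat) zp !orbT.
    apply: (deco2_absurd bN _ _ _ (decoU m_cox djp dx dp) (decoU m_cox qr dq dr)).
    + rewrite subUset sub1set xN; apply: seqset_sub => z zp; apply: inN.
      by rewrite !(inE, mem_cat) zp !orbT.
    + by rewrite subUset; apply/andP; split; apply: seqset_sub => z zp; apply: inN;
        rewrite !(inE, mem_cat) zp !orbT.
    + apply/pred0P => z /=; rewrite !inE; apply/negbTE/negP => /andP[/orP[/eqP->|zp]].
        by move=> h; move/negP: xn; apply; rewrite inE inE !mem_cat h !orbT.
      by have [/negPf -> /negPf ->] := star_disj st zp.
    case/and3P: ne => /ngh_nil/kap_ge h1 /ngh_nil/kap_ge h2 /ngh_nil/kap_ge h3; lra.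
  - exact: grow_arm un yp.
  - rewrite starset_sw12 in xn sN un *; apply: grow_arm exy un yq => //; last first.
      by case/and3P: ne => -> -> ->.
    exact: star_sw12.
  - rewrite starset_sw23 starset_sw12 in xn sN un *; apply: grow_arm exy un yr => //; last first.
      by case/and3P: ne => -> -> ->.
    exact/star_sw12/star_sw23.
subst q r; rewrite /starset !cats0 in xn sN yD un *.
have [u [ip _ _] _] := st; rewrite !cats0 in u.
have [yb|yb] := eqVneq y b.
  subst y; exists x, (b :: p), [::], [::]; split; last by left.
    split; last by rewrite /cross /= ?all_nil; split=> //; apply/allP.
      by rewrite !cats0 cons_uniq u andbT; move: xn; rewrite inE.
    split=> //=; rewrite exy ip andbT /=; apply/allP => z zp; apply/negP => exz.
    have zb : z = b by apply: un => //; rewrite !inE zp orbT.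
    by move: u; rewrite /= -zb zp.
  by rewrite /starset !cats0; apply/setP => z; rewrite !inE.
have yp : y \in p by move: yD; rewrite !inE (negPf yb).
have [p1 [p2 ep]] : exists p1 p2, p = p1 ++ y :: p2.
  by case/splitPr: yp => p1 p2; exists p1, p2.
have [p20|p20] := eqVneq p2 [::].
  exists b, (rcons p x), [::], [::]; rewrite starset_rcons /starset !cats0; split=> //; last by left.
  apply: grow_end exy _ _ _; rewrite /starset ?cats0 //; last by rewrite orbT.
  by rewrite ep p20 last_cat.
have [iy2 iy1 cr] : [/\ ipath y p2, ipath y (rev (b :: p1)) & cross (b :: p1) p2].
  by apply: ipath_split; rewrite -ep.
have perm : perm_eq (y :: p2 ++ rev (b :: p1)) (b :: p).
  by rewrite -cat_cons perm_catC ep -cat_cons perm_cat2r perm_rev.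
(* Attached to an inner vertex [y] of a path, [x] makes [y] the centre of a star. *)
exists y, p2, (rev (b :: p1)), [:: x]; split.
- split.
  + rewrite catA -cat_cons cats1 rcons_uniq (perm_mem perm) (perm_uniq perm) u andbT.
    by move: xn; rewrite inE.
  + by split=> //=; rewrite edge_sym // exy.
  + have nx z : z \in b :: p -> z != y -> ~~ e z x.
      move=> zb zy; rewrite edge_sym //; apply: contra zy => exz; apply/eqP/un => //.
      by rewrite inE.
    have uy := u; rewrite ep -cat_cons cat_uniq in uy; case/and3P: uy => u1 u2 u3.
    split.
    * by apply/cross_sym/crossP => a d; rewrite mem_rev => ? ?; move/crossP: cr; exact.
    * apply/crossP => a d ap; rewrite inE => /eqP->; apply: nx.
        by rewrite ep !(inE, mem_cat) ap !orbT.
      by apply: contraTneq u3 => <-; rewrite /= ap.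
    * apply/crossP => a d; rewrite mem_rev => ap; rewrite inE => /eqP->; apply: nx.
        by rewrite ep -cat_cons mem_cat ap.
      by apply: contraNneq u2 => <-; apply/hasP; exists a => //; exact: mem_head.
- apply/setP => z; have := perm_mem perm z; rewrite !(inE, mem_cat) => <-.
  by case: (z == x); case: (z == y); case: (z \in p2); rewrite /= ?orbT ?orbF.
- by right; rewrite p20 /= andbT rev_cons; case: (rev p1).
Qed.

End InNonaff.

Definition conn C := C != set0 /\ forall D, D \subset C -> D != set0 -> D != C ->
  exists x y, [/\ x \in C, x \notin D, y \in D & e x y].

Lemma conn_shape C : nonaff C -> conn C -> shape C.
Proof.
move=> aff [C0 hC].
have [n] := ubnP (#|C| - 0); rewrite subn0 => _.
(* [D] is a connected part already built; the last condition says that it has at least [#|D| - 1]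
   edges. *)
suff H D : shape D -> D != set0 -> D \subset C -> (2 * #|D| <= ecount m D + 2)%N -> shape C.
  have /set0Pn[b bC] := C0; apply: (H [set b]).
  - exists b, [::], [::], [::]; split; last by left.
      by split=> //; split.
    by apply/setP => z; rewrite !inE.
  - by apply/set0Pn; exists b; rewrite inE.
  - by rewrite sub1set.
  - by rewrite cards1 muln1 leq_addl.
have [k] := ubnP (#|C| - #|D|); elim: k D => // k IH D; rewrite ltnS => Dk sD D0 DC tr.
have [<-//|nDC] := eqVneq D C.
have [x [y [xC xD yD exy]]] := hC D DC D0 nDC.
have xDC : x |: D \subset C by rewrite subUset sub1set xC.
have [un tr'] := unique_attach m_cox aff xDC xD tr yD exy.
have lt : (#|D| < #|C|)%N by apply: proper_card; rewrite properEneq nDC.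
apply: (IH (x |: D)) => //.
- by rewrite cardsU1 xD; lia.
- exact: (shape_grow aff sD xD xDC yD exy un).
- by apply/set0Pn; exists x; rewrite !inE eqxx.
Qed.

End Shapes.

(** * Classification of diagrams of finite type *)

(* [lia] is exponential in the number of irrelevant boolean hypotheses. *)
Ltac nlia :=
  repeat match goal with
  | H : is_true (leq _ _) |- _ => revert H
  | H : is_true (andb (leq _ _) (leq _ _)) |- _ => revert H
  | H : @eq _ ?a _ |- _ => let t := type of (a : nat) in revert H
  | H : is_true (negb (@eq_op _ ?a _)) |- _ =>
    let t := type of (a : nat) in revert H
  end; clear; intros; lia.

Section ListTypes.
Variables (I : finType) (m : I -> I -> option nat).
Hypothesis m_cox : coxeter_matrix m.
Implicit Types (x y z b u v : I) (i j k n : nat) (C : {set I}).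
Implicit Types (p q : seq I).
Local Notation e := (diagram_edge m).
Local Notation light := (light m).
Local Notation ipath := (ipath m).

Lemma list_type x0 C (z : seq I) t : uniq z -> size z = type_rank t -> C = seqset z ->
  (forall i j, (i < j)%N -> (j < size z)%N ->
     m (nth x0 z i) (nth x0 z j) = Some (type_label t i j)) ->
  has_diagram_type m C t.
Proof.
move=> uz sz -> h; exists (fun a => nth x0 z a); split.
- move=> a b /eqP; rewrite nth_uniq ?sz ?ltn_ord // => /eqP; exact: val_inj.
- apply/setP => x; rewrite inE; apply/idP/imsetP => [xz|[a _ ->]]; last first.
    by rewrite mem_nth // sz.
  have ix : (index x z < type_rank t)%N by rewrite -sz index_mem.
  by exists (Ordinal ix) => //; rewrite nth_index.
move=> a b; rewrite /type_entry; have [->|ab] := eqVneq (a : nat) b.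
  exact: (mii m_cox).
case: (ltngtP a b) ab => // ab _; first by rewrite h ?sz.
by rewrite (m_sym m_cox) h ?sz.
Qed.

(* The library statement hides [size p] behind another instance of [I]. *)
Lemma mem_nthI x0 p k : (k < size p)%N -> nth x0 p k \in p.
Proof. exact: mem_nth. Qed.

Lemma m_nonedge x y : x != y -> ~~ e x y -> m x y = Some 2.
Proof. by move=> xy; rewrite (nonedgeP m_cox xy) => /eqP. Qed.

Lemma ipath_nth x0 b p k n : uniq (b :: p) -> ipath b p -> (k < n)%N ->
  (n < (size p).+1)%N -> m (nth x0 (b :: p) k) (nth x0 (b :: p) n) =
  if n == k.+1 then m (nth x0 (b :: p) k) (nth x0 p k) else Some 2.
Proof.
elim: p b k n => [|y p IH] b k n; first by case: n.
move=> /= /andP[bp up] /and3P[by_ bnp yp]; case: n => // n; case: k => [|k] kn ns.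
  case: n kn ns => [|n] // _ ns.
  have zp : nth x0 p n \in p by rewrite mem_nth.
  apply: m_nonedge; last exact: (allP bnp).
  by apply: contraNneq bp => /= ->; rewrite inE zp orbT.
by have := IH y k n up yp; rewrite /= !ltnS eqSS in kn ns *; apply.
Qed.

Lemma path_light_nth x0 b p k : path light b p -> (k < size p)%N ->
  m (nth x0 (b :: p) k) (nth x0 p k) = Some 3.
Proof. by move=> /(pathP x0) h /h /eqP. Qed.

Lemma lpath_nth x0 b p k n : uniq (b :: p) -> ipath b p -> path light b p ->
  (k < n)%N -> (n < (size p).+1)%N ->
  m (nth x0 (b :: p) k) (nth x0 (b :: p) n) = Some (if n == k.+1 then 3 else 2).
Proof.
move=> up ip lp kn ns; rewrite ipath_nth //; case: eqP => // nk.
by rewrite path_light_nth //; nlia.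
Qed.

(** The vertices are numbered along [rev (b :: q) ++ p], with [r0] last, so that the branch vertex
    gets the index [size q]. *)
Lemma type_tripod b p q (r0 : I) t : star m b p q [:: r0] -> path light b p ->
  path light b q -> light b r0 -> type_rank t = (size q + size p).+2 ->
  type_label t =2 tripod_label (type_rank t) (size q) ->
  has_diagram_type m (starset b p q [:: r0]) t.
Proof.
move=> [us [ip iq _] [pq pr qr]] lp lq /eqP lr tr tl.
have us' : uniq (b :: p ++ q ++ [:: r0]) by [].
rewrite /= !(mem_cat, cat_uniq, has_cat, negb_or) /= in us.
rewrite !andbT in us.
case/and4P: us => /and3P[bp bq br] up /andP[hqp rp] /andP[uq rq].
pose z := rev (b :: q) ++ p ++ [:: r0].
have pz : perm_eq z (b :: p ++ q ++ [:: r0]).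
  apply: (@perm_trans _ ((b :: q) ++ p ++ [:: r0])).
    by rewrite perm_cat2r perm_rev.
  by rewrite cat_cons perm_cons perm_catCA.
have sz : size z = (size q + size p).+2.
  by rewrite /z !size_cat size_rev /=; nlia.
apply: (@list_type b _ z).
- by rewrite (perm_uniq pz).
- by rewrite sz tr.
- by apply/setP => x; rewrite !in_set (perm_mem pz).
move=> i j ij js; rewrite tl tr /tripod_label; rewrite sz in js.
have nq k : (k <= size q)%N -> nth b z k = nth b (b :: q) (size q - k).
  move=> kq; rewrite nth_cat size_rev /= ltnS kq nth_rev //=.
have np k : (size q < k <= size q + size p)%N -> nth b z k = nth b (b :: p) (k - size q).
  move=> kq; rewrite nth_cat size_rev /= ltnS leqNgt; have -> : (size q < k)%N by nlia.
  rewrite /= nth_cat; have -> : (k - (size q).+1 < size p)%N by nlia.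
  by have -> : (k - size q)%N = (k - (size q).+1).+1 by nlia.
have nr : nth b z (size q + size p).+1 = r0.
  rewrite nth_cat size_rev /= ltnNge; have -> : ((size q).+1 <= (size q + size p).+1)%N by nlia.
  rewrite /= nth_cat; have -> : ((size q + size p).+1 - (size q).+1)%N = size p by nlia.
  by rewrite ltnn subnn.
have [jl|jl] := eqVneq j (size q + size p).+1.
  rewrite jl nr eqxx andbT ltnn andbF /=; have [->|iq'] := eqVneq i (size q).
    by rewrite nq // subnn /= lr.
  have [iq2|iq2] := leqP i (size q).
    rewrite nq //; have -> : (size q - i)%N = (size q - i).-1.+1 by nlia.
    have mq : nth b q (size q - i).-1 \in q by rewrite mem_nthI //; nlia.
    apply: m_nonedge; first by apply: contraNneq rq => <-.
    by move/crossP: qr; apply => //; rewrite mem_head.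
  rewrite np; last by nlia.
  have -> : (i - size q)%N = (i - size q).-1.+1 by nlia.
  have mp : nth b p (i - size q).-1 \in p by rewrite mem_nthI //; nlia.
  apply: m_nonedge; first by apply: contraNneq rp => <-.
  by move/crossP: pr; apply => //; rewrite mem_head.
have jl' : (j < (size q + size p).+1)%N by nlia.
have -> : (j.+1 < (size q + size p).+2)%N by nlia.
have -> : (j.+1 == (size q + size p).+2) = false by nlia.
rewrite andbT andbF orbF.
have [jq|jq] := leqP j (size q).
  rewrite !nq //; last by nlia.
  rewrite (m_sym m_cox) lpath_nth //; try nlia; last by rewrite /= bq uq.
  by congr (Some (if _ then _ else _)); apply/eqP/eqP; nlia.
have [iq2|iq2] := leqP i (size q); last first.
  rewrite !np; try nlia.
  rewrite lpath_nth //; try nlia; last by rewrite /= bp up.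
  by congr (Some (if _ then _ else _)); apply/eqP/eqP; nlia.
have [->|iq'] := eqVneq i (size q).
  rewrite nq // subnn np; last by nlia.
  rewrite -[nth b (b :: q) 0]/(nth b (b :: p) 0) lpath_nth //; try nlia; last by rewrite /= bp up.
  by congr (Some (if _ then _ else _)); apply/eqP/eqP; nlia.
have -> : (j == i.+1) = false by nlia.
rewrite nq // np; last by nlia.
have -> : (size q - i)%N = (size q - i).-1.+1 by nlia.
have -> : (j - size q)%N = (j - size q).-1.+1 by nlia.
have mp : nth b p (j - size q).-1 \in p by rewrite mem_nthI //; nlia.
have mq : nth b q (size q - i).-1 \in q by rewrite mem_nthI //; nlia.
rewrite (m_sym m_cox); apply: m_nonedge; last by move/crossP: pq; apply.
by apply: contraNneq hqp => /= h; apply/hasP; exists (nth b q (size q - i).-1) => //=; rewrite -h.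
Qed.

(** Here the numbering begins at the special edge, as in types H and I_2; in the next lemma it ends
    there, as in type B. *)
Lemma type_label_path x0 C u v p t n :
  uniq (u :: v :: p) -> ipath u (v :: p) -> path light v p -> m u v = Some n ->
  C = seqset (u :: v :: p) -> type_rank t = (size p).+2 ->
  (forall i j, (i < j)%N -> (j < (size p).+2)%N -> type_label t i j =
     if j == i.+1 then (if i == 0%N then n else 3) else 2) ->
  has_diagram_type m C t.
Proof.
move=> up ip lp muv eC tr tl; apply: (@list_type x0 _ (u :: v :: p)) => //.
move=> i j ij js; rewrite ipath_nth // tl //; case: eqP => // e1.
case: i ij e1 => [|i] ij e1 //.
by rewrite [nth _ (_ :: _) _]/= path_light_nth //; move: js; rewrite e1 /=; nlia.
Qed.

Lemma type_label_path_rev x0 C u v p t n :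
  uniq (u :: v :: p) -> ipath u (v :: p) -> path light v p -> m u v = Some n ->
  C = seqset (u :: v :: p) -> type_rank t = (size p).+2 ->
  (forall i j, (i < j)%N -> (j < (size p).+2)%N -> type_label t i j =
     if j == i.+1 then (if i == size p then n else 3) else 2) ->
  has_diagram_type m C t.
Proof.
move=> up ip lp muv eC tr tl; apply: (@list_type x0 _ (rev (u :: v :: p))).
- by rewrite rev_uniq.
- by rewrite size_rev.
- by rewrite eC; apply/setP => x; rewrite !inE mem_rev !inE.
rewrite size_rev => i j ij js; rewrite tl // !nth_rev //; last by apply: ltn_trans js.
have js' : (j < (size p).+2)%N by [].
rewrite (m_sym m_cox) ipath_nth //=; [|nlia|nlia].
have -> : ((size p).+2 - i.+1 == ((size p).+2 - j.+1).+1)%N = (j == i.+1).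
  by apply/eqP/eqP; nlia.
case: eqP => // e1; have -> : ((size p).+2 - j.+1 = size p - i)%N by nlia.
have [->|ip'] := eqVneq i (size p); first by rewrite subnn.
have -> : (size p - i = (size p - i).-1.+1)%N by nlia.
rewrite /= path_light_nth //; nlia.
Qed.

End ListTypes.

Section Classification.
Variables (I : finType) (m : I -> I -> option nat).
Hypothesis m_cox : coxeter_matrix m.
Variables (R : realFieldType) (c : cosine_table R).
Implicit Types (x y z b u v : I) (i j k n : nat) (C : {set I}).
Implicit Types (p q r : seq I).
Local Notation e := (diagram_edge m).
Local Notation nonaff := (nonaff m c).
Local Notation light := (light m).
Local Notation ipath := (ipath m).
Local Notation star := (star m).
Local Notation kap := (kap R).

Definition allowed C := exists2 t, allowed_type t & has_diagram_type m C t.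

(* The connected diagrams of finite type on which -1 is not in [W]: A_n (n > 1),
   I_2(odd), D_odd and E_6. *)
Definition type_A C := exists b p, [/\ (0 < size p)%N, uniq (b :: p), ipath b p,
  path light b p & C = seqset (b :: p)].

Definition type_I C := exists u v n, [/\ u != v, m u v = Some n, odd n, (3 <= n)%N
  & C = [set u; v]].

Definition type_D C := exists b p f g, [/\ star b p [:: f] [:: g],
  [/\ path light b p, light b f & light b g], ~~ odd (size p), (0 < size p)%N
  & C = starset b p [:: f] [:: g]].

Definition type_E6 C := exists b p q r, [/\ star b p q r,
  [/\ path light b p, path light b q & path light b r],
  [/\ size p = 2, size q = 2 & size r = 1] & C = starset b p q r].

Definition classified C :=
  [\/ allowed C, type_A C, type_I C | type_D C \/ type_E6 C].

Lemma rebase u v p q : star u (v :: p) q [::] -> star v (u :: q) p [::].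
Proof.
move=> [us [/= /and3P[uv up vp] iq _] [/andP[vq pq] _ _]]; split.
- rewrite (perm_uniq (s2 := u :: (v :: p) ++ q ++ [::])) // !cats0.
  by apply/seq.permP => s /=; rewrite !count_cat /=; nlia.
- split=> //=; rewrite edge_sym // uv vq iq; done.
split; [|apply/crossP => //|apply/crossP => //].
by rewrite /cross /= up; exact: (cross_sym m_cox pq).
Qed.

Lemma starset_rebase u v p q : starset v (u :: q) p [::] = starset u (v :: p) q [::].
Proof.
apply/setP => x; rewrite !(inE, mem_cat).
by case: (x == u); case: (x == v); case: (x \in p); rewrite /= ?orbT ?orbF.
Qed.

Lemma kapE0 : kap 0 = 0. Proof. by rewrite /kap mul0r. Qed.
Lemma kapE1 : kap 1 = 1 / 4. Proof. by rewrite /kap; field. Qed.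
Lemma kapE2 : kap 2 = 1 / 3. Proof. by rewrite /kap; field. Qed.
Lemma kapE3 : kap 3 = 3 / 8. Proof. by rewrite /kap; field. Qed.
Lemma kapE5 : kap 5 = 5 / 12. Proof. by rewrite /kap; field. Qed.

(** Seen from [u], the side of [v] weighs at least [a / (1 - kap (size p))] and the other side
    [kap (size q)]; the total is below 1. *)
Lemma heavy_bound u v p q (a : R) : nonaff (starset u (v :: p) q [::]) ->
  star u (v :: p) q [::] -> 0 <= a -> a <= (bform m c u v) ^+ 2 ->
  a < (1 - kap (size p)) * (1 - kap (size q)).
Proof.
move=> aff st a0 ab; rewrite ltNge; apply/negP => h.
have sN := subxx (starset u (v :: p) q [::]).
have [_ dq _] := star_deco m_cox aff sN st.
have st' := rebase st.
have aff' := aff; rewrite -starset_rebase in aff'.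
have [_ dp _] := star_deco m_cox aff' (subxx _) st'.
have inN z : z \in u :: (v :: p) ++ q -> z \in starset u (v :: p) q [::].
  by move=> h'; rewrite inE !cats0.
have [us [/= /and3P[uv up vp] iq _] [/andP[vq pq] _ _]] := st.
have [_ _ _ [d1 _ _]] := star_uniq st.
have vN : v \in starset u (v :: p) q [::] by apply: inN; rewrite !inE eqxx orbT.
have uN : u \in starset u (v :: p) q [::] by apply: inN; rewrite !inE eqxx.
have pN : seqset p \subset starset u (v :: p) q [::].
  by apply/subsetP => z; rewrite inE => zp; apply: inN; rewrite !(inE, mem_cat) zp !orbT.
have qN : seqset q \subset starset u (v :: p) q [::].
  by apply/subsetP => z; rewrite inE => zp; apply: inN; rewrite !(inE, mem_cat) zp !orbT.
have kp1 := deco_lt1 m_cox aff vN pN dp.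
have dvp : deco m c u (v |: seqset p) (1 - kap (size q)).
  apply: (deco_step m_cox aff vN pN _ a0 ab _ dp); last by rewrite mulrC.
  by move: us; rewrite /= !inE !mem_cat !negb_or => /andP[/and3P[-> -> _] _].
apply: (deco2_absurd m_cox aff uN _ qN _ dvp dq).
- by rewrite subUset sub1set vN.
- by rewrite -seqset_cons.
- lra.
Qed.

Lemma heavy_split b p : path e b p -> ~~ path light b p ->
  exists p1 v p2, p = p1 ++ v :: p2 /\ ~~ light (last b p1) v.
Proof.
elim: p b => // v p IH b /= /andP[_ vp]; rewrite negb_and => /orP[nl|nl].
  by exists [::], v, p.
by have [p1 [w [p2 [-> h]]]] := IH v vp nl; exists (v :: p1), w, p2.
Qed.

Lemma nlight_ge4 x y : e x y -> ~~ light x y -> label_ge m 4 x y.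
Proof.
rewrite /diagram_edge /light /label_ge => /andP[xy]; case: (m x y) => // n n3 h.
by rewrite ltn_neqAle n3 andbT; apply: contra h => /eqP <-.
Qed.

Lemma heavy_path C b p : nonaff C -> star b p [::] [::] -> C = starset b p [::] [::] ->
  ~~ path light b p -> exists u v p' q, [/\ star u (v :: p') q [::],
    C = starset u (v :: p') q [::], e u v /\ ~~ light u v, path light v p' & path light u q].
Proof.
move=> aff st eC nl; have [us [ip _ _] _] := st; rewrite !cats0 in us.
have [p1 [v [p2 [ep hv]]]] := heavy_split (ipath_path ip) nl.
have [u [q [st' eC' luv]]] : exists u q, [/\ star u (v :: p2) q [::],
    C = starset u (v :: p2) q [::] & ~~ light u v].
  case/lastP: p1 ep hv => [|p1 u] ep hv.
    by exists b, [::]; rewrite ep in st eC.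
  rewrite last_rcons in hv; exists u, (rev (b :: p1)).
  have ep' : p = p1 ++ u :: v :: p2 by rewrite ep -cats1 -catA.
  have := ip; rewrite ep' => /(ipath_split m_cox)[i1 i2 cr].
  have perm : perm_eq (u :: (v :: p2) ++ rev (b :: p1) ++ [::]) (b :: p ++ [::] ++ [::]).
    apply/seq.permP => s; rewrite !cats0 ep' /= !count_cat count_rev /=; nlia.
  split=> //.
    split; [by rewrite (perm_uniq perm) !cats0| by split|].
    split; [|by apply/crossP|by apply/crossP].
    apply/(cross_sym m_cox)/crossP => x y; rewrite mem_rev => xp yp.
    by move/crossP: cr; apply.
  by rewrite eC; apply/setP => x; rewrite !in_set (perm_mem perm).
exists u, v, p2, q; have [us' [ip' iq' _] _] := st'.
have uv : e u v by case/and3P: ip'.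
(* Two heavy edges would weigh 1/2 from either side, as in affine type C. *)
have main x y s t : star x (y :: s) t [::] -> C = starset x (y :: s) t [::] ->
    e x y -> ~~ light x y -> path light x t.
  move=> sta Ceq exy nxy; apply: contraT => nlt; exfalso.
  have [us2 [_ it _] _] := sta; have [u1 u2 _ [d1 _ _]] := star_uniq sta.
  have inC z : z \in x :: (y :: s) ++ t -> z \in C by rewrite Ceq in_set !cats0.
  have xC : x \in C by apply: inC; exact: mem_head.
  have yC : y \in C by apply: inC; rewrite !inE eqxx orbT.
  have tC : {subset t <= C} by move=> z zt; apply: inC; rewrite -cat_cons mem_cat zt orbT.
  have dt := heavy_arm m_cox aff xC tC u2 it nlt.
  have xy := edge_neq exy.
  have dy : deco m c x [set y] (1 / 2).
    apply: (deco_edge m_cox aff) => //; first lra.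
    by apply: sqr_label4 => //; exact: nlight_ge4.
  apply: (deco2_absurd m_cox aff xC _ _ _ dy dt); last lra.
  - by rewrite sub1set.
  - exact: seqset_sub.
  - rewrite (eq_disjoint1 (x := y)); last by move=> z; rewrite inE.
    by have := disjointFr d1 (x := y); rewrite !inE eqxx => ->.
split=> //.
  apply: (main v u q p2) => //; [exact: rebase|by rewrite starset_rebase|by rewrite edge_sym|].
  by move: luv; rewrite /light (m_sym m_cox).
exact: (main u v p2 q).
Qed.

Lemma kap_lt1 k : kap k < 1.
Proof.
rewrite /kap; have : 0 <= k%:R :> R by exact: ler0n.
rewrite -(natr1 k) => h; rewrite ltr_pdivrMr; lra.
Qed.

(** With vertices on both sides only F_4 survives: label 5 gives 13/20 against 9/16, and label 4
    with a longer arm reaches the bound 1/2. With one arm, label 5 allows two more vertices and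
    larger labels none. *)
Lemma classify_heavy u v p q : nonaff (starset u (v :: p) q [::]) ->
  star u (v :: p) q [::] -> e u v -> ~~ light u v -> path light v p -> path light u q ->
  (size q <= size p)%N -> classified (starset u (v :: p) q [::]).
Proof.
move=> aff st uv nl lp lq qp; have xy := edge_neq uv.
have hb (a : R) := heavy_bound (a := a) aff st.
have [us [ip iq _] [cr _ _]] := st.
have k0 k : 0 <= kap k by rewrite -kapE0; exact: kap_homo.
case E: (m u v) => [n|]; last first.
  have := hb 1 ler01 (sqr_inf c E); have := k0 (size p); have := k0 (size q).
  have := kap_lt1 (size p); have := kap_lt1 (size q) => h1 h2 h3 h4.
  have : (1 - kap (size p)) * (1 - kap (size q)) <= 1 * 1 by apply: ler_pM; lra.
  by lra.
have n3 : (3 <= n)%N by move: uv; rewrite /diagram_edge E => /andP[].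
have n4 : (4 <= n)%N.
  by rewrite ltn_neqAle n3 andbT; apply: contra nl => /eqP e3; rewrite /light E -e3.
have [q0|q0] := posnP (size q); last first.
  have p1 : (0 < size p)%N by nlia.
  have kq := kap_homo R q0; have kp := kap_homo R p1; rewrite kapE1 in kq kp.
  have lt1p := kap_lt1 (size p); have lt1q := kap_lt1 (size q).
  have [n5|n5] := leqP 5 n.
    have lab : label_ge m 5 u v by rewrite /label_ge E.
    have := hb (13 / 20) _ (sqr_label5 c xy lab).
    have -> : (0 : R) <= 13 / 20 by lra.
    have : (1 - kap (size p)) * (1 - kap (size q)) <= 3 / 4 * (3 / 4) by apply: ler_pM; lra.
    by move=> h /(_ isT) h'; have := lt_le_trans h' h; clear; lra.
  have n4' : n = 4 by nlia.
  have lab : label_ge m 4 u v by rewrite /label_ge E.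
  have [p2|p2] := leqP 2 (size p).
    have kp2 := kap_homo R p2; rewrite kapE2 in kp2.
    have := hb (1 / 2) _ (sqr_label4 c xy lab).
    have -> : (0 : R) <= 1 / 2 by lra.
    have : (1 - kap (size p)) * (1 - kap (size q)) <= 2 / 3 * (3 / 4) by apply: ler_pM; lra.
    by move=> h /(_ isT) h'; have := lt_le_trans h' h; clear; lra.
  have sp : size p = 1 by nlia. have sq : size q = 1 by nlia.
  case: p q sp sq {qp hb q0 p1 kq kp lt1p lt1q p2} us ip iq cr lp lq st aff =>
    [//|d [|//]] [//|a [|//]] _ _ us ip iq cr lp lq st aff.
  apply: Or41; exists TypeF4 => //; apply: (@list_type _ _ m_cox u _ [:: a; u; v; d]) => //.
  - rewrite (perm_uniq (s2 := [:: u; v; d; a])) //.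
    by apply/seq.permP => s /=; nlia.
  - apply/setP => x; rewrite !inE /=.
    by case: (x == u); case: (x == v); case: (x == d); rewrite /= ?orbT ?orbF.
  have mm x y : x \in [:: u; v; d; a] -> y \in [:: u; v; d; a] -> x != y ->
     ~~ e x y -> m x y = Some 2 by move=> _ _; exact: m_nonedge.
  move: us ip cr lp lq; rewrite /= !inE !negb_or !andbT.
  move=> /and3P[/and3P[uv' ud ua] /andP[vd va] da] /and3P[_ und _] /andP[nva nda] /eqP lvd /eqP lua.
  case=> [|[|[|i]]] [|[|[|[|j]]]] //= _ _; rewrite /path_label /=.
  - by rewrite (m_sym m_cox) lua.
  - by rewrite (m_sym m_cox) (m_nonedge m_cox).
  - by rewrite (m_sym m_cox) (m_nonedge m_cox).
  - by rewrite E n4'.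
  - by rewrite (m_nonedge m_cox).
case: q q0 {qp lq} iq st aff us cr hb => // _ iq st aff us cr hb.
rewrite kapE0 subr0 in hb.
have hb' (a : R) : 0 <= a -> a <= bform m c u v ^+ 2 -> a < 1 - kap (size p).
  by move=> h1 h2; have := hb a h1 h2; rewrite mulr1.
have eC : starset u (v :: p) [::] [::] = seqset (u :: v :: p) by rewrite /starset /= !cats0.
rewrite !cats0 in us; rewrite eC.
have [n6|n6] := leqP 6 n.
  have lab : label_ge m 6 u v by rewrite /label_ge E.
  have := hb' (3 / 4) _ (sqr_label6 c xy lab).
  have -> : (0 : R) <= 3 / 4 by lra.
  move=> /(_ isT) H; case: p lp us ip eC H {iq st aff hb hb' cr} => [|d p] lp us ip eC H; last first.
    have p1 : (0 < size (d :: p))%N by [].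
    by have := kap_homo R p1; rewrite kapE1; lra.
  case: (boolP (odd n)) => on.
    by apply: Or43; exists u, v, n; split=> //; apply/setP => x; rewrite !inE.
  apply: Or41; exists (TypeI2 n); first by rewrite /= n4.
  apply: (type_label_path m_cox u us ip lp E) => //.
  by move=> [|[|i]] [|[|j]].
have [n5|n5] := leqP 5 n.
  have n5' : n = 5 by nlia.
  have lab : label_ge m 5 u v by rewrite /label_ge E.
  have := hb' (13 / 20) _ (sqr_label5 c xy lab).
  have -> : (0 : R) <= 13 / 20 by lra.
  move=> /(_ isT) H.
  have p3 : (size p < 3)%N.
    by rewrite ltnNge; apply/negP => /(kap_homo R); rewrite kapE3; lra.
  have [s0|s0] := posnP (size p).
    case: p s0 {lp ip hb hb' H p3 st aff iq cr} us eC => // _ us eC.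
    by apply: Or43; exists u, v, n; rewrite n5'; split=> //; [rewrite E n5'|apply/setP => x; rewrite !inE].
  rewrite n5' in E.
  have [s1|s1] := eqVneq (size p) 1.
    apply: Or41; exists TypeH3 => //; apply: (type_label_path m_cox u us ip lp E) => //.
    by rewrite /= s1.
  have s2 : size p = 2 by nlia.
  apply: Or41; exists TypeH4 => //; apply: (type_label_path m_cox u us ip lp E) => //.
  by rewrite /= s2.
have n4' : n = 4 by nlia.
rewrite n4' in E; apply: Or41; exists (TypeB (size p).+2) => //.
by apply: (type_label_path_rev m_cox u us ip lp E).
Qed.

(** The bounds come from the arm lengths (2,2,2), (3,3,1) and (5,2,1) of affine E_6, E_7 and E_8,
    whose weights have sum exactly 1. *)
Lemma classify_star3 b p q r : nonaff (starset b p q r) -> star b p q r ->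
  (0 < size r)%N -> (size r <= size q)%N -> (size q <= size p)%N ->
  classified (starset b p q r).
Proof.
move=> aff st r0 rq qp.
have q0 : (0 < size q)%N by nlia. have p0 : (0 < size p)%N by nlia.
have nn (s : seq I) : (0 < size s)%N -> s != [::] by case: s.
have sum := star_sum m_cox aff (subxx _) st.
have lp := star3_light m_cox aff (subxx _) st (nn _ q0) (nn _ r0).
have st' := star_sw12 m_cox st; have aff' := aff; rewrite starset_sw12 in aff'.
have lq := star3_light m_cox aff' (subxx _) st' (nn _ p0) (nn _ r0).
have st2 := star_sw12 m_cox (star_sw23 m_cox st); have aff2 := aff; rewrite starset_sw23 starset_sw12 in aff2.
have lr := star3_light m_cox aff2 (subxx _) st2 (nn _ p0) (nn _ q0).
have r1 : size r = 1.
  apply/eqP; rewrite eqn_leq r0 andbT leqNgt; apply/negP => r2.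
  have := kap_homo R r2; have := kap_homo R (leq_trans r2 rq).
  by have := kap_homo R (leq_trans r2 (leq_trans rq qp)); rewrite !kapE2; lra.
have q2 : (size q <= 2)%N.
  rewrite leqNgt; apply/negP => q3.
  have := kap_homo R q3; have := kap_homo R (leq_trans q3 qp).
  by rewrite !kapE3; move: sum; rewrite r1 kapE1; lra.
have [q1|q1] := eqVneq (size q) 1.
  case: q r q1 r1 {q0 r0 rq qp q2 sum lp aff' aff2 st' st2} st lq lr aff (lp) =>
    [//|f [|//]] [//|g [|//]] _ _ st lq lr aff lp.
  rewrite /= !andbT in lq lr.
  (* The rank is [size p + 3], so type D of even rank corresponds to odd [size p]. *)
  case: (boolP (odd (size p))) => op; last first.
    by apply: Or44; left; exists b, p, f, g.
  have [p1|p1] := eqVneq (size p) 1.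
    apply: Or41; exists (TypeD 4) => //; rewrite starset_sw12; apply: type_tripod => //.
    - exact: star_sw12.
    - by rewrite /= lq.
    - by rewrite /= p1.
    - by move=> i j; rewrite /= p1.
  apply: Or41; exists (TypeD (size p + 3)); first by rewrite /= oddD op andbT; nlia.
  rewrite starset_sw12; apply: type_tripod => //.
  - exact: star_sw12.
  - by rewrite /= lq.
  - by rewrite /=; nlia.
  - by move=> i j; rewrite /= addnK.
have q2' : size q = 2 by nlia.
have p5 : (size p < 5)%N.
  rewrite ltnNge; apply/negP => /(kap_homo R).
  by move: sum; rewrite r1 q2' kapE1 kapE2 kapE5; lra.
have [p2|p2] := eqVneq (size p) 2.
  by apply: Or44; right; exists b, p, q, r.
case: r r1 {r0 rq sum aff' aff2 st' st2} st lr aff => [//|g [|//]] _ st lr aff.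
rewrite /= andbT in lr.
have [p3|p3] := eqVneq (size p) 3.
  apply: Or41; exists TypeE7 => //; apply: type_tripod => //.
  - by rewrite /= q2' p3.
  - by rewrite q2'.
have p4 : size p = 4 by nlia.
apply: Or41; exists TypeE8 => //; apply: type_tripod => //.
- by rewrite /= q2' p4.
- by rewrite q2'.
Qed.

Theorem classification C : nonaff C -> conn m C -> classified C.
Proof.
move=> aff hC; have [b [p [q [r [st eC ne]]]]] := conn_shape m_cox aff hC.
case: ne => [[q0 r0]|/and3P[p0 q0 r0]].
  subst q r; case: (boolP (path light b p)) => [lp|nl].
    have [us [ip _ _] _] := st; rewrite !cats0 in us.
    have eC' : C = seqset (b :: p) by rewrite eC /starset !cats0.
    case: p {st eC} ip us lp eC' => [|y p] ip us lp eC'.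
      apply: Or41; exists TypeA1 => //; apply: (list_type m_cox (x0 := b) _ _ eC') => //.
      by move=> i [].
    by apply: Or42; exists b, (y :: p).
  have [u [v [p' [q [st' eC' [uv luv] lp lq]]]]] := heavy_path aff st eC nl.
  have [qp|pq] := leqP (size q) (size p').
    by rewrite eC' in aff *; exact: classify_heavy.
  rewrite eC' in aff *; rewrite -starset_rebase in aff *; apply: classify_heavy => //.
  - exact: rebase.
  - by rewrite edge_sym.
  - by move: luv; rewrite /light (m_sym m_cox).
  - exact: ltnW.
have sz (s : seq I) : s != [::] -> (0 < size s)%N by case: s.
move/sz: p0 => p0; move/sz: q0 => q0; move/sz: r0 => r0.
rewrite eC in aff *; move: {eC hC} aff st p0 q0 r0.
wlog rq : p q r / (size r <= size q)%N => [H|].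
  have [rq|/ltnW rq] := leqP (size r) (size q); first exact: H.
  rewrite starset_sw23 => aff /(star_sw23 m_cox) st p0 q0 r0; exact: H.
wlog qp : p q r rq / (size q <= size p)%N => [H|].
  have [qp|/ltnW qp] := leqP (size q) (size p); first exact: H.
  have [rp|/ltnW rp] := leqP (size r) (size p).
    rewrite starset_sw12 => aff /(star_sw12 m_cox) st p0 q0 r0; exact: H.
  rewrite starset_sw12 starset_sw23 => aff /(star_sw12 m_cox)/(star_sw23 m_cox) st p0 q0 r0.
  exact: H.
by move=> aff st p0 q0 r0; exact: classify_star3.
Qed.

End Classification.

(** * Diagrams with -1 in the Coxeter group *)

Section NegClosure.
Variables (I : finType) (m : I -> I -> option nat).
Hypothesis m_cox : coxeter_matrix m.
Variables (R : realFieldType) (c : cosine_table R).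
Implicit Types (x y z : I) (k n : nat) (C J K : {set I}).
Implicit Types (p u : seq I).
Local Notation V := {ffun I -> R^o}.
Implicit Types (v : V).
Local Notation e := (diagram_edge m).
Local Notation negt := (negt m c).
Local Notation hform := (hform m c).
Local Notation form := (form m c).
Local Notation refl := (refl m c).
Local Notation actw := (actw m c).
Local Notation delta := (@delta I R).
Local Notation conn := (conn m).

(** [K] is a union of connected components of the diagram on [J]. *)
Definition closedin K J := K \subset J /\
  forall x y, x \in K -> y \in J -> y \notin K -> ~~ e x y.

Lemma actw_fix u v : (forall x, x \in u -> hform x v = 0) -> actw u v = v.
Proof.
elim: u => //= x u IH h; rewrite IH; last by move=> y yu; apply: h; rewrite inE yu orbT.
by apply: refl_fix; apply: h; exact: mem_head.
Qed.

Lemma h_supp x v K : supp K v -> (forall y, y \in K -> bform m c x y = 0) ->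
  hform x v = 0.
Proof.
move=> sv h; rewrite (supp_decomp sv) linear_sum big1 // => y yK.
by rewrite linearZ /= h_delta h // mulr0.
Qed.

Lemma b_sep K x y : x \notin K -> y \in K -> ~~ e y x -> bform m c x y = 0.
Proof.
move=> xK yK nyx; apply: (b_nonedge m_cox); last by rewrite (edge_sym m_cox).
by apply: contraNneq xK => ->.
Qed.

Lemma closed_h J K x v : closedin K J -> supp K v -> x \in J -> x \notin K ->
  hform x v = 0.
Proof.
by move=> [_ cl] sv xJ xK; apply: (h_supp sv) => y yK; apply: (b_sep xK) => //; exact: cl.
Qed.

Lemma closed_actw J K u v : closedin K J -> {subset u <= J} -> supp K v ->
  supp K (actw u v) /\ actw u v = actw [seq x <- u | x \in K] v.
Proof.
move=> cl; elim: u => //= x u IH uJ sv.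
have [|//|s1 e1] := IH; first by move=> y yu; apply: uJ; rewrite inE yu orbT.
have xJ : x \in J by apply: uJ; exact: mem_head.
case: (boolP (x \in K)) => xK /=; first by rewrite e1; split=> //; apply: supp_refl; rewrite -?e1.
by rewrite refl_fix // (closed_h cl).
Qed.

Lemma negt_closed J K : closedin K J -> negt J -> negt K.
Proof.
move=> cl [u [uJ h]]; have KJ := subsetP cl.1.
exists [seq x <- u | x \in K]; split=> [x|x xK]; first by rewrite mem_filter => /andP[].
rewrite -(closed_actw cl uJ (supp_delta _ xK)).2 h //; exact: KJ.
Qed.

Lemma negt_union J K : [disjoint J & K] ->
  (forall x y, x \in J -> y \in K -> ~~ e x y) -> negt J -> negt K -> negt (J :|: K).
Proof.
move=> dj cl [u [uJ hu]] [w [wK hw]]; exists (u ++ w); split.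
  by move=> x; rewrite mem_cat inE => /orP[/uJ->|/wK->]; rewrite ?orbT.
move=> x; rewrite inE actw_cat; case: (boolP (x \in J)) => [xJ _|xJ /= xK].
  rewrite [actw w _]actw_fix ?hu // => y /wK yK; rewrite h_delta.
  apply: (b_sep (K := J)) => //; first by rewrite (disjointFl dj).
  exact: cl.
rewrite hw // linearN /= actw_fix // => y /uJ yJ; rewrite h_delta.
apply: (b_sep (K := K)) => //; first by rewrite (disjointFr dj).
by rewrite (edge_sym m_cox) cl.
Qed.

Lemma negt0 : negt set0.
Proof. by exists [::]; split=> // x; rewrite inE. Qed.

Lemma negt1 x : negt [set x].
Proof.
exists [:: x]; split=> [y|y]; rewrite !inE => /eqP-> //=; exact: refl_delta.
Qed.

Definition comp J x : {set I} :=
  [set y | connect [rel x y | [&& x \in J, y \in J & e x y]] x y].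

Lemma comp_sub J x : x \in J -> comp J x \subset J.
Proof.
move=> xJ; apply/subsetP => y; rewrite inE => /connectP[p pp ->].
by elim: p x xJ pp => //= z p IH x xJ /andP[/and3P[_ zJ _]]; exact: IH.
Qed.

Lemma comp_refl J x : x \in comp J x. Proof. by rewrite inE connect0. Qed.

Lemma comp_closed J x : x \in J -> closedin (comp J x) J.
Proof.
move=> xJ; split; first exact: comp_sub.
move=> y z yC zJ; apply: contra => eyz; have yJ := subsetP (comp_sub xJ) _ yC.
by move: yC; rewrite !inE => h; apply: (connect_trans h); apply: connect1; rewrite /= yJ zJ.
Qed.

Lemma comp_conn J x : x \in J -> conn (comp J x).
Proof.
move=> xJ; split; first by apply/set0Pn; exists x; exact: comp_refl.
move=> D DC D0 nDC.
pose ok := [exists y in comp J x, exists z in D, (y \notin D) && e y z].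
have [/existsP[y /andP[yC /existsP[z /and3P[zD yD eyz]]]]|] := boolP ok.
  by exists y, z.
move=> nok; exfalso.
have cl y z : y \in comp J x -> y \notin D -> z \in D -> ~~ e y z.
  move=> yC yD zD; apply: contra nok => eyz; apply/existsP; exists y; rewrite yC /=.
  by apply/existsP; exists z; rewrite zD yD.
pose rl : rel I := [rel x y | [&& x \in J, y \in J & e x y]].
have stepC y z : y \in comp J x -> rl y z -> (z \in comp J x) && ((y \in D) == (z \in D)).
  move=> yC ryz; have zC : z \in comp J x.
    by move: yC; rewrite !inE => h; apply: (connect_trans h); exact: connect1.
  have /and3P[_ _ eyz] := ryz; rewrite zC /=; apply/eqP.
  apply/idP/idP => h; apply: contraT => h'.
    by have := cl z y zC h' h; rewrite (edge_sym m_cox) eyz.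
  by have := cl y z yC h' h; rewrite eyz.
have all y : y \in comp J x -> (y \in D) = (x \in D).
  have H p w : path rl w p -> w \in comp J x -> (last w p \in D) = (w \in D).
    elim: p w => //= z p IH w /andP[rw pp] wC.
    by have /andP[zC /eqP->] := stepC _ _ wC rw; apply: IH.
  by rewrite inE => /connectP[p pp ->]; apply: H => //; exact: comp_refl.
have /set0Pn[z zD] := D0.
have xD : x \in D by rewrite -(all z) //; exact: (subsetP DC).
move/negP: nDC; apply; rewrite eqEsubset DC; apply/subsetP => y yC.
by rewrite all.
Qed.

Lemma negt_comp J x : x \in J -> negt J -> negt (comp J x).
Proof. by move=> xJ; apply: negt_closed; exact: comp_closed. Qed.

Lemma negt_comps J : (forall x, x \in J -> negt (comp J x)) -> negt J.
Proof.
move=> h; suff H D : closedin D J -> negt D -> negt J.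
  apply: (H set0); last exact: negt0.
  by split; [exact: sub0set|move=> x y; rewrite inE].
have [n] := ubnP (#|J| - #|D|); elim: n D => // n IH D; rewrite ltnS => Dn cl nD.
have [<-//|DJ] := eqVneq D J.
have [x xJ xD] : exists2 x, x \in J & x \notin D.
  have : D \proper J by rewrite properEneq DJ cl.1.
  by case/properP => _ [x]; exists x.
have [CJ clC] := comp_closed xJ; set C := comp J x in CJ clC.
have dCD : [disjoint D & C].
  have [CI _ hh] : [/\ C :&: D \subset C, True & C :&: D != set0 -> False].
    split=> //; first exact: subsetIl.
    move=> CD0; have [_ cn] := comp_conn xJ.
    have nCD : C :&: D != C.
      apply: contraNneq xD => /setP/(_ x); rewrite inE comp_refl /=; by move=> ->.
    have [y [z [yC yI zI eyz]]] := cn _ (subsetIl C D) CD0 nCD.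
    rewrite !inE in zI; case/andP: zI => _ zD; have yJ := subsetP CJ _ yC.
    have yD : y \notin D by apply: contra yI => yD; rewrite inE yD andbT.
    by have := cl.2 z y zD yJ yD; rewrite (edge_sym m_cox) eyz.
  rewrite -setI_eq0 setIC; apply/eqP; apply: contraPeq hh => h0 //; exact.
have clU : closedin (D :|: C) J.
  split; first by rewrite subUset cl.1 CJ.
  move=> y z; rewrite !inE negb_or => yy zJ /andP[zD zC].
  case/orP: yy => yy; first exact: cl.2.
  by apply: clC => //; rewrite inE.
apply: (IH (D :|: C)) => //.
  have : (0 < #|C|)%N by rewrite card_gt0; apply/set0Pn; exists x; exact: comp_refl.
  have : (#|D :|: C| = #|D| + #|C|)%N by rewrite cardsU disjoint_setI0 // cards0 subn0.
  have := subset_leq_card clU.1; nlia.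
apply: negt_union => //; last exact: h.
move=> y z yD zC; apply: cl.2 => //; first exact: (subsetP CJ).
by rewrite (disjointFl dCD).
Qed.

Lemma actw_refl_root u x v (b := actw u (delta x)) :
  actw (u ++ x :: rev u) v = v - (2 * form b v) *: b.
Proof.
rewrite actw_cat /= -/(actw _ _) {1}/refl linearB linearZ /= actw_revK //.
congr (_ - (2 * _) *: _).
by rewrite -form_delta -(form_actw m_cox c u) actw_revK.
Qed.

(* If [b] is a root of [V_J] orthogonal to the hyperplane [V_K], then -1 on
   [V_J] is the product of -1 on [V_K] and the reflection in [b]. *)
Lemma negt_extend K x u y : x \notin K -> negt K -> {subset u <= x |: K} ->
  y \in x |: K -> (forall k : I, k \in K -> hform k (actw u (delta y)) = 0) ->
  negt (x |: K).
Proof.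
move=> xK [w [wK hw]] uJ yJ; set b := actw u (delta y) => ob.
have sb : supp (x |: K) b by apply: supp_actw => //; exact: supp_delta.
have b1 : form b b = 1 by exact: form_root.
have wb : actw w b = b by apply: actw_fix => k /wK; exact: ob.
have rb v : actw (u ++ y :: rev u) v = v - (2 * form b v) *: b by exact: actw_refl_root.
have hK (k : I) : k \in K -> actw (w ++ u ++ y :: rev u) (delta k) = - delta k.
  move=> kK; rewrite actw_cat rb (form_sym m_cox) form_delta ob //.
  by rewrite mulr0 scale0r subr0 hw.
exists (w ++ u ++ y :: rev u); split.
  move=> z; rewrite mem_cat => /orP[/wK zK|]; first by rewrite inE zK orbT.
  by rewrite mem_cat inE mem_rev => /or3P[/uJ|/eqP->|/uJ].
move=> k; rewrite !inE => /orP[/eqP->{k}|]; last exact: hK.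
have eb : b = (b x : R) *: delta x + \sum_(k in K) (b k : R) *: delta k.
  by rewrite {1}(supp_decomp sb) big_setU1.
have hb : actw (w ++ u ++ y :: rev u) b = - b.
  rewrite actw_cat rb b1 mulr1 linearB linearZ /= wb.
  by rewrite -{1}[b]scale1r -scalerBl -scaleN1r; congr (_ *: _); ring.
(* Otherwise [b] would lie in [V_K] and be orthogonal to it, hence have norm 0. *)
have bx0 : (b x : R) != 0.
  apply/eqP => bx0; move: b1; rewrite /form big1 => [/eqP|z _].
    by rewrite eq_sym oner_eq0.
  case: (boolP (z \in K)) => [zK|zK]; first by rewrite ob // mulr0.
  have [->|zx] := eqVneq z x; first by rewrite bx0 mul0r.
  by rewrite sb ?mul0r // !inE negb_or zx.
have hS : actw (w ++ u ++ y :: rev u) (\sum_(k in K) (b k : R) *: delta k) =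
          - \sum_(k in K) (b k : R) *: delta k.
  rewrite linear_sum -sumrN; apply: eq_bigr => k kK.
  by rewrite linearZ /= hK // scalerN.
have : (b x : R) *: actw (w ++ u ++ y :: rev u) (delta x) = (b x : R) *: (- delta x).
  move: hb; rewrite {1 2}eb linearD linearZ /= hS opprD scalerN => /addIr ->; done.
by move/(scalerI bx0).
Qed.

End NegClosure.

(* Elements [a + b t] of a quadratic order [Z[t]], where [t ^ 2 = p t + q]. *)
Section QuadraticOrder.
Variables (p q : int).
Definition tmul (x : int * int) : int * int := (q * x.2, x.1 + p * x.2).

(* The contribution [-2 b x] of a neighbour with coefficient [x] along an edge
   with the given label, [t] standing for [2 cos (pi / l)] when [l >= 4]. *)
Definition qweight (l : nat) (x : int * int) : int * int :=
  if l == 2 then 0 else if l == 3 then x else tmul x.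

Definition qrefl (lab : nat -> nat -> nat) (n k : nat) (xs : seq (int * int)) :=
  mkseq (fun a => if a == k then
    foldr (fun j acc => (if j == k then - nth 0 xs k
                         else qweight (lab k j) (nth 0 xs j)) + acc) 0 (iota 0 n)
    else nth 0 xs a) n.

Definition qunit (n k : nat) : seq (int * int) :=
  mkseq (fun a => if a == k then (1, 0) else 0) n.

(** A computable test for -1: the arithmetic of the quadratic order replaces that of the field. *)
Definition qneg (lab : nat -> nat -> nat) (n : nat) (w : seq nat) : bool :=
  all (fun k => foldr (qrefl lab n) (qunit n k) w ==
                map -%R (qunit n k)) (iota 0 n) && all (fun k => k < n)%N w.

Variables (R : realFieldType) (t : R).
Hypothesis t2 : t ^+ 2 = p%:~R * t + q%:~R.

Definition qval (x : int * int) : R := x.1%:~R + x.2%:~R * t.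

Lemma qvalD x y : qval (x + y) = qval x + qval y.
Proof. by rewrite /qval /= !rmorphD /=; ring. Qed.

Lemma qvalN x : qval (- x) = - qval x.
Proof. by rewrite /qval /= !rmorphN /=; ring. Qed.

Lemma qval_tmul x : qval (tmul x) = t * qval x.
Proof.
rewrite /qval /= rmorphD !rmorphM /= mulrDr mulrCA -expr2 t2; ring.
Qed.
End QuadraticOrder.

(** * Exceptional types, by computation *)

Section NegTypes.
Variables (I : finType) (m : I -> I -> option nat).
Hypothesis m_cox : coxeter_matrix m.
Variables (R : realFieldType) (c : cosine_table R).
Implicit Types (x y z : I) (i j k n : nat) (C : {set I}).
Implicit Types (p q u : seq I).
Local Notation V := {ffun I -> R^o}.
Local Notation negt := (negt m c).
Local Notation refl := (refl m c).
Local Notation actw := (actw m c).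
Local Notation delta := (@delta I R).

Lemma type_list x0 C t : has_diagram_type m C t -> exists z : seq I,
  [/\ uniq z, size z = type_rank t, C = seqset z &
    forall i j, (i < type_rank t)%N -> (j < type_rank t)%N ->
    m (nth x0 z i) (nth x0 z j) = Some (type_entry t i j)].
Proof.
move=> [phi [phi_inj -> h]]; exists (map phi (enum 'I_(type_rank t))).
have nthE i (lt : (i < type_rank t)%N) :
    nth x0 (map phi (enum 'I_(type_rank t))) i = phi (Ordinal lt).
  rewrite (nth_map (Ordinal lt)) ?size_enum_ord //; congr phi; apply: val_inj.
  by rewrite /= nth_enum_ord.
split.
- by rewrite map_inj_uniq // enum_uniq.
- by rewrite size_map size_enum_ord.
- apply/setP => x; rewrite inE; apply/imsetP/mapP => [[a _ ->]|[a _ ->]]; exists a => //.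
  by rewrite mem_enum.
- by move=> i j li lj; rewrite (nthE i li) (nthE j lj) h.
Qed.

Section Quadratic.
Variables (t : diagram_type) (p q : int) (th : R).
Hypothesis th2 : th ^+ 2 = p%:~R * th + q%:~R.
Variables (x0 : I) (z : seq I).
Local Notation n := (type_rank t).
Hypothesis sz : size z = n.
Hypothesis mz : forall i j, (i < n)%N -> (j < n)%N ->
    m (nth x0 z i) (nth x0 z j) = Some (type_entry t i j).
Hypothesis th_label : forall i j, (i < n)%N -> (j < n)%N -> i != j ->
  type_entry t i j != 2 -> type_entry t i j != 3 ->
  2 * c (type_entry t i j) = th.
Local Notation val := (qval th).
Local Notation refl_ := (qrefl p q (type_entry t) n).

Definition qvec (xs : seq (int * int)) : V :=
  \sum_(a < n) val (nth 0 xs a) *: delta (nth x0 z a).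

Lemma delta_qvec k : (k < n)%N -> qvec (qunit n k) = delta (nth x0 z k).
Proof.
move=> kn; rewrite /qvec (bigD1 (Ordinal kn)) //=.
rewrite nth_mkseq // eqxx /qval /= mul0r addr0 scale1r big1 ?addr0 //.
move=> a ak; rewrite nth_mkseq // (_ : (a == k :> nat) = false).
  by rewrite mul0r addr0 scale0r.
by apply: contraNF ak => /eqP ak; apply/eqP/val_inj.
Qed.

Lemma qvecN xs : size xs = n -> qvec (map -%R xs) = - qvec xs.
Proof.
move=> sx; rewrite /qvec -sumrN; apply: eq_bigr => a _.
by rewrite (nth_map 0) ?sx // qvalN scaleNr.
Qed.

Lemma qval_weight k j (y : int * int) : (k < n)%N -> (j < n)%N -> j != k ->
  val (qweight p q (type_entry t k j) y) = - 2 * bform m c (nth x0 z k) (nth x0 z j) * val y.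
Proof.
move=> kn jn jk; rewrite /qweight /bform mz //.
case: eqP => [->|/eqP l2]; first by rewrite ct_2 /qval /=; ring.
case: eqP => [->|/eqP l3]; first by rewrite ct_3 /qval /=; field.
have E : 2 * c (type_entry t k j) = th by apply: th_label; rewrite // eq_sym.
by rewrite (qval_tmul th2) -{1}E; ring.
Qed.

Lemma qval_foldr (F : nat -> int * int) k :
  val (foldr (fun j acc => F j + acc) 0 (iota 0 k)) = \sum_(j < k) val (F j).
Proof.
rewrite -(big_mkord xpredT (fun j => val (F j))) /index_iota subn0.
elim: (iota 0 k) => [|j s IH]; first by rewrite big_nil /qval /= mul0r addr0.
by rewrite big_cons /= qvalD IH.
Qed.

Lemma refl_qvec xs k : (k < n)%N -> refl (nth x0 z k) (qvec xs) = qvec (refl_ k xs).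
Proof.
move=> kn; rewrite /refl.
have -> : qvec (refl_ k xs) =
    qvec xs + (val (nth 0 (refl_ k xs) k) - val (nth 0 xs k)) *: delta (nth x0 z k).
  rewrite /qvec (bigD1 (Ordinal kn)) //= [in RHS](bigD1 (Ordinal kn)) //=.
  rewrite addrAC -scalerDl addrCA subrr addr0; congr (_ + _).
  apply: eq_bigr => a ak; rewrite nth_mkseq // (_ : (a == k :> nat) = false) //.
  by apply: contraNF ak => /eqP ak; apply/eqP/val_inj.
congr (_ + _); rewrite -scaleNr; congr (_ *: _).
rewrite nth_mkseq // eqxx (qval_foldr (fun j => if j == k then _ else _)).
rewrite /qvec linear_sum /= mulr_sumr -sumrN [in LHS](bigD1 (Ordinal kn)) //=.
rewrite [in RHS](bigD1 (Ordinal kn)) //= eqxx linearZ /= h_delta b_ii // qvalN.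
rewrite mulr1 addrAC; congr (_ + _); first by ring.
apply: eq_bigr => a ak; have ak' : (a == k :> nat) = false.
  by apply: contraNF ak => /eqP ak; apply/eqP/val_inj.
by rewrite ak' linearZ /= h_delta qval_weight ?ak' //; ring.
Qed.

Lemma qneg_negt w : qneg p q (type_entry t) n w -> negt (seqset z).
Proof.
case/andP => /allP hk /allP hw.
have act k (u : seq nat) : all (fun k => k < n)%N u -> (k < n)%N ->
    actw (map (nth x0 z) u) (delta (nth x0 z k)) = qvec (foldr refl_ (qunit n k) u).
  move=> + kn; elim: u => /= [_|j u IH /andP[jn un]]; first by rewrite delta_qvec.
  by rewrite IH // refl_qvec.
exists (map (nth x0 z) w); split.
  by move=> x /mapP[k kw ->]; rewrite inE mem_nth // sz hw.
move=> x; rewrite inE => xz; have kn : (index x z < n)%N by rewrite -sz index_mem.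
rewrite -[x in delta x](nth_index x0 xz) act //; last exact/allP.
have := hk (index x z); rewrite mem_iota add0n => /(_ kn)/eqP ->.
by rewrite qvecN ?size_mkseq // delta_qvec // nth_index.
Qed.

End Quadratic.

(** [l] is the only label other than 2 and 3 that may occur; for types E, where none does, any
    quadratic relation can be supplied. *)
Lemma quadratic_negt C t (p q : int) l w : has_diagram_type m C t ->
  (2 * c l) ^+ 2 = p%:~R * (2 * c l) + q%:~R -> (0 < type_rank t)%N ->
  all (fun i => all (fun j => (i == j) || (type_entry t i j \in [:: 2; 3; l]))
    (iota 0 (type_rank t))) (iota 0 (type_rank t)) ->
  qneg p q (type_entry t) (type_rank t) w -> negt C.
Proof.
move=> ht th2 t0 /allP lab hw; have [x0 _] : exists x0, x0 \in C.
  have [phi [_ -> _]] := ht; exists (phi (Ordinal t0)); exact: imset_f.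
have [z [uz sz -> mz]] := type_list x0 ht.
apply: (qneg_negt th2 sz mz _ hw) => i j ti tj ij l2 l3.
have := lab i; rewrite mem_iota ti => /(_ isT)/allP/(_ j).
rewrite mem_iota tj => /(_ isT); rewrite (negPf ij) !inE (negPf l2) (negPf l3) /=.
by move/eqP ->.
Qed.

Definition coxeter_word n h := flatten (nseq h (iota 0 n)).

Lemma th4 : (2 * c 4) ^+ 2 = 0%:~R * (2 * c 4) + 2%:~R.
Proof. by have := ct_4 c => h; rewrite exprMn mul0r add0r; lra. Qed.

Lemma th5 : (2 * c 5) ^+ 2 = 1%:~R * (2 * c 5) + 1%:~R.
Proof. by have := ct_5 c => h; rewrite exprMn; lra. Qed.

(* In each case [w] is the power [h / 2] of a Coxeter element, where [h] is the
   Coxeter number. *)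
Lemma negt_E7 C : has_diagram_type m C TypeE7 -> negt C.
Proof.
by move=> h; apply: (quadratic_negt (w := coxeter_word 7 9) h th4); [|vm_compute|vm_compute].
Qed.

Lemma negt_E8 C : has_diagram_type m C TypeE8 -> negt C.
Proof.
by move=> h; apply: (quadratic_negt (w := coxeter_word 8 15) h th4); [|vm_compute|vm_compute].
Qed.

Lemma negt_F4 C : has_diagram_type m C TypeF4 -> negt C.
Proof.
by move=> h; apply: (quadratic_negt (w := coxeter_word 4 6) h th4); [|vm_compute|vm_compute].
Qed.

Lemma negt_H3 C : has_diagram_type m C TypeH3 -> negt C.
Proof.
by move=> h; apply: (quadratic_negt (w := coxeter_word 3 5) h th5); [|vm_compute|vm_compute].
Qed.

Lemma negt_H4 C : has_diagram_type m C TypeH4 -> negt C.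
Proof.
by move=> h; apply: (quadratic_negt (w := coxeter_word 4 15) h th5); [|vm_compute|vm_compute].
Qed.

End NegTypes.

(** * Types B and D, and even dihedral types *)

Section NegFamilies.
Variables (I : finType) (m : I -> I -> option nat).
Hypothesis m_cox : coxeter_matrix m.
Variables (R : realFieldType) (c : cosine_table R).
Implicit Types (x y z f g k : I) (i n : nat) (C K : {set I}).
Implicit Types (l u : seq I).
Local Notation V := {ffun I -> R^o}.
Implicit Types (v : V).
Local Notation e := (diagram_edge m).
Local Notation negt := (negt m c).
Local Notation hform := (hform m c).
Local Notation bform := (bform m c).
Local Notation refl := (refl m c).
Local Notation actw := (actw m c).
Local Notation delta := (@delta I R).

Lemma b2 x y : m x y = Some 2 -> bform x y = 0.
Proof. by rewrite /bform => ->; rewrite ct_2 oppr0. Qed.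
Lemma b3 x y : m x y = Some 3 -> bform x y = - (1 / 2).
Proof. by rewrite /bform => ->; rewrite ct_3. Qed.

Lemma nonedge2 x y : m x y = Some 2 -> ~~ e x y.
Proof. by rewrite /diagram_edge => ->; rewrite andbF. Qed.

Lemma h_single x y K v : y \notin K -> supp (y |: K) v ->
  (forall z, z \in K -> bform x z = 0) -> hform x v = bform x y * v y.
Proof.
move=> yK sv h; rewrite {1}(supp_decomp sv) big_setU1 //= linearD linear_sum.
rewrite big1 ?addr0 => [|z zK]; last by rewrite /= linearZ /= h_delta h // mulr0.
by rewrite /= linearZ /= h_delta mulrC.
Qed.

Fixpoint Bpath y l : Prop :=
  match l with
  | [::] => False
  | [:: z] => m y z = Some 4
  | x :: l' => [/\ m y x = Some 3, forall k, k \in l' -> m y k = Some 2 & Bpath x l']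
  end.

(** In the usual coordinates [b] is the root e_1 normalized to 1: it is orthogonal to the smaller B,
    and its coefficient at [y] is the square root of 2. Reflecting e_2 in [y] produces it. *)
Lemma B_root y l : uniq (y :: l) -> Bpath y l ->
  (exists u j, [/\ {subset u <= y :: l}, j \in y :: l &
   let b := actw u (delta j) in
   [/\ b y = 2 * c 4, hform y b = c 4 & forall k, k \in l -> hform k b = 0]])
  /\ negt (seqset (y :: l)).
Proof.
have ext x l' u j : uniq (x :: l') -> negt (seqset l') -> {subset u <= x :: l'} ->
    j \in x :: l' -> (forall k, k \in l' -> hform k (actw u (delta j)) = 0) ->
    negt (seqset (x :: l')).
  move=> /andP[xl _] nl ul jl h; rewrite seqset_cons.
  apply: (negt_extend m_cox (u := u) (y := j)) => //; first by rewrite inE.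
  - by move=> k /ul; rewrite !inE.
  - by move: jl; rewrite !inE.
  - by move=> k; rewrite inE; exact: h.
elim: l y => // x [|x' l'] IH y uy; last first.
  set l := x' :: l' in IH *; move=> [m3 m2 Bx].
  have [ux yx] : uniq (x :: l) /\ y \notin x :: l by case/andP: uy.
  have [[u [j [ul jl [bx hx hk]]]] nl] := IH x ux Bx.
  set b := actw u (delta j) in bx hx hk.
  have sb : supp (x |: seqset l) b.
    rewrite -seqset_cons; apply: supp_actw => [k /ul|]; first by rewrite !inE.
    by apply: supp_delta; rewrite inE.
  have hy : hform y b = - c 4.
    rewrite (h_single _ sb) ?bx ?b3 //; [by field| |].
      by rewrite inE; case/andP: ux.
    by move=> k; rewrite inE => /m2/b2.
  have by0 : b y = 0 by apply: sb; rewrite -seqset_cons inE.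
  have ebk k : hform k (refl y b) = hform k b + 2 * c 4 * bform k y.
    by rewrite /refl hy linearB linearZ /= h_delta; ring.
  have hk' k : k \in x :: l -> hform k (refl y b) = 0.
    rewrite inE => /orP[/eqP->|kl]; rewrite ebk.
      by rewrite hx (b_sym m_cox) b3 //; field.
    by rewrite hk // (b_sym m_cox) b2 ?mulr0 ?addr0 // m2.
  have sub : {subset y :: u <= [:: y, x & l]}.
    by move=> k; rewrite inE => /orP[/eqP->|/ul h]; [exact: mem_head|rewrite inE h orbT].
  have jm : j \in [:: y, x & l] by rewrite inE jl orbT.
  split; last by apply: (ext y _ (y :: u) j).
  exists (y :: u), j; split=> //=; rewrite -/b; split=> //.
    by rewrite reflE hy by0 eqxx mulr1 sub0r mulrN opprK.
  by rewrite h_refl // hy opprK.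
move=> /= m4; have xy : x \notin [:: y] by move: uy; rewrite /= !inE eq_sym andbT.
have byx : bform y x = - c 4 by rewrite /bform m4.
have hx k : k \in [:: x] -> hform k (refl y (delta x)) = 0.
  rewrite inE => /eqP->; rewrite /refl linearB linearZ /= !h_delta b_ii // (b_sym m_cox c x y) byx.
  by have := ct_4 c => h; lra.
have sub : {subset [:: y] <= [:: y; x]} by move=> k; rewrite !inE => ->.
have xm : x \in [:: y; x] by rewrite !inE eqxx orbT.
have n1 : negt (seqset [:: x]).
  rewrite (_ : seqset [:: x] = [set x]); first exact: negt1.
  by apply/setP => k; rewrite !inE.
split; last by apply: (ext y _ [:: y] x).
exists [:: y], x; split=> //=; split=> //.
  rewrite reflE h_delta byx eqxx deltaE; have -> : (y == x) = false.
    by move: xy; rewrite inE eq_sym => /negPf.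
  by rewrite mulr1 sub0r mulrN opprK.
by rewrite h_refl // h_delta byx opprK.
Qed.

Fixpoint Dpath y l : Prop :=
  match l with
  | [::] => False
  | [:: f; g] => [/\ m y f = Some 3, m y g = Some 3 & m f g = Some 2]
  | x :: l' => [/\ m y x = Some 3, forall k, k \in l' -> m y k = Some 2 & Dpath x l']
  end.

(** Up to scaling [y] is e_1 - e_2 and [b] is e_1 + e_2. Their sum is proportional to e_1, which is
    orthogonal to the roots of [l]; this is the last clause. *)
Lemma D_root y l : uniq (y :: l) -> Dpath y l ->
  exists u j, [/\ {subset u <= y :: l}, j \in y :: l &
   let b := actw u (delta j) in
   [/\ b y = 1, hform y b = 0 & forall k, k \in l -> hform k b = - bform y k]].
Proof.
elim: l y => // f l IH y; case: l IH => [_ _ []|g l] //.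
case: l => [|x' l'] IH uy.
  move=> [mf mg mfg].
  have [yf yg fg] : [/\ y != f, y != g & f != g].
    by move: uy; rewrite /= !inE negb_or !andbT => /andP[/andP[-> ->] ->].
  exists [:: g; f], y; split.
  - by move=> k; rewrite !inE => /orP[/eqP->|/eqP->]; rewrite eqxx ?orbT.
  - exact: mem_head.
  have hfy : hform f (delta y) = - (1 / 2) by rewrite h_delta (b_sym m_cox) b3.
  have ef : refl f (delta y) = delta y + delta f.
    by rewrite /refl hfy -scaleNr -[X in _ = _ + X]scale1r; congr (_ + _ *: _); field.
  have hg : hform g (delta y + delta f) = - (1 / 2).
    rewrite linearD /= !h_delta (b_sym m_cox) b3 // b2 ?addr0 //.
    by rewrite (m_sym m_cox).
  have eg : refl g (delta y + delta f) = delta y + delta f + delta g.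
    by rewrite /refl hg -scaleNr -[X in _ = _ + X]scale1r; congr (_ + _ *: _); field.
  rewrite /= ef eg; split.
  - rewrite !ffunE eqxx; have -> : (y == f) = false by apply/negbTE.
    have -> : (y == g) = false by apply/negbTE.
    by rewrite !addr0.
  - by rewrite !linearD /= !h_delta b_ii // !b3 //; field.
  move=> k; rewrite !inE !linearD /= !h_delta => /orP[/eqP->|/eqP->].
    by rewrite b_ii // (b_sym m_cox c f y) (b2 mfg) b3 //; field.
  by rewrite b_ii // (b_sym m_cox c g y) (b_sym m_cox c g f) (b2 mfg) b3 //; field.
set ll := [:: g, x' & l'] in IH *; move=> [m3 m2 Dx].
have [ux yx] : uniq (f :: ll) /\ y \notin f :: ll by case/andP: uy.
have [u [j [ul jl [bx hx hk]]]] := IH f ux Dx.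
set b := actw u (delta j) in bx hx hk.
have sb : supp (f |: seqset ll) b.
  rewrite -seqset_cons; apply: supp_actw => [k /ul|]; first by rewrite !inE.
  by apply: supp_delta; rewrite inE.
have hy : hform y b = - (1 / 2).
  rewrite (h_single _ sb) ?bx ?b3 //; [by field| |].
    by rewrite inE; case/andP: ux.
  by move=> k; rewrite inE => /m2/b2.
have by0 : b y = 0 by apply: sb; rewrite -seqset_cons inE.
have e1 : refl y b = b + delta y.
  by rewrite /refl hy -scaleNr -[X in _ = _ + X]scale1r; congr (_ + _ *: _); field.
have hf1 : hform f (b + delta y) = - (1 / 2).
  by rewrite linearD /= h_delta hx (b_sym m_cox) b3 // add0r.
have e2 : refl f (b + delta y) = b + delta y + delta f.
  by rewrite /refl hf1 -scaleNr -[X in _ = _ + X]scale1r; congr (_ + _ *: _); field.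
have yf : y != f by apply: contraNneq yx => ->; exact: mem_head.
(* The root e_2 + e_3 of the smaller diagram becomes e_1 + e_3 under [y] and e_1 + e_2 under [f]. *)
exists [:: f, y & u], j; split.
- move=> k; rewrite inE => /orP[/eqP->|]; first by rewrite !inE eqxx orbT.
  by rewrite inE => /orP[/eqP->|/ul h]; [exact: mem_head|rewrite inE h orbT].
- by rewrite inE jl orbT.
rewrite /= -/b e1 e2; split.
- rewrite !ffunE by0 eqxx (negPf yf) add0r addr0 //.
- by rewrite !linearD /= !h_delta hy b_ii // b3 //; field.
move=> k; rewrite inE !linearD /= !h_delta => /orP[/eqP->|kl].
  by rewrite hx b_ii // (b_sym m_cox) b3 //; field.
rewrite hk // (b_sym m_cox c k y) (b_sym m_cox c k f) (b2 (m2 _ kl)); ring.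
Qed.

(** Two vertices at a time: -1 is realized on D_(n-2) and on the isolated [y], and the root of
    [D_root], orthogonal to both, adds [x]. The recursion ends with two isolated vertices. *)
Lemma D_negt y l : uniq (y :: l) -> Dpath y l -> odd (size l) -> negt (seqset (y :: l)).
Proof.
have [n] := ubnP (size l); elim: n y l => // n IH y l; rewrite ltnS => ln uy Dy ol.
have [u [j [ul jl [_ hy hk]]]] := D_root uy Dy.
case: l ln uy Dy ol ul jl hk => // x [|f [|g l]] //; first by move=> _ _ [].
move=> ln uy; move: (uy); rewrite /= => /and5P[yl xl fl gl ul0] Dy ol ul jl hk.
set l' := [:: f, g & l] in Dy ul jl hk *.
have [m2 Dx] : (forall k, k \in l' -> m y k = Some 2) /\ Dpath x l' by case: Dy.
have nl' : negt (seqset l').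
  have [l0|l0] := eqVneq l [::].
    subst l; have [_ _ mfg] := Dx; rewrite /l' seqset_cons.
    apply: (negt_union m_cox).
    - by rewrite disjoints1 inE.
    - by move=> a b; rewrite !inE => /eqP-> /eqP->; exact: nonedge2.
    - exact: negt1.
    rewrite (_ : seqset [:: g] = [set g]); first exact: negt1.
    by apply/setP => k; rewrite !inE.
  have Df : Dpath f (g :: l) by move: Dx l0; rewrite /l'; case: (l) => // ? ? [].
  apply: IH => //.
  - by move: ln => /= h; apply: leq_trans h.
  - by rewrite /= fl gl.
  - by move: ol => /=; rewrite negbK.
rewrite (_ : seqset _ = x |: (y |: seqset l')); last first.
  by apply/setP => k; rewrite !inE orbCA.
have xyl : x \notin y |: seqset l'.
  by rewrite !inE negb_or eq_sym; move: yl xl; rewrite !inE negb_or => /andP[-> _] ->.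
apply: (negt_extend m_cox xyl (u := u) (y := j)).
- apply: (negt_union m_cox) nl'; last exact: negt1.
    rewrite disjoints1 inE; apply: contra yl => h; by rewrite inE h orbT.
  by move=> a b /set1P->; rewrite in_set => /m2/nonedge2.
- by move=> k /ul; rewrite !inE orbCA.
- by move: jl; rewrite !inE orbCA.
move=> k; rewrite in_setU => /orP[/set1P->//|]; rewrite in_set => kl'.
have kl2 : k \in x :: l' by rewrite inE kl' orbT.
by rewrite hk // b2 ?oppr0 //; exact: m2.
Qed.

Lemma nth_Bpath x0 y l : (0 < size l)%N ->
  (forall i j, (i < j)%N -> (j < (size l).+1)%N ->
   m (nth x0 (y :: l) i) (nth x0 (y :: l) j) =
   Some (type_label (TypeB (size l).+1) i j)) -> Bpath y l.
Proof.
elim: l y => // x l IH y _ h; case: l IH h => [|x' l] IH h.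
  by have := h 0 1; exact.
split.
- by have := h 0 1; exact.
- move=> k kl; have lt : (index k (x' :: l) < size (x' :: l))%N by rewrite index_mem.
  have := h 0 (index k (x' :: l)).+2 isT lt.
  have -> : nth x0 [:: y, x, x' & l] (index k (x' :: l)).+2 = k := nth_index x0 kl.
  by move=> ->.
apply: IH => // i j ij jl; have /= -> := h i.+1 j.+1 ij jl.
by rewrite /path_label !eqSS.
Qed.

Lemma nth_Dpath x0 y l : (1 < size l)%N ->
  (forall i j, (i < j)%N -> (j < (size l).+1)%N ->
   m (nth x0 (y :: l) i) (nth x0 (y :: l) j) =
   Some (type_label (TypeD (size l).+1) i j)) -> Dpath y l.
Proof.
elim: l y => // x l IH y; case: l IH => // x' l IH _ h; case: l IH h => [|x'' l] IH h.
  split; [by have := h 0 1; exact|by have := h 0 2; exact|by have := h 1 2; exact].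
split.
- by have := h 0 1; exact.
- move=> k kl; have lt : (index k [:: x', x'' & l] < size [:: x', x'' & l])%N by rewrite index_mem.
  have := h 0 (index k [:: x', x'' & l]).+2 isT lt.
  have -> : nth x0 [:: y, x, x', x'' & l] (index k [:: x', x'' & l]).+2 = k := nth_index x0 kl.
  by move=> ->.
apply: IH => // i j ij jl; have -> := h i.+1 j.+1 ij jl.
by congr Some; rewrite /= /tripod_label /= !eqSS !ltnS !subSS !subn0.
Qed.

Lemma entry_label t i j : (i < j)%N -> type_entry t i j = type_label t i j.
Proof.
by move=> ij; rewrite /type_entry ltn_eqF // (minn_idPl (ltnW ij)) (maxn_idPr (ltnW ij)).
Qed.

(** For even [n] the alternating word of length [n] is a rotation of the plane by pi. *)
Lemma negt_even x y n : x != y -> m x y = Some n -> ~~ odd n -> negt [set x; y].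
Proof.
move=> xy mxy on; have n1 := m_ge2 m_cox xy mxy.
have bx : - bform x y = c n by rewrite /bform mxy opprK.
have U0 : cheb (c n) n = 0 by rewrite cheb_ct_n.
have U1 : cheb (c n) n.+1 = -1 by rewrite cheb_ct_Sn.
have U2 : cheb (c n) n.-1 = 1.
  have : cheb (c n) n.-1.+2 = 2 * c n * cheb (c n) n.-1.+1 - cheb (c n) n.-1 by exact: chebSS.
  by rewrite (prednK (ltnW n1)) U0 U1; lra.
exists (alt x y n); split.
  by move=> z /mem_alt[]->; rewrite !inE eqxx ?orbT.
move=> z; rewrite !inE => /orP[/eqP->|/eqP->].
  rewrite (alt_act0 m_cox) (negPf on) bx U0 U1 scale0r addr0 scaleN1r //.
rewrite -(prednK (ltnW n1)) [alt _ _ _]/= actw_rcons refl_delta // linearN /=.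
rewrite (alt_act0 m_cox) (b_sym m_cox) bx (prednK (ltnW n1)) U0 U2 scale1r scale0r addr0.
by have -> : odd n.-1 by case: (n) n1 on => //= k _; rewrite negbK.
Qed.

Theorem allowed_negt C : allowed m C -> negt C.
Proof.
move=> [t ta ht].
have [x0 _] : exists x0, x0 \in C.
  have t0 : (0 < type_rank t)%N by case: t ta {ht} => //= n; lia.
  have [phi [_ -> _]] := ht; exists (phi (Ordinal t0)); exact: imset_f.
have [z [uz sz eC mz]] := type_list x0 ht.
have rank2 n : type_rank t = 2 -> type_label t 0 1 = n -> ~~ odd n -> negt C.
  move=> t2 tl on; rewrite t2 in sz mz.
  case: z uz sz eC mz => [|x [|y [|]]] // uz _ eC mz.
  have -> : C = [set x; y] by rewrite eC; apply/setP => w; rewrite !inE.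
  apply: (negt_even (n := n)) => //; first by move: uz; rewrite /= inE andbT.
  by have := mz 0 1 isT isT; rewrite entry_label // tl.
case: t ta ht sz mz rank2 => [|n|n| | | | | | |n] ta ht sz mz rank2.
- case: z uz sz eC {mz} => [|x [|]] // _ _ ->.
  rewrite (_ : seqset [:: x] = [set x]); first exact: negt1.
  by apply/setP => w; rewrite !inE.
- case: z uz sz eC mz => [|y l] uz sz eC mz; first by move: ta; move/esym: sz => /= ->.
  have sl : n = (size l).+1 by rewrite -[n]sz.
  rewrite eC; apply: (B_root uz _).2; apply: (nth_Bpath (x0 := x0)).
    by move: ta; rewrite sl.
  move=> i j ij jl; rewrite -sl mz /= ?sl //; last by apply: ltn_trans ij _.
  by rewrite entry_label.
- case: z uz sz eC mz => [|y l] uz sz eC mz; first by move: ta; move/esym: sz => /= ->.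
  have sl : n = (size l).+1 by rewrite -[n]sz.
  move: ta => /= /andP[n4 on]; rewrite eC; apply: D_negt => //; last first.
    by move: on; rewrite sl /= negbK.
  apply: (nth_Dpath (x0 := x0)); first by move: n4; rewrite sl; lia.
  move=> i j ij jl; rewrite -sl mz /= ?sl //; last by apply: ltn_trans ij _.
  by rewrite entry_label.
- exact: negt_E7.
- exact: negt_E8.
- exact: negt_F4.
- exact: (rank2 6).
- exact: negt_H3.
- exact: negt_H4.
- by apply: (rank2 n) => //; case/andP: ta.
Qed.

End NegFamilies.

(** * Diagrams without -1 in the Coxeter group *)

Section Lattice.
Variables (I : finType) (m : I -> I -> option nat).
Hypothesis m_cox : coxeter_matrix m.
Variables (R : realFieldType) (c : cosine_table R).
Implicit Types (x y z f g k b : I) (n : nat) (J : {set I}).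
Implicit Types (p q r u : seq I).
Local Notation V := {ffun I -> R^o}.
Implicit Types (v : V).
Local Notation e := (diagram_edge m).
Local Notation light := (light m).
Local Notation ipath := (ipath m).
Local Notation star := (star m).
Local Notation negt := (negt m c).
Local Notation hform := (hform m c).
Local Notation bform := (bform m c).
Local Notation refl := (refl m c).
Local Notation actw := (actw m c).
Local Notation delta := (@delta I R).

Definition integral (a : R) := exists n : int, a = n%:~R.

Lemma integralD a a' : integral a -> integral a' -> integral (a + a').
Proof. by move=> [n ->] [n' ->]; exists (n + n'); rewrite rmorphD. Qed.
Lemma integralN a : integral a -> integral (- a).
Proof. by move=> [n ->]; exists (- n); rewrite rmorphN. Qed.
Lemma integralM a a' : integral a -> integral a' -> integral (a * a').
Proof. by move=> [n ->] [n' ->]; exists (n * n'); rewrite rmorphM. Qed.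
Lemma integral_nat n : integral n%:R.
Proof. by exists n%:Z; rewrite pmulrn. Qed.

Lemma integral_eq n a : a = n%:R -> integral a.
Proof. by move=> ->; exact: integral_nat. Qed.

Lemma not_integral n (a : R) : n%:R < a -> a < n.+1%:R -> ~ integral a.
Proof.
move=> h1 h2 [d ed]; move: h1 h2; rewrite ed !pmulrn !ltr_int; lia.
Qed.

(* -1 acts on the weight lattice modulo the root lattice both trivially and as
   the inversion, hence this quotient has exponent 2. *)
Lemma neg_weight J v : negt J ->
  (forall x y, x \in J -> y \in J -> integral (2 * bform x y)) ->
  supp J v -> (forall x, x \in J -> integral (2 * hform x v)) ->
  forall x, integral (2 * v x).
Proof.
move=> [u [uJ hu]] hb sv hv x.
have H : (forall y, integral (actw u v y - v y)) /\
         (forall y, y \in J -> integral (2 * hform y (actw u v))).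
  elim: u uJ {hu} => [|k u IH] uJ /=.
    by split=> // y; rewrite subrr; exact: (integral_nat 0).
  have kJ : k \in J by apply: uJ; exact: mem_head.
  have [|h1 h2] := IH; first by move=> y yu; apply: uJ; rewrite inE yu orbT.
  split=> [y|y yJ].
    rewrite reflE addrAC; apply: integralD => //; apply: integralN.
    by apply: integralM; [exact: h2|exact: integral_nat].
  have -> : 2 * hform y (refl k (actw u v)) =
      2 * hform y (actw u v) + - (2 * hform k (actw u v) * (2 * bform y k)).
    by rewrite /refl linearB linearZ /= h_delta; ring.
  apply: integralD; first exact: h2.
  by apply/integralN/integralM; [exact: h2|exact: hb].
have e1 : actw u v = - v.
  rewrite (actw_supp_sum m c u sv) {2}(supp_decomp sv) -sumrN.
  by apply: eq_bigr => y yJ; rewrite hu // scalerN.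
have := integralN (H.1 x); rewrite e1 ffunE.
by have -> : - (- v x - v x) = 2 * v x :> R by ring.
Qed.

(** The simply laced case, in which twice the form is integral on simple roots, as [neg_weight]
    requires. *)
Definition lightset J := forall x y, x \in J -> y \in J -> e x y -> light x y.

Lemma light_sym x y : light x y = light y x.
Proof. by rewrite /light (m_sym m_cox). Qed.

Lemma lightset_integral J x y : lightset J -> x \in J -> y \in J ->
  integral (2 * bform x y).
Proof.
move=> lJ xJ yJ; have [->|xy] := eqVneq x y.
  by rewrite b_ii // mulr1; exact: (integral_nat 2).
case: (boolP (e x y)) => [/(lJ x y xJ yJ)/eqP h|h]; last first.
  by rewrite (b_nonedge m_cox) // mulr0; exact: (integral_nat 0).
rewrite (b3 _ h); apply: (@eq_ind R (- 1%:R)); first exact/integralN/integral_nat.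
by field.
Qed.

Lemma path_lightset b p : ipath b p -> path light b p -> lightset (seqset (b :: p)).
Proof.
elim: p b => [|y p IH] b /=.
  by move=> _ _ x y; rewrite !inE => /eqP-> /eqP->; rewrite edge_irr.
case/and3P => by_ /allP bp ip /andP[lby lp] x z.
rewrite seqset_cons !in_setU1 => /orP[/eqP->|xp] /orP[/eqP->|zp].
- by rewrite edge_irr.
- move: zp; rewrite !inE => /orP[/eqP->//|/bp h]; by rewrite (negPf h).
- rewrite (edge_sym m_cox) light_sym.
  move: xp; rewrite !inE => /orP[/eqP->//|/bp h]; by rewrite (negPf h).
- exact: (IH y ip lp).
Qed.

Lemma star_lightset b p q r : star b p q r -> path light b p -> path light b q ->
  path light b r -> lightset (starset b p q r).
Proof.
move=> [_ [ip iq ir] [/crossP pq /crossP pr /crossP qr]] lp lq lr x y.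
have hp := path_lightset ip lp; have hq := path_lightset iq lq.
have hr := path_lightset ir lr.
have mb s z : z \in s -> z \in seqset (b :: s) by move=> zs; rewrite !inE zs orbT.
have bb s : b \in seqset (b :: s) by rewrite !inE eqxx.
have no (s t : seq I) z w : (forall z w, z \in s -> w \in t -> ~~ e z w) -> z \in s -> w \in t ->
    e z w -> light z w.
  by move=> h zs wt ezw; have := h z w zs wt; rewrite ezw.
rewrite !inE !mem_cat => /or4P[/eqP->|hx|hx|hx] /or4P[/eqP->|hy|hy|hy] exy;
 first [by rewrite edge_irr in exy
       |by apply: (no _ _ _ _ pq hx hy)|by apply: (no _ _ _ _ pr hx hy)
       |by apply: (no _ _ _ _ qr hx hy)
       |by (rewrite light_sym; rewrite (edge_sym m_cox) in exy;
          first [apply: (no _ _ _ _ pq hy hx exy)|apply: (no _ _ _ _ pr hy hx exy)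
                |apply: (no _ _ _ _ qr hy hx exy)])
       |by apply: hp exy; first [exact: bb|exact: mb]
       |by apply: hq exy; first [exact: bb|exact: mb]
       |by apply: hr exy; first [exact: bb|exact: mb]].
Qed.

(* Coefficients 1, 2, 3, ... from the far end of the path. *)
Lemma chain_vector b p : uniq (b :: p) -> ipath b p -> path light b p ->
  exists v : V, [/\ supp (seqset (b :: p)) v, v b = (size p).+1%:R,
    v (last b p) = 1, hform b v = (size p).+2%:R / 2
    & forall z, z \in p -> hform z v = 0].
Proof.
elim: p b => [|y p IH] b.
  move=> _ _ _; exists (delta b); split=> //.
  - by apply: supp_delta; rewrite inE mem_head.
  - exact: deltaii.
  - exact: deltaii.
  - by rewrite h_delta b_ii //= divff // pnatr_eq0.
rewrite cons_uniq => /andP[byp uy] /= /and3P[eby /allP bp ip] /andP[lby lp].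
have [v [sv vy vl hy hz]] := IH y uy ip lp.
have sv' : supp (y |: seqset p) v by rewrite -seqset_cons.
have yp : y \notin seqset p by move: uy; rewrite inE => /andP[].
have bz z : z \in p -> bform b z = 0.
  move=> zp; apply: (b_nonedge m_cox); last exact: bp.
  by apply: contraNneq byp => ->; rewrite inE zp orbT.
have hb : hform b v = - ((size p).+1%:R / 2).
  rewrite (h_single yp sv') => [|z]; last by rewrite inE; exact: bz.
  by rewrite vy b3; [field|exact/eqP].
exists (v + (size p).+2%:R *: delta b); split.
- apply: suppD; last by apply/suppZ/supp_delta; rewrite inE mem_head.
  by apply: suppS sv; rewrite (seqset_cons b); exact: subsetUr.
- have -> : (v + (size p).+2%:R *: delta b) b = v b + (size p).+2%:R * (delta b b : R) by rewrite !ffunE.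
  by rewrite deltaii mulr1 sv ?add0r // inE.
- have -> : (v + (size p).+2%:R *: delta b) (last y p) =
    v (last y p) + (size p).+2%:R * (delta b (last y p) : R) by rewrite !ffunE.
  rewrite vl deltaE; have -> : (last y p == b) = false.
    by apply: contraNF byp => /eqP <-; exact: mem_last.
  by rewrite mulr0 addr0.
- rewrite linearD linearZ /= hb h_delta b_ii // -(natr1 (size p).+2) -(natr1 (size p).+1).
  by field.
move=> z; rewrite inE linearD linearZ /= h_delta => /orP[/eqP->|zp].
  by rewrite hy (b_sym m_cox) b3; [field|exact/eqP].
by rewrite hz // (b_sym m_cox) bz // mulr0 addr0.
Qed.

(** The coefficients along the arm are [size p], ..., 2, 1, continuing [size p + 1] at [b]. *)
Lemma arm_vector b p : uniq (b :: p) -> ipath b p -> path light b p ->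
  exists v : V, [/\ supp (seqset p) v, hform b v = - ((size p)%:R / 2)
    & forall z, z \in p -> hform z ((size p).+1%:R *: delta b + v) = 0].
Proof.
case: p => [|y p].
  move=> _ _ _; exists 0; split=> //; first by move=> z _; rewrite ffunE.
  by rewrite linear0 mul0r oppr0.
rewrite cons_uniq => /andP[byp uy] /= /and3P[eby /allP bp ip] /andP[lby lp].
have [v [sv vy vl hy hz]] := chain_vector uy ip lp.
have sv' : supp (y |: seqset p) v by rewrite -seqset_cons.
have yp : y \notin seqset p by move: uy; rewrite inE => /andP[].
have bz z : z \in p -> bform b z = 0.
  move=> zp; apply: (b_nonedge m_cox); last exact: bp.
  by apply: contraNneq byp => ->; rewrite inE zp orbT.
exists v; split=> //.
  rewrite (h_single yp sv') => [|z]; last by rewrite inE; exact: bz.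
  by rewrite vy b3; [field|exact/eqP].
move=> z; rewrite inE linearD linearZ /= h_delta => /orP[/eqP->|zp].
  by rewrite hy (b_sym m_cox) b3; [field|exact/eqP].
by rewrite hz // (b_sym m_cox) bz // mulr0 add0r.
Qed.

(** In rank r, the vector of [chain_vector] divided by r + 1 is a fundamental weight. Twice its
    coefficient at the far end is 2 / (r + 1), not an integer for r > 1. *)
Lemma path_not_neg b p : uniq (b :: p) -> ipath b p -> path light b p ->
  (0 < size p)%N -> ~ negt (seqset (b :: p)).
Proof.
move=> up ip lp p0 nJ; have [v [sv vb vl hb hz]] := chain_vector up ip lp.
set n := size p in p0 vb hb; pose a : R := n.+2%:R.
have n0 : 0 < a by rewrite ltr0n.
have lJ := path_lightset ip lp.
have := neg_weight nJ (fun x y => @lightset_integral _ x y lJ) (suppZ a^-1 sv).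
move=> /(_ _ (last b p)).
have -> : 2 * (a^-1 *: v) (last b p) = 2 / a :> R.
  have -> : (a^-1 *: v) (last b p) = a^-1 * (v (last b p) : R) by rewrite !ffunE.
  by rewrite vl mulr1.
have H x : x \in seqset (b :: p) -> integral (2 * hform x (a^-1 *: v)).
  rewrite inE inE linearZ /= => /orP[/eqP->|xp].
    rewrite hb -/a (_ : 2 * _ = 1%:R); first exact: integral_nat.
    by field; lra.
  by rewrite hz // !mulr0; exact: (integral_nat 0).
move=> /(_ H); apply: (@not_integral 0); first by apply: divr_gt0; lra.
have : 2%:R < a by rewrite ltr_nat.
by rewrite ltr_pdivrMr // mul1r.
Qed.

Lemma D_not_neg b p f g : star b p [:: f] [:: g] -> path light b p ->
  light b f -> light b g -> ~~ odd (size p) -> ~ negt (starset b p [:: f] [:: g]).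
Proof.
move=> st lp lf lg op nJ; have lJ : lightset (starset b p [:: f] [:: g]).
  by apply: star_lightset => //=; rewrite ?lf ?lg.
have [up _ _ _] := star_uniq st.
have [us [ip ibf ibg] [/crossP pf /crossP pg /crossP fg]] := st.
have ebf : e b f by case/andP: ibf.
have ebg : e b g by case/andP: ibg.
have [v [sv hb hz]] := arm_vector up ip lp.
set P : R := (size p)%:R in hb; pose N : R := (P + 1) / 2.
have fJ : f \in starset b p [:: f] [:: g] by rewrite !(inE, mem_cat) eqxx !orbT.
have gJ : g \in starset b p [:: f] [:: g] by rewrite !(inE, mem_cat) eqxx !orbT.
have bJ : b \in starset b p [:: f] [:: g] by rewrite !(inE, mem_cat) eqxx.
have [pf' pg' bp gf] : [/\ f \notin p, g \notin p, b \notin p & g != f].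
  move: us; rewrite /= !(mem_cat, cat_uniq, inE, negb_or) /= !negb_or !andbT.
  by case/and3P=> /and3P[-> _ _] _ /andP[/andP[-> ->]]; rewrite eq_sym => ->.
have bf : b != f := edge_neq ebf. have bg : b != g := edge_neq ebg.
(* The half-spin weight at [f]. Twice its coefficient at [g] is [(P + 1) / 2], half an odd integer
   when [size p] is even. *)
pose la := 2^-1 *: ((P + 1) *: delta b + v) + (N / 2) *: delta g + ((N + 1) / 2) *: delta f.
have zero x y : x != y -> ~~ e x y -> bform x y = 0 by exact: b_nonedge.
have vf : hform f v = 0.
  apply: (h_supp sv) => y; rewrite inE => yp; apply: zero.
    by apply: contraNneq pf' => ->.
  by rewrite (edge_sym m_cox) pf // mem_head.
have vg : hform g v = 0.
  apply: (h_supp sv) => y; rewrite inE => yp; apply: zero.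
    by apply: contraNneq pg' => ->.
  by rewrite (edge_sym m_cox) pg // mem_head.
have bbf : bform b f = - (1 / 2) by apply/b3/eqP.
have bbg : bform b g = - (1 / 2) by apply/b3/eqP.
have bgf : bform f g = 0 by apply: zero; rewrite 1?eq_sym // fg // mem_head.
have sla : supp (starset b p [:: f] [:: g]) la.
  apply: suppD; last exact/suppZ/supp_delta.
  apply: suppD; last exact/suppZ/supp_delta.
  apply/suppZ/suppD; first exact/suppZ/supp_delta.
  by apply: suppS sv; apply/subsetP => z; rewrite !(inE, mem_cat) => ->; rewrite orbT.
have hla x : hform x la = 2^-1 * ((P + 1) * bform x b + hform x v) +
   N / 2 * bform x g + (N + 1) / 2 * bform x f.
  by rewrite /la !(linearD, linearZ) /= !h_delta.
have H x : x \in starset b p [:: f] [:: g] -> integral (2 * hform x la).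
  rewrite inE inE !mem_cat !inE => /or4P[/eqP->|xp|/eqP->|/eqP->].
  - apply: (@integral_eq 0).
    by rewrite hla b_ii // hb bbg bbf /N; field.
  - apply: (@integral_eq 0).
    have := hz x xp; rewrite linearD linearZ /= h_delta -natr1 -/P => h.
    have xg : bform x g = 0.
      by apply: zero; [apply: contraNneq pg' => <-|rewrite pg // mem_head].
    have xf : bform x f = 0.
      by apply: zero; [apply: contraNneq pf' => <-|rewrite pf // mem_head].
    by rewrite hla h xg xf !(mulr0, addr0).
  - apply: (@integral_eq 1).
    by rewrite hla vf bgf b_ii // (b_sym m_cox) bbf /N; field.
  - apply: (@integral_eq 0).
    by rewrite hla vg (b_sym m_cox c g f) bgf b_ii // (b_sym m_cox) bbg /N; field.
have := neg_weight nJ (fun x y => @lightset_integral _ x y lJ) sla H g.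
have -> : 2 * la g = N :> R.
  have -> : la g = 2^-1 * ((P + 1) * (delta b g : R) + (v g : R)) + N / 2 * (delta g g : R)
      + (N + 1) / 2 * (delta f g : R) by rewrite !ffunE.
  rewrite !deltaE eqxx (eq_sym g b) (negPf bg) (negPf gf) sv; last by rewrite inE.
  by rewrite /= mulr0n mulr1n; field.
have eP : P = 2 * (size p)./2%:R.
  by rewrite /P -{1}(odd_double_half (size p)) (negPf op) add0n -mul2n natrM.
apply: (@not_integral (size p)./2); rewrite /N eP -?(natr1 (size p)./2); lra.
Qed.

Lemma E6_not_neg b p q r : star b p q r -> path light b p -> path light b q ->
  path light b r -> size p = 2 -> size q = 2 -> size r = 1 ->
  ~ negt (starset b p q r).
Proof.
move=> st lp lq lr sp sq sr nJ.
have lJ : lightset (starset b p q r) by exact: star_lightset.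
case: p q r sp sq sr st lp lq lr nJ lJ =>
  [//|p0 [//|p1 [|//]]] [//|q0 [//|q1 [|//]]] [//|r0 [|//]] _ _ _ st lp lq lr nJ lJ.
have [us [ip iq ir] [pq pr qr]] := st.
move: us ip iq ir pq pr qr lp lq lr; rewrite /= !inE !negb_or !andbT.
move=> /and5P[]/and5P[nb1 nb2 nb3 nb4 nb5] /and4P[n01 n02 n03 n04].
move=> /and3P[n12 n13 n14] /andP[n23 n24] n34.
move=> /and3P[_ e1 _] /and3P[_ e2 _] _ /andP[/andP[e3 e4] /andP[e5 e6]] /andP[e7 e8] /andP[e9 e10].
move=> /andP[/eqP l1 /eqP l2] /andP[/eqP l3 /eqP l4] /eqP l5.
have zero x y : x != y -> ~~ e x y -> bform x y = 0 by exact: b_nonedge.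
(* The fundamental weight at [p1], read off the inverse Cartan matrix of E_6; twice its coefficient
   at [p1] is 8/3. *)
pose la := (5 / 3) *: delta p0 + (4 / 3) *: delta p1 + 2 *: delta b +
  (4 / 3) *: delta q0 + (2 / 3) *: delta q1 + (1 : R) *: delta r0.
have hla x : hform x la = 5 / 3 * bform x p0 + 4 / 3 * bform x p1 + 2 * bform x b +
    4 / 3 * bform x q0 + 2 / 3 * bform x q1 + bform x r0.
  by rewrite /la !(linearD, linearZ) /= !h_delta mul1r.
have sla : supp (starset b [:: p0; p1] [:: q0; q1] [:: r0]) la.
  by do 5?[apply: suppD]; apply/suppZ/supp_delta; rewrite !inE eqxx ?orbT.
have B1 := b3 c l1; have B2 := b3 c l2; have B3 := b3 c l3; have B4 := b3 c l4.
have B5 := b3 c l5; have Z1 := zero _ _ nb2 e1; have Z2 := zero _ _ nb4 e2.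
have Z3 := zero _ _ n02 e3; have Z4 := zero _ _ n03 e4; have Z5 := zero _ _ n12 e5.
have Z6 := zero _ _ n13 e6; have Z7 := zero _ _ n04 e7; have Z8 := zero _ _ n14 e8.
have Z9 := zero _ _ n24 e9; have Z10 := zero _ _ n34 e10.
have sy := b_sym m_cox c.
have H x : x \in starset b [:: p0; p1] [:: q0; q1] [:: r0] -> integral (2 * hform x la).
  rewrite !inE => /or4P[/eqP->|/eqP->|/eqP->|/or3P[/eqP->|/eqP->|/eqP->]].
  - apply: (@integral_eq 0).
    by rewrite hla B1 Z1 b_ii // B3 Z2 B5; field.
  - apply: (@integral_eq 0).
    by rewrite hla b_ii // B2 (sy p0 b) B1 Z3 Z4 Z7; field.
  - apply: (@integral_eq 1).
    by rewrite hla (sy p1 p0) B2 b_ii // (sy p1 b) Z1 Z5 Z6 Z8; field.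
  - apply: (@integral_eq 0).
    by rewrite hla (sy q0 p0) (sy q0 p1) (sy q0 b) Z3 Z5 B3 b_ii // B4 Z9; field.
  - apply: (@integral_eq 0).
    by rewrite hla (sy q1 p0) (sy q1 p1) (sy q1 b) (sy q1 q0) Z4 Z6 Z2 B4 b_ii // Z10; field.
  - apply: (@integral_eq 0).
    by rewrite hla (sy r0 p0) (sy r0 p1) (sy r0 b) (sy r0 q0) (sy r0 q1) Z7 Z8 B5 Z9 Z10 b_ii //; field.
have := neg_weight nJ (fun x y => @lightset_integral _ x y lJ) sla H p1.
have -> : 2 * la p1 = 8 / 3 :> R.
  have -> : la p1 = 5 / 3 * (delta p0 p1 : R) + 4 / 3 * (delta p1 p1 : R)
     + 2 * (delta b p1 : R) + 4 / 3 * (delta q0 p1 : R) + 2 / 3 * (delta q1 p1 : R)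
     + 1 * (delta r0 p1 : R) by rewrite !ffunE.
  rewrite !deltaE eqxx (eq_sym p1 p0) (negPf n01) (eq_sym p1 b) (negPf nb2).
  by rewrite (negPf n12) (negPf n13) (negPf n14) /= ?mulr0n ?mulr1n; field.
by apply: (@not_integral 2); lra.
Qed.

End Lattice.

(** * From -1 to the allowed types, and removal of a vertex *)

Section NegClassification.
Variables (I : finType) (m : I -> I -> option nat).
Hypothesis m_cox : coxeter_matrix m.
Variables (R : realFieldType) (c : cosine_table R).
Variables (W : groupType) (s : I -> W).
Hypothesis W_cox : coxeter_system m s.
Implicit Types (x y z f g b : I) (k n : nat) (C J N : {set I}) (w : W).
Implicit Types (p q r u : seq I).
Local Notation V := {ffun I -> R^o}.
Implicit Types (v : V).
Local Notation e := (diagram_edge m).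
Local Notation light := (light m).
Local Notation ipath := (ipath m).
Local Notation star := (star m).
Local Notation negt := (negt m c).
Local Notation nonaff := (nonaff m c).
Local Notation conn := (conn m).
Local Notation hform := (hform m c).
Local Notation delta := (@delta I R).
Local Notation act := (act m_cox c W_cox).
Local Notation inW := (std_parabolic s).
Local Notation len := (len s).
Local Notation closedin := (closedin m).

(* [W_N] is finite, and [w] is its longest element. *)
Definition fint N := exists2 w, inW N w &
  forall x, x \in N -> nonneg (- act w (delta x)).

(** Each letter that lengthens [w] adds a nonnegative multiple of a positive root to the image of
    [v]. *)
Lemma act_antidominant N v w : supp N v -> (forall x, x \in N -> hform x v <= 0) ->
  inW N w -> nonneg (act w v - v).
Proof.
move=> sv hv; have [n] := ubnP (len N w); elim: n w => // n IH w; rewrite ltnS => wn wN.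
case: (posnP (len N w)) => [w0|w0].
  by rewrite (len_eq0 m_cox W_cox wN w0) act1 subrr; exact: nonneg0.
have [x [xN lt]] := len_gt0_last m_cox W_cox wN w0.
have wxN : inW N (w * s x)%g by apply: inWM => //; exact: inWs.
have px : nonneg (act (w * s x)%g (delta x)).
  apply: (@root_pos _ _ m_cox R c _ _ W_cox N) => //.
  by rewrite (msK m_cox W_cox) ltnW.
have -> : act w v - v = (act (w * s x)%g v - v) + (- 2 * hform x v) *: act (w * s x)%g (delta x).
  rewrite addrAC; congr (_ - _); rewrite -{1}(msK m_cox W_cox w x) actM act_s.
  by rewrite /refl linearB linearZ /= mulNr scaleNr.
apply: nonnegD; first by apply: IH => //; exact: leq_trans lt wn.
by apply: nonnegZ => //; have := hv x xN; lra.
Qed.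

(** The longest element maps [v] to a nonpositive vector, while antidominance makes the image at
    least [v]. *)
Lemma fint_nonaff N : fint N -> nonaff N.
Proof.
move=> [w wN hw] v pv sv hv.
have hv' x : x \in N -> hform x v <= 0.
  move=> xN; have [vx|vx] := eqVneq (v x) 0; last exact: hv.
  exact: h_off.
have h1 := act_antidominant sv hv' wN.
have h2 : nonneg (- act w v).
  rewrite (act_supp_sum m_cox c W_cox w sv) -sumrN; apply: nonneg_sum => x xN.
  by rewrite -scalerN; apply: nonnegZ => //; exact: hw.
by apply: nonneg_anti => //; have := nonnegD h1 h2; rewrite addrAC subrr add0r.
Qed.

Lemma negt_fint N : negt N -> fint N.
Proof.
move=> /(negtP m_cox c W_cox)[w [wN hw]]; exists w => // x xN.
by rewrite hw // opprK; exact: nonneg_delta.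
Qed.

Lemma negt_nonaff N : negt N -> nonaff N.
Proof. by move/negt_fint/fint_nonaff. Qed.

(* For odd n the elements of the dihedral group are the powers of the rotation
   g and their products with [s x]; one commuting with [s x] is 1 or [s x]. *)
Lemma odd_dihedral_not_neg x y n : x != y -> m x y = Some n -> odd n ->
  ~ negt [set x; y].
Proof.
move=> xy mxy on /(negtP m_cox c W_cox)[w hw].
pose g := (s x * s y)%g; have gn : (g ^+ n = 1)%g.
  by case: W_cox => h _ _; exact: h.
have sx := ss m_cox W_cox x; have sy := ss m_cox W_cox y.
have gV : (g^-1 = g ^+ n.-1)%g.
  apply: mulg1_eq; rewrite -expgS prednK //; by case: (n) on.
have sxg k : (s x * g ^+ k = (g^-1) ^+ k * s x)%g.
  elim: k => [|k IH]; first by rewrite !expg0 mulg1 mul1g.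
  rewrite expgSr mulgA IH -mulgA expgSr -[RHS]mulgA; congr (_ * _)%g.
  by rewrite /g invgM !(sV m_cox W_cox) mulgA sx mul1g -mulgA sx mulg1.
have shape : exists k, w = (g ^+ k)%g \/ w = (g ^+ k * s x)%g.
  have [/(inWP m_cox W_cox)[u uJ ->] _] := hw.
  elim: u uJ => [|z u IH] uJ; first by exists 0; left; rewrite word_nil.
  have [|k ek] := IH; first by move=> z' h; apply: uJ; rewrite inE h orbT.
  have main k' (w' : W) : (w' = g ^+ k')%g \/ (w' = g ^+ k' * s x)%g ->
      exists k, (s x * w' = g ^+ k)%g \/ (s x * w' = g ^+ k * s x)%g.
    move=> h; exists (n.-1 * k'); case: h => ->.
      by right; rewrite sxg gV -expgnA.
    by left; rewrite mulgA sxg -mulgA sx mulg1 gV -expgnA.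
  rewrite word_cons; have := uJ z (mem_head _ _); rewrite !inE => /orP[/eqP->|/eqP->].
    exact: main ek.
  have -> : (s y * word s u = s x * (g * word s u))%g by rewrite /g !mulgA sx mul1g.
  by apply: (main k.+1); case: ek => ->; [left|right]; rewrite expgS ?mulgA.
have [k ek] := shape.
have cxw : (w * s x = s x * w)%g.
  by apply: (negw_central hw); apply: inWs; rewrite !inE eqxx.
(* Conjugation by [s x] both fixes and inverts [g ^+ k], so its square is 1; its [n]-th power is 1
   too, with [n] odd. *)
have gk : (g ^+ k = 1)%g.
  have cg : (g ^+ k * s x = s x * g ^+ k)%g.
    case: ek => ek; first by rewrite -ek.
    by rewrite -ek -{1}[w](mulgK (s x)) (sV m_cox W_cox) cxw ek -!mulgA sx mulg1.
  have e1 : ((g ^+ k) ^+ 2 = 1)%g.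
    have e0 : (g ^+ k = g^-1 ^+ k)%g by apply: (mulIg (s x)); rewrite -sxg.
    by rewrite expg2 {2}e0 expVgn mulgV.
  have e2 : ((g ^+ k) ^+ n = 1)%g by rewrite -expgnA mulnC expgnA gn expg1n.
  by move: e2; rewrite -(odd_double_half n) on add1n expgS -mul2n expgnA e1 expg1n mulg1.
have yJ : y \in [set x; y] by rewrite !inE eqxx orbT.
have := congr1 (fun v : V => v y) (hw.2 y yJ).
have wv : (act w (delta y) y : R) = 1.
  case: ek => ->; rewrite gk ?mul1g ?act1 ?deltaii // act_s reflEne ?deltaii //.
  by rewrite eq_sym.
rewrite [in RHS]ffunE deltaii => h; have : (1 : R) = - 1 by rewrite -[LHS]wv.
lra.
Qed.

Theorem neg_allowed C : negt C -> conn C -> allowed m C.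
Proof.
move=> nC cC; case: (classification m_cox (negt_nonaff nC) cC) => //.
- by move=> [b [p [p0 up ip lp eC]]]; case: (path_not_neg m_cox up ip lp p0 (c := c)); rewrite -eC.
- move=> [x [y [n [xy mxy on _ eC]]]]; case: (odd_dihedral_not_neg xy mxy on).
  by rewrite -eC.
case=> [[b [p [f [g [st [lp lf lg] op _ eC]]]]]|[b [p [q [r [st [lp lq lr] [sp sq sr] eC]]]]]].
  by case: (D_not_neg m_cox st lp lf lg op (c := c)); rewrite -eC.
by case: (E6_not_neg m_cox st lp lq lr sp sq sr (c := c)); rewrite -eC.
Qed.

(** A longer arm would be a component of type A_n with n > 1. *)
Lemma arm_le1 J x r : ipath x r -> path light x r -> uniq (x :: r) ->
  closedin (seqset r) J -> negt J -> (size r <= 1)%N.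
Proof.
case: r => [|y [|z r]] // /= /and3P[_ _ ip] /andP[_ lp] /andP[_ ur] cl nJ.
by case: (path_not_neg m_cox ur ip lp _ (negt_closed m_cox cl nJ)).
Qed.

Lemma sub_closed C x p q : C = x |: (seqset p :|: seqset q) -> x \notin p ->
  cross m q p -> closedin (seqset p) (C :\ x).
Proof.
move=> -> xp /crossP cr; split.
  apply/subsetP => z; rewrite !inE => zp; rewrite zp orbT andbT.
  by apply: contraNneq xp => <-.
move=> z y; rewrite !inE => zp /andP[yx /or3P[/eqP yx'|yp|yq]] ynp.
- by rewrite yx' eqxx in yx.
- by rewrite yp in ynp.
by rewrite (edge_sym m_cox) cr.
Qed.

Lemma light_rev b p1 x p2 : path light b (p1 ++ x :: p2) ->
  path light x p2 /\ path light x (rev (b :: p1)).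
Proof.
rewrite cat_path /= => /and3P[l1 l2 l3]; split=> //.
have := rev_path light b (rcons p1 x); rewrite last_rcons belast_rcons => ->.
rewrite (eq_path (e' := light)) ?rcons_path ?l1 //.
by move=> y z; rewrite (light_sym m_cox).
Qed.

(** Without [x], the part of the path on the side of [b] is an arm of at most one vertex, so [x] is
    [b] or its neighbour; for [x = b] the arm considered is [p]. *)
Lemma path_corank b p x : uniq (b :: p) -> ipath b p -> path light b p ->
  x \in b :: p -> negt (seqset (b :: p) :\ x) ->
  (x = b /\ (size p <= 1)%N) \/ (exists p2, p = x :: p2).
Proof.
move=> up ip lp; rewrite inE => /orP[/eqP->|xp] nC; [left|right].
  split=> //; apply: (arm_le1 ip lp up _ nC).
  apply: (sub_closed (q := [::])) => //; last by case/andP: up.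
  by apply/setP => z; rewrite !inE orbF.
case/splitPr: xp up ip lp nC => p1 p2 up ip lp nC.
have [i2 i1 cr] := ipath_split m_cox ip; have [l2 l1] := light_rev lp.
have ur : uniq (x :: rev (b :: p1)).
  move: up; rewrite -cat_cons cat_uniq /= => /and3P[u1 u2 _].
  rewrite mem_rev rev_uniq [uniq _]/= u1 andbT.
  by move: u2; rewrite negb_or => /andP[].
have : (size (rev (b :: p1)) <= 1)%N.
  apply: (arm_le1 i1 l1 ur _ nC); apply: (sub_closed (q := p2)).
  - apply/setP => z; rewrite !(inE, mem_cat, mem_rev).
    by case: (z == x); case: (z == b); case: (z \in p1); rewrite /= ?orbT.
  - by case/andP: ur.
  - apply/(cross_sym m_cox)/crossP => y z; rewrite mem_rev => yp zp.
    by move/crossP: cr; apply.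
by rewrite size_rev; case: p1 {nC ip lp up i1 l1 cr ur} => //; exists p2.
Qed.

Lemma ipath_prefix b p1 p2 : ipath b (p1 ++ p2) -> ipath b p1.
Proof.
elim: p1 b => //= y p1 IH b /and3P[-> + /IH->]; rewrite all_cat => /andP[->].
by [].
Qed.

Lemma star_prefix b p1 p2 q r : star b (p1 ++ p2) q r -> star b p1 q r.
Proof.
move=> [us [ip iq ir] [pq pr qr]]; split.
- apply: subseq_uniq us; rewrite -!cat_cons; apply: cat_subseq => //.
  by exact: (prefix_subseq (b :: p1)).
- by split=> //; exact: ipath_prefix ip.
- by split=> //; apply/crossP => y z yp; [move/crossP: pq|move/crossP: pr]; apply;
    rewrite mem_cat yp.
Qed.

(** Removing [f] or [g] leaves a path, and removing [b] cuts off an arm of at least two vertices.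
    Removing a vertex of [p] leaves a fork with arm [p1] and a piece [p2] of at most one vertex;
    [p1] must have odd size, so by parity [p2] is empty. *)
Lemma D_corank b p f g x : star b p [:: f] [:: g] -> path light b p ->
  light b f -> light b g -> ~~ odd (size p) -> (0 < size p)%N ->
  x \in starset b p [:: f] [:: g] -> negt (starset b p [:: f] [:: g] :\ x) ->
  x = last b p.
Proof.
move=> st lp lf lg op p0 xC nC.
have [up _ _ _] := star_uniq st.
have [us [ip ibf ibg] [cf cg cfg]] := st.
have leaf f' g' : star b p [:: f'] [:: g'] -> light b g' ->
    ~ negt (starset b p [:: f'] [:: g'] :\ f').
  move=> [us' [_ _ ig] [_ cg' cfg']] lg' nn.
  have ebg : e b g' by case/andP: ig.
  have ug : uniq [:: g', b & p].
    move: us'; rewrite /= !mem_cat !inE !negb_or cat_uniq /=.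
    case/andP => /and3P[-> bf bg] /and3P[-> hh _].
    rewrite !orbF !negb_or in hh; case/andP: hh => _ gp.
    by rewrite gp eq_sym bg.
  apply: (path_not_neg m_cox ug _ _ _ (c := c)) => //.
  - rewrite /= (edge_sym m_cox) ebg ip andbT /=; apply/allP => z zp.
    by rewrite (edge_sym m_cox); move/crossP: cg'; apply; rewrite ?mem_head.
  - by rewrite /= (light_sym m_cox) lg'.
  rewrite (_ : seqset _ = starset b p [:: f'] [:: g'] :\ f') //.
  apply/setP => z; rewrite !(inE, mem_cat); have [->|zf] := eqVneq z f'.
    move: us'; rewrite /= !mem_cat !inE !negb_or cat_uniq /=.
    case/andP => /and3P[_ bf bg] /and3P[_ hh /andP[fg' _]].
    rewrite !orbF !negb_or in hh; case/andP: hh => fp _; move: fg'; rewrite inE => fg'.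
    by rewrite (negPf fg') eq_sym (negPf bf) (negPf fp).
  by rewrite /=; case: (z == g'); case: (z == b); case: (z \in p).
move: (xC); rewrite inE inE !mem_cat !inE => /or4P[/eqP xb|xp|/eqP xf|/eqP xg].
- exfalso; rewrite xb in nC; have := arm_le1 ip lp up _ nC.
  have cl : closedin (seqset p) (starset b p [:: f] [:: g] :\ b).
    apply: (sub_closed (q := [:: f; g])).
    + by apply/setP => z; rewrite !(inE, mem_cat).
    + by case/andP: up.
    + apply/(cross_sym m_cox)/crossP => y z yp; rewrite !inE => /orP[]/eqP->.
        by move/crossP: cf; apply; rewrite ?mem_head.
      by move/crossP: cg; apply; rewrite ?mem_head.
  move=> /(_ cl); case: (size p) p0 op => [|[|]] //.
- have [p1 [p2 ep]] : exists p1 p2, p = p1 ++ x :: p2.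
    by case/splitPr: xp => p1 p2; exists p1, p2.
  have := ip; rewrite ep => /(ipath_split m_cox)[i2 i1 cr].
  have := lp; rewrite ep => /light_rev[l2 l1].
  have up' := up; rewrite ep -cat_cons cat_uniq in up'; case/and3P: up' => u1 u12 u2.
  have inp z : z \in p1 \/ z \in p2 -> z \in p.
    by rewrite ep mem_cat inE => -[->|->] //; rewrite !orbT.
  have s2 : (size p2 <= 1)%N.
    apply: (arm_le1 i2 l2 u2 _ nC); apply: (sub_closed (q := [:: f, g, b & p1])).
    + apply/setP => z; rewrite ep !(inE, mem_cat).
      by case: (z == f); case: (z == g); case: (z == b); case: (z == x);
        case: (z \in p1); case: (z \in p2).
    + by case/andP: u2.
    + apply/crossP => y z; rewrite inE inE => /or3P[/eqP->|/eqP->|yp] zp.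
      * by rewrite (edge_sym m_cox); move/crossP: cf; apply; [apply: inp; right|exact: mem_head].
      * by rewrite (edge_sym m_cox); move/crossP: cg; apply; [apply: inp; right|exact: mem_head].
      * by move/crossP: cr; apply.
  have st1 : star b p1 [:: f] [:: g] by move: st; rewrite ep => /star_prefix.
  have lp1 : path light b p1 by move: lp; rewrite ep cat_path => /andP[].
  (* For empty [p1] the fork is a path of three vertices, which [D_not_neg] covers too. *)
  have op1 : odd (size p1).
    apply: contraT => op1; case: (D_not_neg m_cox st1 lp1 lf lg op1 (c := c)).
    have := @sub_closed (starset b p [:: f] [:: g]) x [:: b, f, g & p1] p2 _ _ _.
    move=> H; rewrite (_ : starset _ _ _ _ = seqset [:: b, f, g & p1]); last first.
      apply/setP => z; rewrite !(inE, mem_cat).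
      by case: (z == f); case: (z == g); case: (z == b); case: (z \in p1).
    apply: (negt_closed m_cox (H _ _ _) nC).
    + apply/setP => z; rewrite ep !(inE, mem_cat).
      by case: (z == f); case: (z == g); case: (z == b); case: (z == x);
        case: (z \in p1); case: (z \in p2).
    + have [xf xg] := star_disj st xp; rewrite !inE in xf xg.
      by move: u12; rewrite /= !inE !negb_or xf xg => /andP[].
    + apply/(cross_sym m_cox)/crossP => y z; rewrite inE inE inE => /or4P[/eqP->|/eqP->|/eqP->|yp] zp.
      * by move/crossP: cr; apply => //; exact: mem_head.
      * by rewrite (edge_sym m_cox); move/crossP: cf; apply; [apply: inp; right|exact: mem_head].
      * by rewrite (edge_sym m_cox); move/crossP: cg; apply; [apply: inp; right|exact: mem_head].
      * by move/crossP: cr; apply => //; rewrite inE yp orbT.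
  have : p2 = [::].
    move: op s2; rewrite ep size_cat /= oddD op1 /= negbK; by case: (p2) => [|a [|]].
  by move=> ->; rewrite last_cat.
- by rewrite xf in nC; case: (leaf _ _ st lg nC).
- have st' := star_sw23 m_cox st; rewrite xg starset_sw23 in nC.
  by case: (leaf _ _ st' lf nC).
Qed.

End NegClassification.

(** * Elementary steps *)

Section Corank.
Variables (I : finType) (m : I -> I -> option nat).
Hypothesis m_cox : coxeter_matrix m.
Variables (R : realFieldType) (c : cosine_table R).
Implicit Types (x y z f g b : I) (n : nat) (C : {set I}).
Implicit Types (p q r u : seq I).
Local Notation e := (diagram_edge m).
Local Notation light := (light m).
Local Notation star := (star m).
Local Notation negt := (negt m c).
Local Notation nonaff := (nonaff m c).
Local Notation conn := (conn m).
Local Notation closedin := (closedin m).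

(** Removing the neighbour of [b] leaves a component A_4; removing the end of the arm leaves D_5. *)
Lemma E6_corank_arm b p q r x : star b p q r -> path light b p -> path light b q ->
  path light b r -> size p = 2 -> size q = 2 -> size r = 1 -> x \in p ->
  ~ negt (starset b p q r :\ x).
Proof.
move=> st lp lq lr sp sq sr xp nC.
case: p sp st lp xp nC => [//|p0 [//|p1 [|//]]] _ st lp xp nC.
case: r sr st lr nC => [//|r0 [|//]] _ st lr nC.
have [us [ip iq ir] [pq pr qr]] := st.
have ebr : e b r0 by case/andP: ir.
have [ebp nebp] : e b p0 /\ ~~ e b p1 by case/and3P: ip => -> /= /andP[->].
have lbr : light b r0 by case/andP: lr.
have lbp : light b p0 by case/andP: lp.
have [p0q p0r] := star_disj st (mem_head _ _).
have [p1q p1r] : p1 \notin q /\ p1 \notin [:: r0].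
  by apply: (star_disj st); rewrite !inE eqxx orbT.
have [_ uq _ _] := star_uniq st.
have rq : r0 \notin q by have [] := star_disj (star_sw23 m_cox (star_sw12 m_cox (star_sw23 m_cox st))) (mem_head _ _).
have [b0 b1 br p01] : [/\ b != p0, b != p1, b != r0 & p0 != p1].
  move: us; rewrite /= !inE !mem_cat !inE !negb_or => /andP[/and4P[-> -> _ ->] /andP[/andP[-> _] _]].
  by [].
move: xp; rewrite !inE => /orP[/eqP xe|/eqP xe]; rewrite xe in nC.
  have cl : closedin (seqset [:: r0, b & q]) (starset b [:: p0; p1] q [:: r0] :\ p0).
    apply: (sub_closed m_cox (q := [:: p1])).
    - apply/setP => z; rewrite !(inE, mem_cat).
      by case: (z == r0); case: (z == b); case: (z == p0); case: (z == p1); case: (z \in q).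
    - by rewrite !inE !negb_or p0q (eq_sym p0 b) b0; move: p0r; rewrite inE => ->.
    - apply/crossP => y z; rewrite inE => /eqP->; rewrite inE inE => /or3P[/eqP->|/eqP->|zq].
      + by move/crossP: pr; apply; rewrite !inE eqxx ?orbT.
      + by rewrite (edge_sym m_cox).
      + by move/crossP: pq; apply => //; rewrite !inE eqxx orbT.
  apply: (path_not_neg m_cox _ _ _ _ (negt_closed m_cox cl nC)) => //.
  - by rewrite cons_uniq uq inE negb_or eq_sym br rq.
  - rewrite /= (edge_sym m_cox) ebr iq andbT; apply/allP => z zq.
    by rewrite (edge_sym m_cox); move/crossP: qr; apply; rewrite ?mem_head.
  - by rewrite /= (light_sym m_cox) lbr.
have st' : star b q [:: p0] [:: r0].
  by apply/(star_sw12 m_cox)/(star_prefix (p2 := [:: p1])).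
have e1 : starset b [:: p0; p1] q [:: r0] :\ p1 = starset b q [:: p0] [:: r0].
  apply/setP => z; rewrite !(inE, mem_cat); have [->|zp] := eqVneq z p1.
    rewrite /= eq_sym (negPf b1) (negPf p1q) eq_sym (negPf p01).
    by move: p1r; rewrite inE => /negPf ->.
  by rewrite /=; case: (z == b); case: (z == p0); case: (z \in q).
apply: (D_not_neg m_cox st' lq lbp lbr _ (c := c)); first by rewrite sq.
by rewrite -e1.
Qed.

(** Removing [b] leaves a component A_2; removing the short arm leaves A_5. *)
Lemma E6_corank b p q r x : star b p q r -> path light b p -> path light b q ->
  path light b r -> size p = 2 -> size q = 2 -> size r = 1 ->
  x \in starset b p q r -> ~ negt (starset b p q r :\ x).
Proof.
move=> st lp lq lr sp sq sr; rewrite inE inE !mem_cat => /or4P[/eqP->|xp|xq|xr] nC.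
- have [up _ _ _] := star_uniq st; have [_ [ip _ _] [pq pr _]] := st.
  have cl : closedin (seqset p) (starset b p q r :\ b).
    apply: (sub_closed m_cox (q := q ++ r)).
    + by apply/setP => z; rewrite !(inE, mem_cat).
    + by case/andP: up.
    + apply/(cross_sym m_cox)/crossP => y z yp; rewrite mem_cat => /orP[]zz.
        by move/crossP: pq; apply.
      by move/crossP: pr; apply.
  by have := arm_le1 m_cox ip lp up cl nC; rewrite sp.
- exact: (E6_corank_arm st lp lq lr sp sq sr xp nC).
- rewrite starset_sw12 in nC.
  exact: (E6_corank_arm (star_sw12 m_cox st) lq lp lr sq sp sr xq nC).
case: p sp st lp nC => [//|p0 [//|p1 [|//]]] _ st lp nC.
case: r sr st lr nC xr => [//|r0 [|//]] _ st lr nC; rewrite inE => /eqP xr; rewrite xr in nC.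
have [up uq _ _] := star_uniq st.
have [us [ip iq ir] [pq pr qr]] := st.
have [ebp nebp epp] : [/\ e b p0, ~~ e b p1 & e p0 p1].
  by case/and3P: ip => -> /= /andP[-> _] /andP[-> _].
have [lbp lpp] : light b p0 /\ light p0 p1 by case/and3P: lp.
have [p0q p0r] := star_disj st (mem_head _ _).
have [p1q p1r] : p1 \notin q /\ p1 \notin [:: r0].
  by apply: (star_disj st); rewrite !inE eqxx orbT.
have rq : r0 \notin q by have [] := star_disj (star_sw23 m_cox (star_sw12 m_cox (star_sw23 m_cox st))) (mem_head _ _).
have [b0 b1 br p01] : [/\ b != p0, b != p1, b != r0 & p0 != p1].
  move: us; rewrite /= !inE !mem_cat !inE !negb_or => /andP[/and4P[-> -> _ ->] /andP[/andP[-> _] _]].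
  by [].
have e1 : starset b [:: p0; p1] q [:: r0] :\ r0 = seqset [:: p1, p0, b & q].
  apply/setP => z; rewrite !(inE, mem_cat); have [->|zr] := eqVneq z r0.
    rewrite /= (eq_sym r0 b) (negPf br) (negPf rq); move: p0r p1r; rewrite !inE !(eq_sym _ r0).
    by move=> /negPf-> /negPf->.
  by rewrite /=; case: (z == b); case: (z == p0); case: (z == p1); case: (z \in q).
rewrite e1 in nC; apply: (path_not_neg m_cox _ _ _ _ nC) => //.
- by rewrite cons_uniq (cons_uniq p0) uq andbT !inE !negb_or p1q p0q (eq_sym p1 p0) p01 (eq_sym p1 b) b1 (eq_sym p0 b) b0.
- rewrite /= (edge_sym m_cox p1) epp (edge_sym m_cox p1 b) nebp (edge_sym m_cox p0 b) ebp iq.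
  rewrite andbT /=; apply/andP; split;
    by apply/allP => z zq; move/crossP: pq; apply => //; rewrite !inE eqxx ?orbT.
- by rewrite /= (light_sym m_cox p1) lpp (light_sym m_cox p0) lbp.
Qed.

Theorem two_coranks C x y : conn C -> nonaff C -> x \in C -> y \in C -> x != y ->
  negt (C :\ x) -> negt (C :\ y) -> negt C \/ (C = [set x; y] /\ odd_diagram_edge m x y).
Proof.
move=> cC aff xC yC xy nx ny.
case: (classification m_cox aff cC) => [hC|hC|hC|[hC|hC]].
- by left; exact: allowed_negt.
- right; move: hC => [b [p [p0 up ip lp eC]]]; rewrite eC in xC yC nx ny.
  have edge z w : light z w -> z != w -> odd_diagram_edge m z w.
    by move=> /eqP h zw; rewrite /odd_diagram_edge /diagram_edge zw h.
  have mem z : z \in seqset (b :: p) -> z \in b :: p by rewrite inE.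
  (* One of [x] and [y] must be [b], which forces the path to have two vertices. *)
  case: (path_corank m_cox up ip lp (mem _ xC) nx) => [[xb p1]|[p2 ep]].
    case: p p0 p1 {ip mem} up lp eC xC yC nx ny => [|z [|]] // _ _ up lp eC xC yC nx ny.
    have yz : y = z by move: yC xy; rewrite xb !inE (eq_sym b) => /orP[->//|/eqP].
    rewrite eC xb yz; split; first by apply/setP => w; rewrite !inE.
    by apply: edge; [move: lp => /= /andP[]|rewrite -xb -yz].
  case: (path_corank m_cox up ip lp (mem _ yC) ny) => [[yb p1]|[p2' ep']]; last first.
    by move: ep' xy; rewrite ep => -[->]; rewrite eqxx.
  case: p2 ep => [|? ?] ep; last by rewrite ep in p1.
  rewrite eC ep yb; split; first by apply/setP => w; rewrite !inE orbC.
  apply: edge; last by rewrite -yb.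
  by rewrite (light_sym m_cox); move: lp; rewrite ep /= => /andP[].
- right; move: hC => [u [v [n [uv muv on n3 eC]]]]; rewrite eC in xC yC *.
  have euv : odd_diagram_edge m u v by rewrite /odd_diagram_edge /diagram_edge uv muv n3 on.
  have evu : odd_diagram_edge m v u.
    by rewrite /odd_diagram_edge /diagram_edge eq_sym uv (m_sym m_cox) muv n3 on.
  move: xC yC xy; rewrite !inE => /orP[/eqP->|/eqP->] /orP[/eqP->|/eqP->]; rewrite ?eqxx // => _.
  by split=> //; exact: setUC.
- move: hC => [b [p [f [g [st [lp lf lg] op p0 eC]]]]]; rewrite eC in xC yC nx ny.
  have ex := D_corank m_cox st lp lf lg op p0 xC nx.
  have ey := D_corank m_cox st lp lf lg op p0 yC ny.
  by rewrite ex ey eqxx in xy.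
move: hC => [b [p [q [r [st [lp lq lr] [sp sq sr] eC]]]]]; rewrite eC in xC nx.
by case: (E6_corank st lp lq lr sp sq sr xC nx).
Qed.

End Corank.

(** * The odd graph *)

Section OddGraph.
Variables (I : finType) (m : I -> I -> option nat).
Hypothesis m_cox : coxeter_matrix m.
Variables (R : realFieldType) (c : cosine_table R).
Variables (W : groupType) (s : I -> W).
Hypothesis W_cox : coxeter_system m s.
Implicit Types (x y z a b : I) (i j k n : nat) (C J K L M N X : {set I}) (w g : W).
Implicit Types (t u : seq I).
Local Notation e := (diagram_edge m).
Local Notation negt := (negt m c).
Local Notation negw := (negw m_cox c W_cox).
Local Notation nonaff := (nonaff m c).
Local Notation conn := (conn m).
Local Notation delta := (@delta I R).
Local Notation act := (act m_cox c W_cox).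
Local Notation inW := (std_parabolic s).
Local Notation word := (word s).
Local Notation closedin := (closedin m).
Local Notation maps := (maps m_cox c W_cox).
Local Notation step := (step m_cox c W_cox).
Local Notation inWP := (inWP m_cox W_cox).

(** Odd-adjacency in terms of the diagram, with [l = 1]: the common part [X] is not joined to the
    odd edge. *)
Definition oddflip J K := exists a b X, [/\ J = a |: X, K = b |: X,
  a \notin X /\ b \notin X, odd_diagram_edge m a b
  & forall z, z \in X -> ~~ e a z /\ ~~ e b z].

Lemma odd_edge_sym a b : odd_diagram_edge m a b = odd_diagram_edge m b a.
Proof. by rewrite /odd_diagram_edge (edge_sym m_cox) (m_sym m_cox). Qed.

Lemma oddflip_sym J K : oddflip J K -> oddflip K J.
Proof.
move=> [a [b [X [eJ eK [aX bX] ab h]]]]; exists b, a, X; split=> //.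
  by rewrite odd_edge_sym.
by move=> z /h[].
Qed.

Lemma closed_act N K w v : closedin K N -> inW N w -> supp K v -> supp K (act w v).
Proof.
by move=> cl /inWP[u uN ->] sv; rewrite act_word; case: (closed_actw m_cox c cl uN sv).
Qed.

Lemma maps_supp (u : W) J K v : maps u J K -> supp J v -> supp K (act u v).
Proof.
move=> [f hf <-] sv; rewrite (act_supp_sum m_cox c W_cox u sv) => l lK.
by rewrite sum_ffunE big1 // => x xJ; rewrite ffunE hf // (supp_delta R (imset_f _ xJ) lK) scaler0.
Qed.

Lemma maps_supp_inv (u : W) J K v : maps u J K -> supp K v -> supp J (act u^-1 v).
Proof.
move=> [f hf fK] sv; rewrite (act_supp_sum m_cox c W_cox _ sv) => l lJ.
rewrite sum_ffunE big1 // => x; rewrite -fK => /imsetP[y yJ ->].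
by rewrite ffunE -hf // actVK (supp_delta R yJ lJ) scaler0.
Qed.

Lemma step_oddflip J J' : negt J -> negt J' -> step J J' -> J = J' \/ oddflip J J'.
Proof.
move=> nJ nJ' [x [u [xJ uN mu J'N uneg]]]; set N := x |: J in uN J'N.
have cJ := maps_card mu.
have [->|JJ'] := eqVneq J J'; [by left|right].
have cN : #|N| = #|J|.+1 by rewrite /N cardsU1 xJ.
have xJ' : x \in J'.
  apply: contraNT JJ' => xJ'; rewrite eq_sym eqEcard -cJ leqnn andbT.
  apply/subsetP => z zJ'; have := subsetP J'N z zJ'.
  by rewrite !inE => /orP[/eqP zx|//]; rewrite -zx zJ' in xJ'.
have [y yN yJ'] : exists2 y, y \in N & y \notin J'.
  have : J' \proper N by rewrite properEcard J'N cN -cJ ltnS leqnn.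
  by case/properP => _ [y]; exists y.
have yx : y != x by apply: contraNneq yJ' => ->.
have yJ : y \in J by move: yN; rewrite !inE (negPf yx).
have eJ : J = N :\ x by rewrite /N setU1K.
have eJ' : J' = N :\ y.
  apply/eqP; rewrite eqEcard subsetD1 J'N yJ' /= -cJ.
  by have := cardsD1 y N; rewrite yN cN add1n => -[->].
have /(negtP m_cox c W_cox)[wJ hwJ] := nJ.
(* This is the longest element of [W_N], as [wneg] shows below. *)
pose w := (u * wJ)%g.
have wN : inW N w.
  apply: inWM => //; apply: (inWS m_cox W_cox _ hwJ.1); exact: subsetUr.
(* [wJ] changes the root of [x] only along [V_J], which [u] maps into [V_J'], and [y] is not in
   [J']. *)
have wx_y : act w (delta x) y = act u (delta x) y.
  have sv := act_sub_supp m_cox c W_cox (delta x) hwJ.1; set v := _ - _ in sv.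
  have ev : act wJ (delta x) = delta x + v by rewrite addrC subrK.
  rewrite /w actM ev linearD /= [LHS]ffunE.
  by rewrite (maps_supp mu sv yJ') addr0.
(* Otherwise [u] would send the root of [x] into [V_J'], the image of [V_J], and [x] would lie in
   [J]. *)
have ux_y : act u (delta x) y != 0.
  apply/eqP => uxy; have : supp J' (act u (delta x)).
    move=> z zJ'; have [->//|zy] := eqVneq z y.
    apply: (supp_act m_cox c W_cox uN); last first.
      by apply: contra zJ' => zN; rewrite eJ' in_setD1 zy.
    by apply: supp_delta; rewrite !inE eqxx.
  move/(maps_supp_inv mu); rewrite actVK => /(_ x xJ).
  by rewrite deltaii => /eqP; rewrite oner_eq0.
have wneg z : z \in N -> nonneg (- act w (delta z)).
  rewrite !inE => /orP[/eqP->|zJ].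
    have := root_sign m_cox c W_cox w x => -[h|//]; exfalso.
    have h1 := h y; have h2 := uneg y; move: ux_y; rewrite ffunE in h2.
    move: h1; rewrite wx_y; move: h2; move: (act u (delta x) y : R) => r r1 r2 /eqP; apply.
    by apply/eqP; rewrite eq_le r2 andbT; lra.
  rewrite /w actM hwJ.2 // linearN /= opprK; have [f hf _] := mu.
  by rewrite hf //; exact: nonneg_delta.
have affN : nonaff N by apply: (fint_nonaff (W_cox := W_cox)); exists w.
have xN : x \in N by rewrite !inE eqxx.
pose C := comp m N x; have clC : closedin C N := comp_closed m xN.
have xC : x \in C := comp_refl m N x.
have connC : conn C := comp_conn m_cox xN.
clearbody C.
have yC : y \in C.
  apply: contraT => yC; move: ux_y; rewrite -wx_y.
  by rewrite (closed_act clC wN (supp_delta R xC)) ?eqxx.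
have CN := subsetP clC.1.
have sub z A B : A = B :\ z -> z \in C -> closedin C B -> closedin (C :\ z) A.
  move=> -> zC [CB h]; split; first exact: setSD.
  move=> p q; rewrite !inE => /andP[pz pC] /andP[qz qB]; rewrite qz /= => qC.
  exact: h.
have nCx : negt (C :\ x) by apply: negt_closed nJ => //; exact: sub clC.
have nCy : negt (C :\ y) by apply: negt_closed nJ' => //; exact: sub clC.
have affC : nonaff C := nonaffS clC.1 affN.
have xy : x != y by rewrite eq_sym.
case: (two_coranks m_cox connC affC xC yC xy nCx nCy) => [nC|[eC oxy]].
  (* If -1 were realized on [C] it would be on all of [N], and then it would be [w]; but [w] moves
     the root of [x] to one involving [y]. *)
  exfalso; have clD : closedin (N :\: C) J.
    split.
      apply/subsetP => z; rewrite eJ !inE => /andP[zC ->]; rewrite andbT.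
      by apply: contraNneq zC => ->.
    move=> p q; rewrite in_setD => /andP[pC pN] qJ; rewrite in_setD negb_and negbK.
    have qN : q \in N by rewrite !inE qJ orbT.
    by rewrite qN orbF => qC; rewrite (edge_sym m_cox); apply: clC.2.
  have nN : negt N.
    have -> : N = C :|: (N :\: C) by rewrite setDE setUIr setUCr setIT (setUidPr clC.1).
    apply: (negt_union m_cox) nC (negt_closed m_cox clD nJ).
      by rewrite -setI_eq0; apply/eqP/setP => z; rewrite !inE; case: (z \in C).
    by move=> p q pC; rewrite in_setD => /andP[qC qN]; apply: clC.2.
  have /(negtP m_cox c W_cox)[w' hw'] := nN.
  have ww : w = w'.
    apply: (neg_unique wN hw'.1 wneg) => z zN.
    by rewrite hw'.2 // opprK; exact: nonneg_delta.
  move: ux_y; rewrite -wx_y ww hw'.2 // ffunE deltaE (negPf yx).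
  by rewrite mulr0n oppr0 eqxx.
exists y, x, (N :\: C); split.
- rewrite eJ eC; apply/setP => z; rewrite !inE.
  have [->|zy] := eqVneq z y; first by rewrite yx yJ orbT.
  by rewrite orbF; case: (z == x).
- rewrite eJ' eC; apply/setP => z; rewrite !inE.
  have [->|zx] := eqVneq z x; first by rewrite xy.
  by case: (z == y).
- by rewrite !in_setD xC yC.
- by rewrite odd_edge_sym.
move=> z; rewrite in_setD => /andP[zC zN].
by split; apply: clC.2.
Qed.

(** The images of [delta y] under the two products have opposite coordinates [2 * bform x y] and
    [- 2 * bform x y] at [x]. *)
Lemma commute_nonedge x y : x != y -> (s x * s y = s y * s x)%g -> ~~ e x y.
Proof.
move=> xy cm; apply/negP => exy; have := b_edge c exy.
have := congr1 (fun w => act w (delta y) x) cm.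
rewrite !actM !act_s (refl_delta m_cox) linearN /= [RHS]reflEne //.
rewrite [LHS]ffunE !reflE h_delta !deltaE eqxx (negPf xy) mulr1 sub0r opprK.
by move: (bform m c x y) => r h1 h2; have : 2 * r = - (2 * r) := h1; lra.
Qed.

Lemma nonedge_commute x y : x != y -> ~~ e x y -> (s x * s y = s y * s x)%g.
Proof.
move=> xy h; have mxy := m_nonedge m_cox xy h.
have : ((s x * s y) ^+ 2 = 1)%g by case: W_cox => + _ _; apply.
rewrite expg2 => /mulg1_eq <-.
by rewrite invgM !(sV m_cox W_cox).
Qed.

(** [w] changes vectors both along [V_L] and along [V_X], which meet in 0. *)
Lemma parabolic_inter L X w : [disjoint L & X] -> inW L w -> inW X w -> w = 1%g.
Proof.
move=> dj wL wX; apply: (@faithful _ _ m_cox R c _ _ W_cox) => x.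
have h1 := act_sub_supp m_cox c W_cox (delta x) wL.
have h2 := act_sub_supp m_cox c W_cox (delta x) wX.
apply/eqP; rewrite -subr_eq0; apply/eqP/ffunP => z; rewrite [RHS]ffunE.
case: (boolP (z \in L)) => zL; last by rewrite h1.
by rewrite h2 // (disjointFr dj zL).
Qed.

Lemma s_neq1 x : s x <> 1%g.
Proof.
move=> h; have := congr1 (fun w => act w (delta x) x) h.
rewrite act_s act1 (refl_delta m_cox) ffunE deltaii => h'.
by have : (- 1 : R) = 1 := h'; lra.
Qed.

Lemma inW1P x w : inW [set x] w <-> w = 1%g \/ w = s x.
Proof.
split=> [/inWP[u uJ ->]|[->|->]]; last by apply: inWs; rewrite inE.
  elim: u uJ => [|y u IH] uJ; first by left; rewrite word_nil.
  have yx : y = x by have := uJ y (mem_head _ _); rewrite inE => /eqP.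
  have [|h|h] := IH; first by move=> z zu; apply: uJ; rewrite inE zu orbT.
    by right; rewrite word_cons yx h mulg1.
  by left; rewrite word_cons yx h (ss m_cox W_cox).
exact: inW1.
Qed.

Lemma rank1_2group x : elementary_2group (inW [set x]) 1.
Proof.
exists (fun v : 'rV['Z_2]_1 => if v 0 0 == 0 then 1%g else s x); split.
- move=> u v; rewrite mxE.
  have H (p q : 'Z_2) : (if p + q == 0 then 1%g else s x) =
      ((if p == 0 then 1 else s x) * (if q == 0 then 1 else s x))%g.
    case: p => [[|[|//]] hp]; case: q => [[|[|//]] hq]; rewrite /= ?mulg1 ?mul1g //.
    by rewrite (ss m_cox W_cox).
  exact: H.
- move=> u v h; apply/matrixP => i j; rewrite !ord1.
  have H (p q : 'Z_2) : (if p == 0 then 1%g else s x) = (if q == 0 then 1%g else s x) -> p = q.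
    case: p => [[|[|//]] hp]; case: q => [[|[|//]] hq] //= h'; apply/val_inj => //=.
      by case: (@s_neq1 x).
    by case: (@s_neq1 x).
  exact: H.
apply/seteqP; split => w.
  by move=> [v _ <-]; apply/inW1P; case: ifP; [left|right].
move=> /inW1P[->|->].
  by exists 0 => //; rewrite mxE eqxx.
by exists (const_mx 1) => //; rewrite mxE.
Qed.

Lemma oddflip_adjacent J K : oddflip J K -> odd_adjacent m s J K.
Proof.
move=> [a [b [X [eJ eK [aX bX] ab h]]]].
have abn : a != b by case/andP: ab => /andP[].
have idp x A : A = x |: X -> x \notin X -> (forall z, z \in X -> ~~ e x z) ->
    internal_direct_product (inW [set x]) (inW X) (inW A).
  move=> -> xX hx.
  have cm p q : inW [set x] p -> inW X q -> (p * q = q * p)%g.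
    move=> /inW1P[->|->]; first by rewrite mul1g mulg1.
    move=> /inWP[t tX ->]; elim: t tX => [|z t IH] tX; first by rewrite word_nil mulg1 mul1g.
    have zX : z \in X by apply: tX; exact: mem_head.
    rewrite word_cons mulgA nonedge_commute ?hx //; last by apply: contraNneq xX => ->.
    rewrite -!mulgA IH // => z' zt; apply: tX; by rewrite inE zt orbT.
  split=> //.
    apply/seteqP; split => w /=; last by move=> ->; split; exact: inW1.
    move=> [w1 w2]; apply: (parabolic_inter _ w1 w2).
    by rewrite disjoints1.
  apply/seteqP; split => w /=.
    move=> /inWP[t tX ->]; elim: t tX => [|z t IH] tX.
      by exists 1%g; [exact: inW1|exists 1%g; [exact: inW1|rewrite mulg1 word_nil]].
    have [|p pL [q qX pq]] := IH; first by move=> z' zt; apply: tX; rewrite inE zt orbT.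
    rewrite word_cons -pq; have := tX z (mem_head _ _); rewrite in_setU1 => /orP[/eqP->|zX].
      exists (s x * p)%g; last by exists q => //; rewrite mulgA.
      by apply: inWM => //; apply: inWs; rewrite inE.
    exists p => //; exists (s z * q)%g; first by apply: inWM => //; exact: inWs.
    by rewrite mulgA (cm p (s z)) ?mulgA //; exact: inWs.
  move=> [p pL [q qX <-]]; apply: inWM.
    by apply: (inWS m_cox W_cox _ pL); rewrite sub1set !inE eqxx.
  by apply: (inWS m_cox W_cox _ qX); exact: subsetUr.
exists 1%N, [set a]%SET, [set b]%SET, X; split=> //; split.
- split=> //; last by apply: idp => // z /h[].
  by apply/eqP; rewrite setI_eq0 disjoints1.
- split=> //; last by apply: idp => // z /h[].
  by apply/eqP; rewrite setI_eq0 disjoints1.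
- exact: rank1_2group.
- exact: rank1_2group.
exists a, b; split=> //.
  by apply/setP => z; rewrite !inE; case: eqP => // ->; rewrite eq_sym (negPf abn).
by apply/setP => z; rewrite !inE; case: eqP => // ->; rewrite (negPf abn).
Qed.

(** [W_L] and [W_M] are abelian, so the vertices common to [L] and [M] are joined neither to [a] nor
    to [b] and can be moved into [X]. *)
Lemma adjacent_oddflip J K : odd_adjacent m s J K -> oddflip J K.
Proof.
move=> [l [L [M [X [_ [[eJ LX dL] [eK MX dM] eL eM [a [b [LM ML ab]]]]]]]]].
have abel A n : elementary_2group (inW A) n ->
    forall p q, inW A p -> inW A q -> (p * q = q * p)%g.
  move=> [phi [pD _ rg]] p q; rewrite -rg => -[v _ <-] [v' _ <-].
  by rewrite -!pD addrC.
have [aL aM] : a \in L /\ a \notin M.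
  by have := set11 a; rewrite -LM in_setD => /andP[].
have [bM bL] : b \in M /\ b \notin L.
  by have := set11 b; rewrite -ML in_setD => /andP[].
have ndj A z : A :&: X = set0 -> z \in A -> z \notin X.
  by move=> h zA; apply/negP => zX; have := in_set0 z; rewrite -h inE zA zX.
exists a, b, (X :|: (L :&: M)); split=> //.
- rewrite eJ; apply/setP => z; rewrite !inE.
  have := congr1 (fun A : {set I} => z \in A) LM; rewrite !inE.
  by case: (z \in L); case: (z \in M); case: (z \in X); case: (z == a).
- rewrite eK; apply/setP => z; rewrite !inE.
  have := congr1 (fun A : {set I} => z \in A) ML; rewrite !inE.
  by case: (z \in L); case: (z \in M); case: (z \in X); case: (z == b).
- by rewrite !inE (negPf aM) (negPf bL) andbF andFb !orbF (ndj L) ?(ndj M).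
move=> z; rewrite !inE => /orP[zX|/andP[zL zM]].
  have [d1 _ _] := dL; have [d2 _ _] := dM.
  split; apply: commute_nonedge.
  - by apply: contraTneq zX => <-; exact: ndj aL.
  - by apply: d1; exact: inWs.
  - by apply: contraTneq zX => <-; exact: ndj bM.
  - by apply: d2; exact: inWs.
split; apply: commute_nonedge.
- by apply: contraNneq aM => ->.
- by apply: (abel _ _ eL); exact: inWs.
- by apply: contraNneq bL => ->.
- by apply: (abel _ _ eM); exact: inWs.
Qed.

Lemma oddflip_conj J K w w' : oddflip J K -> negw J w -> negw K w' ->
  exists g, w' = (w ^ g)%g.
Proof.
move=> [a [b [X [eJ eK [aX bX] ab h]]]] hw hw'.
case/andP: (ab) => eab; case E: (m a b) => [n|//] on; have abn := edge_neq eab.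
have n1 := m_ge2 m_cox abn E.
have bx : - bform m c a b = c n by rewrite /bform E opprK.
have U0 : cheb (c n) n = 0 by rewrite cheb_ct_n.
have U1 : cheb (c n) n.+1 = -1 by rewrite cheb_ct_Sn.
have U2 : cheb (c n) n.-1 = 1.
  have : cheb (c n) n.-1.+2 = 2 * c n * cheb (c n) n.-1.+1 - cheb (c n) n.-1 by exact: chebSS.
  by rewrite (prednK (ltnW n1)) U0 U1; lra.
(* As [n] is odd, this alternating word of even length rotates the root of [a] onto that of [b]; its
   letters fix the roots of [X]. *)
pose r := word (alt a b n.-1).
have ra : act r (delta a) = delta b.
  have on' : odd n.-1 = false by case: (n) on => //= k; move/negbTE.
  by rewrite act_word (alt_act0 m_cox) on' bx (prednK (ltnW n1)) U0 U2 scale0r scale1r add0r.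
have rz z : z \in X -> act r (delta z) = delta z.
  move=> zX; rewrite act_word actw_fix // => y /mem_alt.
  have [h1 h2] := h z zX; case=> ->; rewrite h_delta (b_nonedge m_cox) //.
    by apply: contraNneq aX => ->.
  by apply: contraNneq bX => ->.
have mp : maps r J K.
  exists (fun z => if z == a then b else z).
    move=> z; rewrite eJ in_setU1; case: eqP => [->//|_ /= zX]; exact: rz.
  rewrite eJ eK; apply/setP => z; apply/imsetP/idP.
    move=> [y]; rewrite !in_setU1; case: eqP => [_ _ ->|_ /= yX ->]; first by rewrite eqxx.
    by rewrite yX orbT.
  rewrite in_setU1 => /orP[/eqP->|zX].
    by exists a; rewrite ?eqxx // in_setU1 eqxx.
  exists z; first by rewrite in_setU1 zX orbT.
  by case: eqP zX aX => // -> ->.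
exists (r^-1)%g; rewrite conjgE invgK.
by rewrite (negw_unique hw' (maps_conj mp hw)) mulgA.
Qed.

(** The list of types in the definition of the odd graph is traded for the realizability of -1,
    component by component. *)
Lemma vertexP k J : odd_graph_vertex m k J <-> #|J| = k /\ negt J.
Proof.
split=> [[cJ h]|[cJ nJ]]; split=> //.
  apply: (negt_comps m_cox) => x xJ.
  have [|t ta ht] := h (comp m J x); first by exists x.
  by apply: (allowed_negt m_cox); exists t.
move=> C [x xJ eC]; have -> : C = comp m J x by [].
apply: (neg_allowed m_cox W_cox); last exact: (comp_conn m_cox).
exact: (negt_comp m_cox xJ nJ).
Qed.

Local Notation oge := (odd_graph_edge m s).

Lemma ogeP k J K : reflect [/\ #|J| = k, negt J, #|K| = k, negt K & oddflip J K] (oge k J K).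
Proof.
apply: (iffP idP) => [/asboolP[/vertexP[? ?] /vertexP[? ?] /adjacent_oddflip ?]//|[? ? ? ? ?]].
by apply/asboolP; split; [apply/vertexP|apply/vertexP|exact: oddflip_adjacent].
Qed.

Lemma oge_sym k : symmetric (oge k).
Proof.
move=> J K; apply/ogeP/ogeP => -[? ? ? ? /oddflip_sym ?]; by split.
Qed.

Lemma connect_vertex k J K : odd_graph_vertex m k J -> connect (oge k) J K ->
  odd_graph_vertex m k K.
Proof.
move=> vJ /connectP[p pp ->]; elim: p J vJ pp => //= A p IH J vJ /andP[/ogeP[_ _ ? ? _] pp].
by apply: IH pp; apply/vertexP.
Qed.

Lemma connect_conj k J K w w' : odd_graph_vertex m k J -> connect (oge k) J K ->
  negw J w -> negw K w' -> exists g, w' = (w ^ g)%g.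
Proof.
move=> vJ /connectP[p pp ->]; elim: p J w vJ pp => /= [|A p IH] J w vJ pp hw hw'.
  by exists 1%g; rewrite conjg1; exact: negw_unique hw' hw.
case/andP: pp => ed pp; have [_ _ cA nA fl] := ogeP _ _ _ ed.
have /(negtP m_cox c W_cox)[wA hA] := nA.
have [g eg] := oddflip_conj fl hw hA.
have [|h eh] := IH A wA _ pp hA hw'; first by apply/vertexP.
by exists (g * h)%g; rewrite conjgM -eg.
Qed.

Lemma conj_connect k J K w w' g : #|J| = k -> negw J w -> negw K w' ->
  (w' = g * w * g^-1)%g -> connect (oge k) J K.
Proof.
move=> cJ hw hw' eg; have [z mz] := conj_negw hw hw' eg.
have nJ : negt J by apply/(negtP m_cox c W_cox); exists w.
(* The cardinality is carried along since edges of the odd graph join sets of exactly [k]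
   elements. *)
pose E (A B : {set I}) := #|A| = k -> #|B| = k /\ connect (oge k) A B.
have := @maps_chain _ _ m_cox _ c _ _ W_cox E z J K; case=> //.
- move=> B A D h1 h2 /h1[cB AB]; have [cD BD] := h2 cB.
  by split=> //; exact: connect_trans AB BD.
- move=> A B nA nB st cA; have cB : #|B| = k.
    by have [i [u [_ _ /maps_card <- _ _]]] := st.
  split=> //; case: (step_oddflip nA nB st) => [->//|fl].
  by apply: connect1; apply/ogeP.
Qed.

Lemma conj_class_conj w g : conj_class (w ^ g)%g = conj_class w.
Proof.
apply/seteqP; split => x [h _ <-].
  by exists (g * h)%g => //; rewrite conjgM.
by exists (g^-1 * h)%g => //; rewrite -conjgM mulgA mulgV mul1g.
Qed.

Lemma negw_involution_rank k J w : (0 < k)%N -> #|J| = k -> negw J w ->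
  involution_rank s w k.
Proof.
move=> k0 cJ hw; split; [split|].
- move=> w1; have [x xJ] : exists x, x \in J by apply/set0Pn; rewrite -card_gt0 cJ.
  have := hw.2 x xJ; rewrite w1 act1 => h.
  have := @delta_not_neg I R x; rewrite -h; apply; exact: nonneg_delta.
- exact: negwK hw.
exists (inW J); first exact: (negw_closure hw).
exists J, 1%g; split=> //; apply/seteqP; split => x.
  by move=> xJ; exists x => //; rewrite conjg1.
by move=> [y yJ <-]; rewrite conjg1.
Qed.

(** Minimality, used in both directions, identifies the closure of [w] with a conjugate of [W_J];
    then [parabolic_card] compares the ranks. *)
Lemma involution_rank_neg k w : involution_rank s w k ->
  exists J g, #|J| = k /\ negw J (w ^ g)%g.
Proof.
move=> [[_ ww] [P [[K [h eP]] Pw minP] [K' [h' [eP' cK']]]]].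
have [J [g hJ]] := involution_conj_neg m_cox c W_cox ww; exists J, g; split=> //.
rewrite -cK'; apply: (parabolic_card m_cox c W_cox (g := (g^-1)%g) (h := h')).
rewrite -eP'; apply/seteqP; split => x.
  move=> [y yJ <-].
  have : conj_set (inW K) (h * g)%g (w ^ g)%g.
    move: Pw; rewrite eP => -[z zK <-]; exists z => //; exact: conjgM.
  move/(negw_in_parabolic hJ)/(_ y yJ) => [z zK <-]; rewrite eP; exists z => //.
  by rewrite -conjgM mulgK.
apply: minP; first by exists J, (g^-1)%g.
by exists (w ^ g)%g; [case: hJ|rewrite conjgK].
Qed.

Theorem components_bijection k : (0 < k)%N ->
  exists f : {set {set I}} -> set W,
    set_bij (odd_graph_components m s k) (involution_classes s k) f /\
    forall (C : {set {set I}}) (J : {set I}),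
      odd_graph_components m s k C -> J \in C ->
      exists w : W, unique (longest s J) w /\ f C = conj_class w.
Proof.
(* A union over all vertices of [C], so that no vertex has to be chosen; [fE] shows that it is a
   single conjugacy class. *)
move=> k0; pose f (C : {set {set I}}) : set W :=
  [set x | exists J w, [/\ J \in C, negw J w & conj_class w x]]%classic.
have csym : connect_sym (oge k) by apply: sym_connect_sym; exact: oge_sym.
have inC J0 J : (J \in finset (connect (oge k) J0)) = connect (oge k) J0 J by rewrite inE.
have fE (C : {set {set I}}) J w : odd_graph_components m s k C -> J \in C -> negw J w ->
    f C = conj_class w.
  move=> [J0 vJ0 <-]; rewrite inC => cJ hw; apply/seteqP; split => x.
    move=> [J' [w' []]]; rewrite inC => cJ' hw' xw'.
    have vJ := connect_vertex vJ0 cJ.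
    have JJ' : connect (oge k) J J' by rewrite csym in cJ; exact: connect_trans cJ cJ'.
    have [g eg] := connect_conj vJ JJ' hw hw'.
    by move: xw'; rewrite eg conj_class_conj.
  by move=> xw; exists J, w; rewrite inC.
have vert (C : {set {set I}}) J : odd_graph_components m s k C -> J \in C -> exists w, #|J| = k /\ negw J w.
  move=> [J0 vJ0 <-]; rewrite inC => /(connect_vertex vJ0)/vertexP[cJ].
  by move=> /(negtP m_cox c W_cox)[w hw]; exists w.
have rep (C : {set {set I}}) : odd_graph_components m s k C -> exists J w, [/\ J \in C, #|J| = k & negw J w].
  move=> hC; have [J0 vJ0 eC] := hC; have J0C : J0 \in C by rewrite -eC inC connect0.
  by have [w [cJ hw]] := vert C J0 hC J0C; exists J0, w.
exists f; split; last first.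
  move=> C J hC JC; have [w [cJ hw]] := vert C J hC JC.
  by exists w; split; [exact: (negw_longest hw)|exact: fE hw].
split.
- move=> C hC; have [J [w [JC cJ hw]]] := rep C hC.
  by exists w; [exact: negw_involution_rank hw|rewrite (fE C J w)].
- move=> C1 C2 /set_mem h1 /set_mem h2 fC.
  have [J1 [w1 [JC1 c1 hw1]]] := rep C1 h1; have [J2 [w2 [JC2 c2 hw2]]] := rep C2 h2.
  have : conj_class w2 w2 by exists 1%g => //; rewrite conjg1.
  rewrite -(fE C2 J2 w2) // -fC (fE C1 J1 w1) // => -[g _ eg].
  have cc : connect (oge k) J1 J2.
    apply: (conj_connect (g := (g^-1)%g) c1 hw1 hw2).
    by rewrite -eg conjgE invgK mulgA.
  have [A1 _ e1] := h1; have [A2 _ e2] := h2.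
  move: JC1 JC2; rewrite -e1 -e2 !inC => a1 a2.
  apply/setP => B; rewrite !inC; apply: same_connect => //.
  by apply: (connect_trans a1); apply: (connect_trans cc); rewrite csym.
move=> X [w hw <-]; have [J [g [cJ hJ]]] := involution_rank_neg hw.
have vJ : odd_graph_vertex m k J.
  by apply/vertexP; split=> //; apply/(negtP m_cox c W_cox); exists (w ^ g)%g.
have hC : odd_graph_components m s k (finset (connect (oge k) J)) by exists J.
exists (finset (connect (oge k) J)) => //.
by rewrite (fE _ J (w ^ g)%g) ?conj_class_conj // inC connect0.
Qed.

End OddGraph.

Import Rstruct.

Theorem corollary1p2 (I : finType) (m : I -> I -> option nat)
    (W : groupType) (s : I -> W) (k : nat)
    (m_coxeter : coxeter_matrix m) (W_coxeter : coxeter_system m s)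
    (k_gt0 : (0 < k)%N) :
  exists f : {set {set I}} -> set W,
    set_bij (odd_graph_components m s k) (involution_classes s k) f /\
    forall (C : {set {set I}}) (J : {set I}),
      odd_graph_components m s k C -> J \in C ->
      exists w : W, unique (longest s J) w /\ f C = conj_class w.
Proof.
(* The statement does not mention a field; the real numbers provide the cosines. *)
exact: (components_bijection m_coxeter (cosm_table (Rdefinitions.R : realType))
  W_coxeter k_gt0).
Qed.
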